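(* Let $0<\alpha<1$, $T>0$, $a\in\mathbb R$ and $\tau_1,\tau_2\in C[0,T]$. Define $$w_1(x,t)=\int_0^tG_\alpha^{2\alpha/3}(x-a,t-\eta)\,\tau_1(\eta)\,d\eta\quad(x\in\mathbb R),\qquad w_2(x,t)=\int_0^tV_\alpha^{2\alpha/3}(x-a,t-\eta)\,\tau_2(\eta)\,d\eta\quad(x\ge a),$$ for $0<t\le T$. Then: (i) $w_1$ and $w_2$ satisfy the homogeneous equation $$\partial_{0t}^{\alpha}w_k(x,t)-\frac{\partial^3w_k(x,t)}{\partial x^3}=0,\qquad 0<t\le T,$$ for all $x\ne a$ when $k=1$, and for all $x>a$ when $k=2$. (ii) $\lim_{t\to0+}w_1(x,t)=0$ for all $x\in\mathbb R$, and $\lim_{t\to0+}w_2(x,t)=0$ for all $x\ge a$.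
   Context: For $0<\alpha<1$ the Caputo fractional derivative is $\partial_{0t}^{\alpha}g(t)=\frac{1}{\Gamma(1-\alpha)}\int_0^t\frac{g'(\tau)}{(t-\tau)^{\alpha}}\,d\tau$, acting in the variable $t$. The Wright function is $\phi(\rho,\mu;z)=\sum_{n=0}^\infty\frac{z^n}{n!\,\Gamma(\rho n+\mu)}$, $-1<\rho<0$, $\mu\in\mathbb C$ (with $1/\Gamma=0$ at the poles of $\Gamma$). For $t>0$, $$G_\alpha^{2\alpha/3}(x,t)=\frac{1}{3t^{1-2\alpha/3}}\begin{cases}\phi\left(-\frac\alpha3,\frac{2\alpha}3;\frac{x}{t^{\alpha/3}}\right),&x<0,\\-2\operatorname{Re}\left[e^{2\pi i/3}\phi\left(-\frac\alpha3,\frac{2\alpha}3;e^{2\pi i/3}\frac{x}{t^{\alpha/3}}\right)\right],&x>0,\end{cases}$$ $$V_\alpha^{2\alpha/3}(x,t)=\frac{1}{3t^{1-2\alpha/3}}\operatorname{Im}\left[e^{2\pi i/3}\phi\left(-\frac\alpha3,\frac{2\alpha}3;e^{2\pi i/3}\frac{x}{t^{\alpha/3}}\right)\right],\quad x>0,$$ both extended by continuity to $x=0$. *)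

(* Defs.v *)
From HB Require Import structures.
From mathcomp Require Import all_boot all_order all_algebra.
From mathcomp Require Import all_classical all_reals all_analysis.
From mathcomp Require Import complex.

Set Implicit Arguments.
Unset Strict Implicit.
Unset Printing Implicit Defensive.

Import Order.TTheory GRing.Theory Num.Theory.
Import numFieldNormedType.Exports.

Local Open Scope classical_set_scope.
Local Open Scope ring_scope.
Local Open Scope complex_scope.

Section Definitions.
Variable R : realType.
Implicit Types (alpha rho mu s t x y : R) (z : R[i]).

Definition euler_gamma x : R :=
  \int[lebesgue_measure]_(s in `]0, +oo[) (s `^ (x - 1) * expR (- s)).

(* For x <= 0, with m the least natural number such that x + m > 0:
   Gamma x = Gamma (x + m) / (x (x + 1) ... (x + m - 1)).
   At the poles the denominator vanishes, so that Gamma x = 0, hence also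
   (Gamma x)^-1 = 0, since 0^-1 = 0: this is the usual convention for 1 / Gamma. *)
Definition Gamma x : R :=
  if 0 < x then euler_gamma x
  else let m := (Num.truncn (- x)).+1 in
       euler_gamma (x + m%:R) / \prod_(i < m) (x + i%:R).

(* The regular algebra R[i]^o carries the topology of the complex modulus. *)
Definition wright rho mu z : R[i] :=
  limn (series (fun n : nat =>
    z ^+ n / n`!%:R * ((Gamma (rho * n%:R + mu))^-1)%:C : R[i]^o)).

(* exp (2 pi i / 3) *)
Definition omega3 : R[i] := cos (2 * pi / 3) +i* sin (2 * pi / 3).

Definition wrightG alpha z : R[i] := wright (- (alpha / 3)) (2 * alpha / 3) z.

Definition rotated_wright alpha x t : R[i] :=
  omega3 * wrightG alpha (omega3 * (x / t `^ (alpha / 3))%:C).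

(* The value at x = 0 is irrelevant here: G and V below replace it. *)
Definition G_off0 alpha x t : R :=
  (3 * t `^ (1 - 2 * alpha / 3))^-1 *
  (if x < 0 then complex.Re (wrightG alpha (x / t `^ (alpha / 3))%:C)
   else - 2 * complex.Re (rotated_wright alpha x t)).

Definition G alpha x t : R :=
  if x == 0 then lim (G_off0 alpha y t @[y --> (0 : R)^']) else G_off0 alpha x t.

Definition V_off0 alpha x t : R :=
  (3 * t `^ (1 - 2 * alpha / 3))^-1 * complex.Im (rotated_wright alpha x t).

(* Only meaningful for x >= 0. *)
Definition V alpha x t : R :=
  if x == 0 then lim (V_off0 alpha y t @[y --> (0 : R)^'+]) else V_off0 alpha x t.

Definition w1 alpha (a : R) (tau : R -> R) x t : R :=
  \int[lebesgue_measure]_(eta in `]0, t[) (G alpha (x - a) (t - eta) * tau eta).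

(* Only meaningful for x >= a. *)
Definition w2 alpha (a : R) (tau : R -> R) x t : R :=
  \int[lebesgue_measure]_(eta in `]0, t[) (V alpha (x - a) (t - eta) * tau eta).

Definition caputo_integrand alpha (g : R -> R) t s : R :=
  derive1 g s / (t - s) `^ alpha.

Definition caputo alpha (g : R -> R) t : R :=
  (Gamma (1 - alpha))^-1 *
  \int[lebesgue_measure]_(s in `]0, t[) caputo_integrand alpha g t s.

(* As derivatives and integrals are total operators, the existence of the
   Caputo derivative has to be stated separately from its value. *)
Definition caputo_derivable alpha (g : R -> R) t : Prop :=
  (forall s, 0 < s < t -> derivable g s 1) /\
  lebesgue_measure.-integrable `]0, t[ (EFin \o caputo_integrand alpha g t).

Definition derivable3 (f : R -> R) x : Prop :=
  \forall y \near x, forall n, (n < 3)%N -> derivable (derive1n n f) y 1.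

Definition solves_at alpha (w : R -> R -> R) x t : Prop :=
  [/\ caputo_derivable alpha (w x) t,
      derivable3 (w ^~ t) x &
      caputo alpha (w x) t - derive1n 3 (w ^~ t) x = 0].

End Definitions.

(* Main.v *)
(** Put [b = alpha / 3] and [q = 1 - 2 b].  Up to constants and away from [x = 0],
    the functions [G] and [V] are sums over both signs of inverse Laplace transforms
    of [e^(+- i theta) p^(q-1) exp (- X e^(+- i psi) p^b)], [X = |x|], with [psi = 0]
    for [x < 0] and [psi = - pi / 3] for [x > 0].  Written as absolutely convergent integrals over
    the imaginary axis, these kernels are smooth in [(X, t)] for [X > 0] and all
    real [t], and they vanish for [t <= 0].  Differentiation in [t] raises [q] by 1,
    differentiation in [X] raises [q] by [b] and multiplies by a phase, and
    fractional integration of order [g] lowers [q] by [g].  The same holds for the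
    convolutions of the kernels with a continuous density, so that both the Caputo
    derivative and the third derivative in [x] of [w] have the exponent [q + 3 b],
    with equal phases since [3 psi] is [0] or [- pi].
    Rotating the rays of integration to the negative axis, expanding the
    exponential of [X p^b] and using the reflection formula for [Gamma] turns the
    kernels into the Wright series. *)

Require Import Defs.
From mathcomp Require Import all_boot all_order all_algebra.
From mathcomp Require Import all_classical all_reals all_analysis.
From mathcomp Require Import measurable_realfun complex ring lra.
Import Order.TTheory GRing.Theory Num.Theory.
Import numFieldNormedType.Exports.
Local Open Scope classical_set_scope.
Local Open Scope ring_scope.

Set Implicit Arguments.
Unset Strict Implicit.
Unset Printing Implicit Defensive.

(** * Integration over real sets *)

(** No complex analysis is used: contour integrals occur only through their imaginary parts, and a
    ray is turned by showing that the integral has derivative zero in the angle. The Wright series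
    gives the kernels for each [t > 0], but says little about [t -> 0], where its argument tends to
    infinity. The integral over the imaginary axis does: its integrand is bounded by a power of [r]
    times [exp (- c X r^b)], uniformly in [t]. This decay, needed on the rays of both signs, is what
    restricts [b] to [b < 1/3]. Off [x = a] the limit at [t = 0] is then mere continuity. Two points
    need separate care. The fractional integral of one half of a kernel over the half-line does not
    converge absolutely, because such a half is only bounded in time; it is regularised by
    [exp (- e v)]. And at [x = a] the decay in [r] is lost: the kernel degenerates to a multiple of
    [t^(2 b - 1)], an integrable singularity that is treated directly. *)

Local Notation leb := lebesgue_measure.
Local Notation intble A f := (leb.-integrable A (EFin \o f)).

Ltac mfun := repeat first
  [ done
  | exact: measurable_fst | exact: measurable_snd | exact: measurable_id
  | exact: measurable_cst
  | apply: measurable_funD | apply: measurable_funB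
  | apply: measurable_funM | apply: measurable_funN | apply: measurable_funX
  | apply: (measurableT_comp (@measurable_expR _))
  | apply: (measurableT_comp (continuous_measurable_fun (@continuous_sin _)))
  | apply: (measurableT_comp (continuous_measurable_fun (@continuous_cos _)))
  | apply: (measurableT_comp (@measurable_powR _ _)) ].

(* The measure space [measurableTypeR R] underlying [lebesgue_measure] and the
   canonical measurable structure of [R] are convertible but not unifiable. *)
Local Notation msetR A := (@measurable _ (measurableTypeR _) A).
Local Notation mfunR A f := (@measurable_fun _ _ (measurableTypeR _) _ A f).

Local Notation D := `]0, +oo[%classic.

Section RealIntegrals.
Context {R : realType}.
Implicit Types (A B : set R) (f g : R -> R).

Lemma intble_dom A f g : msetR A -> mfunR A f -> intble A g ->
  (forall x, A x -> `|f x| <= g x) -> intble A f.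
Proof.
move=> mA mf ig fg; apply: le_integrable ig => //; first exact/measurable_EFinP.
by move=> x Ax /=; rewrite lee_fin (le_trans (fg x Ax))// ler_norm.
Qed.

Lemma mfunTS A f : measurable_fun setT f -> mfunR A f.
Proof.
move=> mf; have mf' : mfunR setT f := mf.
exact: measurable_funTS mf'.
Qed.

Lemma intbleZ A f (k : R) : msetR A -> intble A f ->
  intble A (fun x => k * f x).
Proof. by move=> mA fi; have := integrableZl mA k fi. Qed.

Lemma intbleD A f g : msetR A -> intble A f -> intble A g ->
  intble A (fun x => f x + g x).
Proof. by move=> mA fi gi; have := integrableD mA fi gi. Qed.

Lemma intble_eq A f g : msetR A -> (forall x, A x -> f x = g x) ->
  intble A f -> intble A g.
Proof.
by move=> mA fg; apply: eq_integrable => // x /set_mem Ax /=; rewrite fg.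
Qed.

Lemma le_normr_Rint A f g : msetR A -> mfunR A f -> intble A g ->
  (forall x, A x -> `|f x| <= g x) ->
  `|\int[leb]_(x in A) f x| <= \int[leb]_(x in A) g x.
Proof.
move=> mA mf ig fg; have fi := intble_dom mA mf ig fg.
apply: (le_trans (le_normr_Rintegral mA fi)); apply: le_Rintegral => //.
exact: (integrable_norm fi).
Qed.

Lemma dct A (f_ : nat -> R -> R) f g : msetR A ->
  (forall n, mfunR A (f_ n)) -> intble A g ->
  (forall x, A x -> f_ n x @[n --> \oo] --> f x) ->
  (forall n x, A x -> `|f_ n x| <= g x) ->
  intble A f /\
  \int[leb]_(x in A) f_ n x @[n --> \oo] --> \int[leb]_(x in A) f x.
Proof.
move=> mA mf ig ff fg.
have mf' n : mfunR A (EFin \o f_ n) by exact/measurable_EFinP.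
have ff' x : A x -> (EFin \o f_ n) x @[n --> \oo] --> (EFin \o f) x.
  by move=> Ax; apply: cvg_EFin; [exact: nearW|exact: ff].
have mfl : mfunR A (EFin \o f) by exact: emeasurable_fun_cvg mf' ff'.
have [||fi _ c] := @dominated_convergence _ _ _ leb A mA _ _ _ mf' mfl _ ig.
- exact: aeW.
- by apply: aeW => x n Ax /=; rewrite lee_fin fg.
split=> //; apply: (@fine_cvg _ _ _ _ _ (\int[leb]_(x in A) f x)).
rewrite fineK ?integrable_fin_num//.
Qed.

Lemma Rintegral_sum A (f_ : nat -> R -> R) n : msetR A ->
  (forall i, intble A (f_ i)) ->
  intble A (fun x => \sum_(0 <= i < n) f_ i x) /\
  \int[leb]_(x in A) (\sum_(0 <= i < n) f_ i x) =
  \sum_(0 <= i < n) \int[leb]_(x in A) f_ i x.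
Proof.
move=> mA fi; elim: n => [|n [ih1 ih2]].
  split.
    apply: (@intble_eq _ (fun x => 0 * f_ 0 x)) => //; last exact: intbleZ.
    by move=> x _; rewrite mul0r big_nil.
  rewrite big_nil (@eq_Rintegral _ _ R leb A (cst 0)) ?Rintegral_cst ?mul0r//.
  by move=> x _; rewrite big_nil.
split.
  apply: intble_eq (intbleD mA ih1 (fi n)) => // x _.
  by rewrite big_nat_recr.
rewrite big_nat_recr//= -ih2 -RintegralD//.
by apply: eq_Rintegral => x _; rewrite big_nat_recr.
Qed.

(** By Tonelli, absolute integrability on the product follows from a majorant [H] whose inner
    integrals are bounded by an integrable [G]. Multiplying by the two indicators places the
    integrand on the whole plane, where Fubini's theorem is applied. *)
Lemma fubini_dom A B (f : R -> R -> R) (H : R -> R -> R) (G : R -> R) :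
  msetR A -> msetR B ->
  measurable_fun setT (fun z : R * R => f z.1 z.2) ->
  (forall x y, A x -> B y -> `|f x y| <= H x y) ->
  (forall x, A x -> intble B (H x)) ->
  (forall x, A x -> \int[leb]_(y in B) H x y <= G x) ->
  intble A G -> (forall y, B y -> intble A (f ^~ y)) ->
  \int[leb]_(x in A) \int[leb]_(y in B) f x y =
  \int[leb]_(y in B) \int[leb]_(x in A) f x y.
Proof.
move=> mA mB mf fH Hi HG Gi fi2.
pose F (z : R * R) := (f z.1 z.2 * \1_A z.1 * \1_B z.2)%:E.
have mA0 : measurable A := mA.
have mB0 : measurable B := mB.
have mF0 : measurable_fun setT F.
  apply/measurable_EFinP; apply: measurable_funM; first apply: measurable_funM => //.
    have h : measurable_fun setT (\1_A : R -> R) by exact: measurable_indic.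
    exact: (measurableT_comp h (@measurable_fst _ _ R R)).
  have h : measurable_fun setT (\1_B : R -> R) by exact: measurable_indic.
  exact: (measurableT_comp h (@measurable_snd _ _ R R)).
have mF : @measurable_fun _ _ (measurableTypeR R * measurableTypeR R)%type _ setT F := mF0.
have FT : (\int[leb]_x \int[leb]_y `|F (x, y)| < +oo)%E.
  apply: (@le_lt_trans _ _ (\int[leb]_(x in A) (G x)%:E)%E); last first.
    by apply: integrable_lty.
  rewrite [leRHS]integral_mkcond; apply: ge0_le_integral => //.
  - by move=> x _; exact: integral_ge0.
  - have maF : @measurable_fun _ _ (measurableTypeR R * measurableTypeR R)%type _
      setT (abse \o F) by exact: measurableT_comp.
    have aF0 z : (0 <= (abse \o F) z)%E by exact: abse_ge0.
    pose m2 : {sigma_finite_measure set (measurableTypeR R) -> \bar R} := leb.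
    refine (@measurable_fun_fubini_tonelli_F _ _ (measurableTypeR R)
      (measurableTypeR R) R m2 _ maF aF0).
  - have mG := measurable_int leb Gi.
    exact: (measurable_restrictT _ mA).1 mG.
  move=> x _; rewrite patchE; case: ifPn => [/set_mem Ax|xA]; last first.
    rewrite integral0_eq// => y _; rewrite /F /= indicE (negPf xA).
    by rewrite mulr0 mul0r normr0.
  apply: (@le_trans _ _ (\int[leb]_(y in B) (H x y)%:E)%E); last first.
    rewrite -[leLHS]fineK ?lee_fin; first exact: HG.
    exact: integrable_fin_num (Hi x Ax).
  rewrite [leRHS]integral_mkcond; apply: ge0_le_integral => //.
  - by apply: measurableT_comp => //; exact: measurableT_comp mF _.
  - have mH := measurable_int leb (Hi x Ax).
    exact: (measurable_restrictT _ mB).1 mH.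
  move=> y _; rewrite patchE /F /= [\1_A x]indicE mem_set// mulr1 indicE.
  case: ifPn => [/set_mem By|yB]; last by rewrite mulr0 normr0.
  by rewrite mulr1 lee_fin fH.
have Fi : (leb \x leb)%E.-integrable setT F by apply/integrable12ltyP.
have mfx x : measurable_fun setT (f x).
  have h : measurable_fun setT (fun y : R => (x, y)).
    exact: pair1_measurable.
  exact (measurableT_comp mf h).
have E1 x : A x -> (\int[leb]_y F (x, y) = (\int[leb]_(y in B) f x y)%:E)%E.
  move=> Ax; rewrite fineK; last first.
    apply: integrable_fin_num => //; apply: intble_dom (Hi x Ax) _ => //.
      exact: mfunTS.
    by move=> y; exact: fH.
  rewrite [RHS]integral_mkcond; apply: eq_integral => y _.
  rewrite patchE /F /= [\1_A x]indicE mem_set// mulr1 indicE.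
  by case: ifPn => _; rewrite ?mulr1 ?mulr0.
(* Fubini alone gives finiteness of these inner integrals for almost every [y]. The pointwise
   identity asks for it at every [y] in [B], since [fine] would send an infinite value to 0. *)
have E2 y : B y -> (\int[leb]_x F (x, y) = (\int[leb]_(x in A) f x y)%:E)%E.
  move=> By; rewrite fineK; last by apply: integrable_fin_num => //; exact: fi2.
  rewrite [RHS]integral_mkcond; apply: eq_integral => x _.
  rewrite patchE /F /= [\1_B y]indicE mem_set// mulr1 indicE.
  by case: ifPn => _; rewrite ?mulr1 ?mulr0.
rewrite /Rintegral; congr fine.
transitivity (\int[leb]_x \int[leb]_y F (x, y))%E.
  rewrite [LHS]integral_mkcond; apply: eq_integral => x _; rewrite patchE.
  case: ifPn => [/set_mem Ax|xA]; first by rewrite E1.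
  by rewrite integral0_eq// => y _; rewrite /F /= [\1_A x]indicE (negPf xA) mulr0 mul0r.
rewrite (Fubini Fi) [RHS]integral_mkcond; apply: eq_integral => y _; rewrite patchE.
case: ifPn => [/set_mem By|yB]; first by rewrite E2.
by rewrite integral0_eq// => x _; rewrite /F /= [\1_B y]indicE (negPf yB) mulr0.
Qed.

End RealIntegrals.

(** * Improper integrals over the half-line *)

Section HalfLine.
Context {R : realType}.
Implicit Types (f g F : R -> R).

Lemma mset_itv (i : interval R) : msetR [set` i].
Proof. exact: measurable_itv. Qed.

Lemma msetD : msetR (D : set R).
Proof. exact: mset_itv. Qed.

Lemma intble_cc f (a b : R) : {in `[a, b], continuous f} ->
  intble `[a, b] f.
Proof.
move=> cf; apply: continuous_compact_integrable; first exact: segment_compact.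
by apply: continuous_in_subspaceT => x /set_mem; exact: cf.
Qed.

Lemma FTC_cc f F (a b : R) : a < b -> {in `[a, b], continuous f} ->
  (forall x, x \in `[a, b] -> is_derive x 1 F (f x)) ->
  \int[leb]_(x in `[a, b]) f x = F b - F a.
Proof.
move=> ab cf dF.
have cF x : x \in `[a, b] -> {for x, continuous F}.
  by move=> /dF [/derivable1_diffP/differentiable_continuous].
rewrite /Rintegral (@continuous_FTC2 _ _ F)//.
- by apply: continuous_in_subspaceT => x /set_mem; exact: cf.
- split.
  + by move=> x /subset_itv_oo_cc /dF[].
  + by apply: cvg_at_right_filter; apply: cF; rewrite in_itv/= lexx ltW.
  + by apply: cvg_at_left_filter; apply: cF; rewrite in_itv/= lexx ltW.
by move=> x /subset_itv_oo_cc /dF dFx; rewrite derive1E derive_val.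
Qed.


Lemma mem_cc_D (u v x : R) : 0 < u -> x \in `[u, v] -> 0 < x.
Proof. by move=> u0; rewrite in_itv/= => /andP[ux _]; exact: lt_le_trans ux. Qed.

Lemma Rint_exhaust_set (A : set R) (E : nat -> set R) f : msetR A ->
  (forall n, measurable (E n)) -> (forall n, E n `<=` A) ->
  (forall x, A x -> \forall n \near \oo, E n x) ->
  intble A f -> measurable_fun setT f ->
  \int[leb]_(x in E n) f x @[n --> \oo] --> \int[leb]_(x in A) f x.
Proof.
move=> mA mE EA AE fi mf.
have [] := @dct R A (fun n => f \* \1_(E n)) f (fun x => `|f x|) mA.
- move=> n; apply: mfunTS; apply: measurable_funM => //.
- exact: integrable_norm.
- move=> x Ax; apply: cvg_near_cst; have := AE x Ax; apply: filterS => n Enx.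
  by rewrite /= indicE mem_set ?mulr1.
- move=> n x _ /=; rewrite normrM -[leRHS]mulr1 ler_wpM2l// indicE.
  by case: (_ \in _); rewrite ?normr1 ?normr0.
move=> _; suff -> : (fun n => \int[leb]_(x in E n) f x) =
  (fun n => \int[leb]_(x in A) (f \* \1_(E n)) x) by [].
apply/funext => n.
rewrite [LHS]Rintegral_mkcond [RHS]Rintegral_mkcond.
apply: eq_Rintegral => x _; rewrite !patchE/= indicE.
have [xE|xE] := boolP (x \in E n); last first.
  by rewrite mulr0; case: ifPn.
by rewrite mulr1 ifT//; apply/mem_set/(EA n)/set_mem.
Qed.

(** Monotone convergence along the exhaustion bounds the integral over [A] by [M]. This reduces
    integrability over an open interval to compact subintervals, where continuity is enough. *)
Lemma intble_ge0_exhaust (A : set R) (E : nat -> set R) f (M : R) : msetR A ->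
  (forall n, msetR (E n)) -> nondecreasing_seq (E : nat -> set (measurableTypeR R)) ->
  \bigcup_n E n = A -> measurable_fun setT f -> (forall x, A x -> 0 <= f x) ->
  (forall n, intble (E n) f) -> (forall n, \int[leb]_(x in E n) f x <= M) ->
  intble A f.
Proof.
move=> mA mE ndE UA mf f0 fi fM.
apply/integrableP; split; first by apply/measurable_EFinP; exact: mfunTS.
have -> : (\int[leb]_(x in A) `|(EFin \o f) x| = \int[leb]_(x in A) (f x)%:E)%E.
  by apply: eq_integral => x /set_mem Ax /=; rewrite ger0_norm// f0.
have cv : (\int[leb]_(x in E n) (EFin \o f) x @[n --> \oo] -->
    \int[leb]_(x in A) (EFin \o f) x)%E.
  rewrite -UA; apply: (@ge0_nondecreasing_set_cvg_integral _ (measurableTypeR R)) => //.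
  - by move=> n; apply/measurable_EFinP; exact: mfunTS.
  - by move=> n x Enx; rewrite /= lee_fin f0// -UA; exists n.
have <- := cvg_lim _ cv; last by [].
rewrite (@le_lt_trans _ _ M%:E) ?ltry//.
apply: lime_le; first exact: (cvgP _ cv).
apply: nearW => n.
by rewrite -[leLHS](fineK (integrable_fin_num (mE n) (fi n))) lee_fin; exact: fM.
Qed.

Lemma Rint_exhaust f (u v : nat -> R) : intble D f -> measurable_fun setT f ->
  (forall n, 0 < u n) -> u n @[n --> \oo] --> 0 -> v n @[n --> \oo] --> +oo ->
  \int[leb]_(x in `[u n, v n]) f x @[n --> \oo] --> \int[leb]_(x in D) f x.
Proof.
move=> fi mf u0 uc vc.
apply: (@Rint_exhaust_set D (fun n => `[u n, v n]%classic)) => //.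
- by move=> n x /= /mem_cc_D; rewrite in_itv/= andbT; exact.
move=> x; rewrite /= in_itv/= andbT => x0.
near=> n; rewrite in_itv/=; apply/andP; split.
  by rewrite ltW//; near: n; move/cvgr_lt : uc; exact.
by near: n; exact: (cvgryPge _).1 vc _.
Unshelve. all: by end_near. Qed.

(** The shift by 2 gives [lo n < 1 < hi n] already for [n = 0]; [FTC_cc] needs a nondegenerate
    interval. *)
Let lo n : R := n.+2%:R^-1.
Let hi n : R := n.+2%:R.

Let lo_gt0 n : 0 < lo n. Proof. by rewrite invr_gt0 ltr0n. Qed.

Let hi_y : hi n @[n --> \oo] --> +oo.
Proof.
have : (n%:R : R) @[n --> \oo] --> +oo by exact: cvgr_idn.
by rewrite -(cvg_shiftn 2) /hi; under eq_fun do rewrite addn2.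
Qed.

Let lo_0 : lo n @[n --> \oo] --> 0.
Proof. by apply/gtr0_cvgV0; [apply: nearW => n; rewrite ltr0n|exact: hi_y]. Qed.

Let lo_hi n : lo n < hi n.
Proof. by rewrite /lo /hi (@lt_le_trans _ _ 1)// ?ler1n// invf_lt1 ?ltr0n ?ltr1n. Qed.

Lemma Rint_FTC f F (l0 l1 : R) : (forall x : R, 0 < x -> {for x, continuous f}) ->
  measurable_fun setT f ->
  (forall x : R, 0 < x -> is_derive x 1 F (f x)) -> intble D f ->
  F x @[x --> 0^'+] --> l0 -> F x @[x --> +oo] --> l1 ->
  \int[leb]_(x in D) f x = l1 - l0.
Proof.
move=> cf mf dF fi F0 F1.
apply: (@cvg_unique _ (@Rhausdorff R) _ _ _ _
  (Rint_exhaust fi mf lo_gt0 lo_0 hi_y)).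
have h n x : x \in `[lo n, hi n] -> 0 < x by exact: mem_cc_D.
have E : (fun n => \int[leb]_(x in `[lo n, hi n]) f x) =
  (fun n => F (hi n) - F (lo n)).
  apply/funext => n; apply: FTC_cc => //.
  - by move=> x /h; exact: cf.
  - by move=> x /h; exact: dF.
rewrite /= E; apply: cvgB; first exact: (cvg_comp _ _ hi_y F1).
by move/cvg_at_rightP : F0; apply; split => //; exact: lo_0.
Qed.

Lemma intble_ge0_FTC f F (M : R) :
  (forall x : R, 0 < x -> {for x, continuous f}) -> measurable_fun setT f ->
  (forall x : R, 0 < x -> 0 <= f x) ->
  (forall x : R, 0 < x -> is_derive x 1 F (f x)) ->
  (forall x : R, 0 < x -> `|F x| <= M) -> intble D f.
Proof.
move=> cf mf f0 dF FM.
have h n x : x \in `[lo n, hi n] -> 0 < x by exact: mem_cc_D.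
apply: (@intble_ge0_exhaust D (fun n => `[lo n, hi n]%classic) f (M + M)) => //.
- move=> m n mn; apply/subsetPset; apply: subset_itv; rewrite bnd_simp.
    by rewrite lef_pV2 ?posrE ?ltr0n// ler_nat !ltnS.
  by rewrite ler_nat !ltnS.
- apply/seteqP; split => [x [n _] /= /mem_cc_D|x /=].
    by rewrite in_itv/= andbT; exact.
  rewrite in_itv/= andbT => x0.
  have [n] : \forall n \near \oo, x \in `[lo n, hi n].
    near=> n; rewrite in_itv/=; apply/andP; split.
      by rewrite ltW//; near: n; move/cvgr_lt : lo_0; exact.
    by near: n; exact: (cvgryPge _).1 hi_y _.
  by move=> _ /(_ n (leqnn n)) xn; exists n.
- by move=> x; rewrite /= in_itv/= andbT; exact: f0.
- by move=> n; apply: intble_cc => x /h; exact: cf.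
move=> n; have -> : \int[leb]_(x in `[lo n, hi n]) f x = F (hi n) - F (lo n).
  by apply: FTC_cc => // x /h; [exact: cf|exact: dF].
rewrite (le_trans (ler_norm _))// (le_trans (ler_normB _ _))// lerD// FM//.
Unshelve. all: by end_near. Qed.

(** Substitution on the compact intervals [[lo n, hi n]], followed by a limit on both sides: since
    [c] and [p] are positive, the image intervals [[P (lo n), P (hi n)]] exhaust the half-line as
    well. *)
Lemma Rint_subst_powR (G : R -> R) (c p : R) : 0 < c -> 0 < p ->
  (forall x : R, 0 < x -> {for x, continuous G}) -> measurable_fun setT G ->
  intble D G -> intble D (fun x => G (c * x `^ p) * (c * p * x `^ (p - 1))) ->
  \int[leb]_(x in D) G x =
  \int[leb]_(x in D) (G (c * x `^ p) * (c * p * x `^ (p - 1))).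
Proof.
move=> c0 p0 cG mG Gi Gi'.
pose P (x : R) := c * x `^ p.
have P0 (x : R) : 0 < x -> 0 < P x by move=> x0; rewrite mulr_gt0// powR_gt0.
have dP (x : R) : 0 < x -> is_derive x 1 P (c * p * x `^ (p - 1)).
  move=> x0; have := is_derive1_powR p x0 => h.
  by have := is_deriveZ c h; rewrite /GRing.scale/= mulrA.
have dPE (x : R) : 0 < x -> derive1 P x = c * p * x `^ (p - 1).
  by move=> /dP h; rewrite derive1E derive_val.
have cpow q (x : R) : 0 < x -> {for x, continuous (fun y : R => y `^ q)}.
  by move=> x0; have [/derivable1_diffP/differentiable_continuous] := is_derive1_powR q x0.
have P_lo : P (lo n) @[n --> \oo] --> 0.
  rewrite -(mulr0 c); apply: cvgM; first exact: cvg_cst.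
  have /cvg_at_rightP := powR_cvg0 p0; apply; split => //; exact: lo_0.
have P_hi : P (hi n) @[n --> \oo] --> +oo.
  apply/gtr0_cvgV0; first by apply: nearW => n; exact: P0.
  have -> : unstable.inv_fun (fun n => P (hi n)) = (fun n => c^-1 * (lo n) `^ p).
    apply/funext => n; rewrite /unstable.inv_fun /P invfM; congr (_ * _).
    by rewrite /lo -powR_inv1 ?ler0n// -powRrM mulN1r powRN.
  rewrite -[X in _ --> X](mulr0 c^-1); apply: cvgM; first exact: cvg_cst.
  have /cvg_at_rightP := powR_cvg0 p0; apply; split => //; exact: lo_0.
have mS : measurable_fun setT (fun x => G (c * x `^ p) * (c * p * x `^ (p - 1))).
  apply: measurable_funM; last by mfun.
  by apply: (measurableT_comp mG); mfun.
have h n x : x \in `[lo n, hi n] -> 0 < x by exact: mem_cc_D.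
apply: (@cvg_unique _ (@Rhausdorff R) _ _ _ _
  (Rint_exhaust Gi mG (fun n => P0 _ (lo_gt0 n)) P_lo P_hi)).
have := Rint_exhaust Gi' mS lo_gt0 lo_0 hi_y.
suff -> : (fun n => \int[leb]_(x in `[lo n, hi n]) (G (c * x `^ p) * (c * p * x `^ (p - 1)))) =
  (fun n => \int[leb]_(x in `[P (lo n), P (hi n)]) G x) by [].
apply/funext => n; symmetry.
have cP' (x : R) : 0 < x -> {for x, continuous (derive1 P)}.
  move=> x0.
  suff : (fun y => c * p * y `^ (p - 1)) y @[y --> x] --> derive1 P x.
    move=> hc; apply: cvg_trans hc; apply: near_eq_cvg; near=> y; rewrite /= dPE//.
    by near: y; exact: lt_nbhsr.
  by rewrite dPE//; apply: cvgM; [exact: cvg_cst|exact: cpow].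
rewrite /Rintegral (@integration_by_substitution_increasing _ P G).
- congr fine; apply: eq_integral => x /set_mem /= /h x0.
  by congr EFin; rewrite -(dPE x x0).
- exact: ltW.
- move=> x y /h x0 /h y0 xy.
  by rewrite /P ltr_pM2l// gt0_ltr_powR// nnegrE ltW.
- by move=> x /subset_itv_oo_cc /h; exact: cP'.
- apply/cvg_ex; exists (derive1 P (lo n)); apply: cvg_at_right_filter; exact: cP'.
- apply/cvg_ex; exists (derive1 P (hi n)); apply: cvg_at_left_filter; apply: cP'.
  by rewrite (lt_trans (lo_gt0 n)).
- have cP (x : R) : 0 < x -> {for x, continuous P}.
    by move=> /dP[/derivable1_diffP/differentiable_continuous].
  split.
  + by move=> x /subset_itv_oo_cc /h /dP [].
  + by apply: cvg_at_right_filter; apply: cP.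
  + by apply: cvg_at_left_filter; apply: cP; rewrite (lt_trans (lo_gt0 n)).
- apply: continuous_in_subspaceT => x /set_mem /mem_cc_D x0; apply: cG.
  by apply: x0; exact: P0.
Unshelve. all: by end_near. Qed.

End HalfLine.

(** * Derivatives and differentiation under the integral sign *)

Section Derivatives.
Context {R : realType}.
Implicit Types (f g : R -> R) (x a b : R).

Lemma der_eq f x a b : is_derive x 1 f a -> a = b -> is_derive x 1 f b.
Proof. by move=> h <-. Qed.

Lemma derC x (k : R) : is_derive x 1 (fun _ : R => k) 0.
Proof. exact: is_derive_cst. Qed.

Lemma derI x : is_derive x 1 (fun y : R => y) 1.
Proof. exact: is_derive_id. Qed.

Lemma derD f g x a b : is_derive x 1 f a -> is_derive x 1 g b ->
  is_derive x 1 (fun y => f y + g y) (a + b).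
Proof. by move=> h k; exact: is_deriveD. Qed.

Lemma derN f x a : is_derive x 1 f a -> is_derive x 1 (fun y => - f y) (- a).
Proof. by move=> h; exact: is_deriveN. Qed.

Lemma derM f g x a b : is_derive x 1 f a -> is_derive x 1 g b ->
  is_derive x 1 (fun y => f y * g y) (f x * b + g x * a).
Proof. by move=> h k; exact: is_deriveM. Qed.

Lemma derV f x a : f x != 0 -> is_derive x 1 f a ->
  is_derive x 1 (fun y => (f y)^-1) (- (f x) ^- 2 * a).
Proof. exact: is_deriveV. Qed.

Lemma derexp f x a : is_derive x 1 f a ->
  is_derive x 1 (fun y => expR (f y)) (expR (f x) * a).
Proof. by move=> h; exact: is_derive1_comp. Qed.

Lemma dersin f x a : is_derive x 1 f a ->
  is_derive x 1 (fun y => sin (f y)) (cos (f x) * a).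
Proof. by move=> h; exact: is_derive1_comp. Qed.

Lemma dercos f x a : is_derive x 1 f a ->
  is_derive x 1 (fun y => cos (f y)) (- sin (f x) * a).
Proof. by move=> h; exact: is_derive1_comp. Qed.

Lemma derpow x p : 0 < x -> is_derive x 1 (fun y => y `^ p) (p * x `^ (p - 1)).
Proof. exact: is_derive1_powR. Qed.

Lemma der_cont f x a : is_derive x 1 f a -> {for x, continuous f}.
Proof. by move=> [/derivable1_diffP/differentiable_continuous]. Qed.

End Derivatives.

Ltac der := lazymatch goal with
  | |- is_derive _ _ (fun _ => ?k) _ => notypeclasses refine (@derC _ _ _)
  | |- is_derive _ _ (fun y => y) _ => notypeclasses refine (@derI _ _)
  | |- is_derive _ _ (fun y => @Algebra.add _ (@?f y) (@?g y)) _ =>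
      notypeclasses refine (@derD _ f g _ _ _ _ _); der
  | |- is_derive _ _ (fun y => @Algebra.opp _ (@?f y)) _ =>
      notypeclasses refine (@derN _ f _ _ _); der
  | |- is_derive _ _ (fun y => @GRing.mul _ (@?f y) (@?g y)) _ =>
      notypeclasses refine (@derM _ f g _ _ _ _ _); der
  | |- is_derive _ _ (fun y => expR (@?f y)) _ => notypeclasses refine (@derexp _ f _ _ _); der
  | |- is_derive _ _ (fun y => sin (@?f y)) _ => notypeclasses refine (@dersin _ f _ _ _); der
  | |- is_derive _ _ (fun y => cos (@?f y)) _ => notypeclasses refine (@dercos _ f _ _ _); der
  | |- is_derive _ _ (fun y => y `^ ?p) _ => notypeclasses refine (@derpow _ _ _ _); assumption
  end.

Ltac derive_eq := notypeclasses refine (@der_eq _ _ _ _ _ _ _); [der|cbv beta].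

Section DeriveUnderIntegral.
Context {R : realType}.
Implicit Types (A : set R).

Lemma is_derive_Rint A (f df : R -> R -> R) (g : R -> R) (a e : R) :
  msetR A -> 0 < e ->
  (forall x, `|x - a| < e -> intble A (f x)) ->
  (forall x y, `|x - a| < e -> A y -> is_derive x 1 (f ^~ y) (df x y)) ->
  intble A g ->
  (forall x y, `|x - a| < e -> A y -> `|df x y| <= g y) ->
  is_derive a 1 (fun x => \int[leb]_(y in A) f x y)
    (\int[leb]_(y in A) df a y).
Proof.
move=> mA e0 fi dfd gi dg.
have Ie x : `]a - e, a + e[%classic x -> `|x - a| < e.
  by rewrite /= in_itv/= ltr_distl.
have Ia : `]a - e, a + e[%classic a by rewrite /= in_itv/= ltrBlDr ltrDl e0.
have h1 x : `]a - e, a + e[%classic x -> intble A (f x) by move=> /Ie; exact: fi.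
have h2 x y : `]a - e, a + e[%classic x -> A y -> derivable (f ^~ y) x 1.
  by move=> /Ie xe Ay; have [] := dfd x y xe Ay.
have h3 x y : `]a - e, a + e[%classic x -> A y -> `|partial1of2 f x y| <= `|g y|.
  move=> /Ie xe Ay; rewrite partial1of2E; have [_ ->] := dfd x y xe Ay.
  by rewrite (le_trans (dg _ _ xe Ay))// ler_norm.
have h4 : intble A (fun y => `|g y|) by exact: integrable_norm.
have h0 y : 0 <= `|g y| by [].
split.
  exact: (derivable_under_integral mA Ia h1 h2 h0 h4 h3).
rewrite -derive1E (differentiation_under_integral mA Ia h1 h2 h0 h4 h3).
apply: eq_Rintegral => y /set_mem Ay; rewrite partial1of2E.
by have [_ ->] := dfd a y (Ie _ Ia) Ay.
Qed.

End DeriveUnderIntegral.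

(** * Integrable majorants built from powers and exponentials *)

Section PowerExponential.
Context {R : realType}.
Implicit Types (q c b X r : R).

Lemma expR_ge_pow (n : nat) (y : R) : 0 <= y -> y ^+ n / n`!%:R <= expR y.
Proof.
case: n => [|n] y0; first by rewrite expr0 fact0 divr1 -expR0 ler_expR.
by rewrite (le_trans _ (expR_ge1Dxn n y0))// lerDr.
Qed.

Lemma powR_expR_bounded q c b : 0 < c -> 0 < b -> 0 <= q ->
  exists2 C, 0 <= C & forall r, 0 < r -> r `^ q * expR (- (c * r `^ b)) <= C.
Proof.
move=> c0 b0 q0.
(* For [r > 1], [r^q <= (r^b)^m] because [q <= b m], and [exp y >= y^m / m!] at [y = c r^b] gives
   the bound [m! / c^m]. For [r <= 1] both factors are at most 1. *)
pose m := (Num.truncn (q / b)).+1.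
have qm : q <= b * m%:R.
  by rewrite mulrC -ler_pdivrMr// ltW// truncnS_gt.
exists (1 + m`!%:R / c ^+ m).
  by rewrite addr_ge0// divr_ge0// exprn_ge0// ltW.
move=> r r0; have [r1|r1] := leP r 1.
  rewrite -[leLHS]mulr1 mulr1 (@le_trans _ _ 1)//; last first.
    by rewrite lerDl divr_ge0// exprn_ge0// ltW.
  rewrite -[leRHS]mulr1 ler_pM ?powR_ge0 ?expR_ge0//.
    have := @ge0_ler_powR _ q q0 r 1; rewrite powR1; apply => //.
      by rewrite nnegrE ltW.
    by rewrite nnegrE.
  by rewrite expR_le1 oppr_le0 mulr_ge0 ?powR_ge0// ltW.
have y0 : 0 <= c * r `^ b by rewrite mulr_ge0 ?powR_ge0// ltW.
rewrite (@le_trans _ _ (m`!%:R / c ^+ m))// ?lerDr// expRN ler_pdivrMr ?expR_gt0//.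
rewrite (@le_trans _ _ (r `^ (b * m%:R)))//; first by rewrite ler_powR// ltW.
rewrite powRrM powR_mulrn ?powR_ge0//.
have cm : 0 < c ^+ m by rewrite exprn_gt0.
rewrite mulrAC ler_pdivlMr//; have := expR_ge_pow m y0.
by rewrite exprMn ler_pdivrMr ?ltr0n ?fact_gt0// mulrC [leRHS]mulrC.
Qed.

Let onepow_gt0 q r : 0 < 1 + r `^ q.
Proof. by rewrite ltr_pwDl// powR_ge0. Qed.

(** The integrand is the derivative of the bounded function [- 1 / (1 + r^q)]. It serves as a
    majorant of order [r^(q-1)] at 0 and [r^(-q-1)] at infinity, which handles both ends of the
    half-line at once. *)
Lemma intble_powR_bump q : 0 < q ->
  intble D (fun r => q * r `^ (q - 1) * (1 + r `^ q) ^- 2).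
Proof.
move=> q0; pose g r := q * r `^ (q - 1) * (1 + r `^ q) ^- 2.
apply: (@intble_ge0_FTC R g (fun r => - (1 + r `^ q)^-1) 1).
- move=> r r0; apply: (@der_cont R _ _ (_ : R)).
  apply: derM; first by der.
  have -> : (fun r => (1 + r `^ q) ^- 2) = (fun r => ((1 + r `^ q) * (1 + r `^ q))^-1).
    by apply/funext => y; rewrite expr2.
  by apply: derV; [rewrite mulf_neq0 ?gt_eqF|der].
- rewrite /g; apply: measurable_funM; first by mfun.
  have -> : (fun r => (1 + r `^ q) ^- 2) = (fun r => (1 + r `^ q) `^ (- 2%:R)).
    by apply/funext => r; rewrite powR_invn// ltW.
  by mfun.
- by move=> r r0; rewrite /g !mulr_ge0 ?powR_ge0 ?invr_ge0 ?exprn_ge0 ?(ltW q0) ?(ltW (onepow_gt0 _ _)).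
- move=> r r0; apply: der_eq.
    by apply: derN; apply: derV; [rewrite gt_eqF|der].
  by rewrite /g; ring.
- move=> r r0; rewrite normrN ger0_norm ?invr_ge0 ?(ltW (onepow_gt0 _ _))//.
  by rewrite invf_le1// lerDl powR_ge0.
Qed.

Lemma intble_powR_expR_powR q c b : 0 < q -> 0 < c -> 0 < b ->
  intble D (fun r => r `^ (q - 1) * expR (- (c * r `^ b))).
Proof.
move=> q0 c0 b0.
have [C C0 CP] := powR_expR_bounded c0 b0 (ltW (mulr_gt0 (ltr0Sn R 1) q0)).
pose g r := q * r `^ (q - 1) * (1 + r `^ q) ^- 2.
have u0 r : 0 < 1 + r `^ q by exact: onepow_gt0.
have gi : intble D g by exact: intble_powR_bump.
have mD := @msetD R.
(* With [s = r^q] and [C] a bound for [s^2 exp (- c r^b)], the constant comes from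
   [(1 + s)^2 <= 2 + 2 s^2]; dividing by [q] cancels the factor [q] in [g]. *)
apply: (@intble_dom R D _ (fun r => ((2 + 2 * C) / q) * g r)) => //.
- by apply: mfunTS; mfun.
- exact: intbleZ.
move=> r /=; rewrite in_itv/= andbT => r0.
rewrite ger0_norm ?mulr_ge0 ?powR_ge0 ?expR_ge0//.
have -> : (2 + 2 * C) / q * g r = r `^ (q - 1) * ((2 + 2 * C) / (1 + r `^ q) ^+ 2).
  by rewrite /g; field; rewrite !gt_eqF.
rewrite ler_wpM2l ?powR_ge0// ler_pdivlMr ?exprn_gt0//.
have e1 : expR (- (c * r `^ b)) <= 1.
  by rewrite expR_le1 oppr_le0 mulr_ge0 ?powR_ge0// ltW.
have := CP r r0; rewrite mulrC [2 * q]mulrC powRrM.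
have -> : (r `^ q) `^ 2 = (r `^ q) ^+ 2 by rewrite (powR_mulrn 2) ?powR_ge0.
set e := expR _ in e1 *; have e0 : 0 <= e by exact: expR_ge0.
have := powR_ge0 r q; set s := r `^ q => s0.
have := sqr_ge0 (1 - s).
nra.
Qed.

Lemma intble_powR_expR q c : 0 < q -> 0 < c ->
  intble D (fun r => r `^ (q - 1) * expR (- (c * r))).
Proof.
move=> q0 c0; apply: intble_eq (intble_powR_expR_powR q0 c0 ltr01).
  exact: msetD.
by move=> r /=; rewrite in_itv/= andbT => r0; rewrite powRr1// ltW.
Qed.

(** Beyond the point [K] where [K^(b-1) = d / (X + 1)], the function [X r^b] lies below [d r]
    because [b < 1]; up to [K] it is at most its value there. The denominator [X + 1] instead of [X]
    covers [X = 0]. The estimate lets a factor [exp (- c r)] absorb any [exp (X r^b)]. *)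
Lemma powR_sublinear b X d : 0 < b < 1 -> 0 <= X -> 0 < d ->
  exists C, forall r, 0 < r -> X * r `^ b <= d * r + C.
Proof.
move=> /andP[b0 b1] X0 d0.
pose e := d / (X + 1); have X1 : 0 < X + 1 by rewrite ltr_wpDl.
have e0 : 0 < e by rewrite divr_gt0.
pose K := e `^ (b - 1)^-1.
have K0 : 0 < K by rewrite powR_gt0.
have Ke : K `^ (b - 1) = e.
  by rewrite /K -powRrM mulVf ?powRr1 ?(ltW e0)// subr_eq0 lt_eqF.
exists (X * K `^ b) => r r0; have [rK|rK] := leP r K.
  rewrite (@le_trans _ _ (X * K `^ b))// ?lerDr ?mulr_ge0 ?(ltW d0) ?(ltW r0)//.
  by rewrite ler_wpM2l// (ge0_ler_powR (ltW b0)) ?nnegrE ?(ltW r0) ?(ltW K0).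
rewrite (@le_trans _ _ (d * r))// ?lerDl ?mulr_ge0 ?powR_ge0//.
have -> : r `^ b = r * r `^ (b - 1).
  by rewrite mulr_powRB1 ?(ltW r0).
have h : r `^ (b - 1) <= e.
  rewrite -Ke -[b - 1]opprB !powRN lef_pV2 ?posrE ?powR_gt0//.
  by rewrite ge0_ler_powR ?nnegrE ?subr_ge0 ?(ltW r0) ?(ltW K0) ?(ltW b1) ?(ltW rK).
rewrite (@le_trans _ _ (X * (r * e)))//.
  by rewrite ler_wpM2l// ler_wpM2l// ltW.
have -> : X * (r * e) = (X / (X + 1)) * (d * r) by rewrite /e; field; rewrite gt_eqF.
rewrite -[leRHS]mul1r ler_wpM2r ?mulr_ge0 ?(ltW d0) ?(ltW r0)//.
by rewrite ler_pdivrMr// mul1r lerDl.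
Qed.

Lemma intble_powR_expRD q c b X : 0 < q -> 0 < c -> 0 < b < 1 -> 0 <= X ->
  intble D (fun r => r `^ (q - 1) * expR (- (c * r) + X * r `^ b)).
Proof.
move=> q0 c0 b01 X0.
have c20 : 0 < c / 2 by rewrite divr_gt0.
have [C CP] := powR_sublinear b01 X0 c20.
have mD := @msetD R.
apply: (@intble_dom R D _ (fun r => expR C * (r `^ (q - 1) * expR (- (c / 2 * r))))) => //.
- by apply: mfunTS; mfun.
- by apply: intbleZ => //; exact: intble_powR_expR.
move=> r /=; rewrite in_itv/= andbT => r0.
rewrite ger0_norm ?mulr_ge0 ?powR_ge0 ?expR_ge0// mulrCA ler_wpM2l ?powR_ge0//.
by rewrite -expRD ler_expR; have := CP r r0; lra.
Qed.

End PowerExponential.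

(** * The Gamma function *)

Section Gamma.
Context {R : realType}.
Implicit Types (p q c b r rho chi X xi phi : R) (f g : R -> R).

Lemma powRDp (x a b : R) : 0 < x -> x `^ (a + b) = x `^ a * x `^ b.
Proof. by move=> x0; rewrite powRD// (gt_eqF x0) implybT. Qed.

Lemma cvg0_dom (T : Type) (F : set_system T) (FF : Filter F) (f g : T -> R) :
  (\forall x \near F, `|f x| <= g x) -> g x @[x --> F] --> 0 ->
  f x @[x --> F] --> 0.
Proof.
move=> fg g0; apply: (@squeeze_cvgr _ _ _ _ (fun x => - g x) g) => //.
  by apply: filterS fg => x; rewrite ler_norml.
by rewrite -[X in _ --> X](oppr0 R); exact: cvgN.
Qed.

Lemma der0_cst f (a b x y : R) :
  (forall z, z \in `]a, b[ -> is_derive z 1 f 0) ->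
  x \in `]a, b[ -> y \in `]a, b[ -> f x = f y.
Proof.
wlog xy : x y / x <= y => [H df xI yI|].
  by have [/H|/ltW/H] := leP x y; [exact|move=> ->].
move=> df; rewrite !in_itv/= => /andP[ax xb] /andP[ay yb].
have d0 (z : R) : z \in `]x, y[ -> is_derive z 1 f ((cst 0 : R -> R) z).
  rewrite in_itv/= => /andP[xz zy]; apply: df.
  by rewrite in_itv/= (lt_trans ax xz) (lt_trans zy yb).
have cf : {within `[x, y], continuous f}.
  apply: continuous_in_subspaceT => z /set_mem/=; rewrite in_itv/= => /andP[xz zy].
  apply: (@der_cont _ _ _ 0); apply: df.
  by rewrite in_itv/= (lt_le_trans ax xz) (le_lt_trans zy yb).
have [z _] := MVT_segment xy d0 cf.
by rewrite mul0r => /eqP; rewrite subr_eq0 => /eqP.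
Qed.

Lemma powR_expR_cvgy p c b : 0 < c -> 0 < b -> 0 <= p ->
  r `^ p * expR (- (c * r `^ b)) @[r --> +oo] --> 0.
Proof.
move=> c0 b0 p0; have p1 : 0 <= p + 1 by rewrite addr_ge0.
have [C C0 CP] := powR_expR_bounded c0 b0 p1.
apply: (@cvg0_dom _ _ _ _ (fun r => C * r^-1)).
  near=> r; have r0 : 0 < r by near: r; exact: nbhs_pinfty_gt.
  rewrite ger0_norm ?mulr_ge0 ?powR_ge0 ?expR_ge0// ler_pdivlMr//.
  by rewrite (le_trans _ (CP r r0))// powRDp// powRr1 ?(ltW r0)// mulrAC.
rewrite -[X in _ --> X](mulr0 C); apply: cvgM; first exact: cvg_cst.
by apply/gtr0_cvgV0 => //; near=> r; near: r; exact: nbhs_pinfty_gt.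
Unshelve. all: by end_near. Qed.

Lemma euler_gammaS p : 0 < p -> euler_gamma (p + 1) = p * euler_gamma p.
Proof.
move=> p0; have mD := @msetD R.
have i0 := intble_powR_expR p0 ltr01.
have p1 : 0 < p + 1 by rewrite addr_gt0.
have i1 := intble_powR_expR p1 ltr01.
apply/eqP; rewrite -subr_eq0 /euler_gamma -RintegralZl//; last first.
  by apply: intble_eq i0 => // r _; rewrite mul1r.
rewrite -RintegralB//; last 2 first.
- by apply: intble_eq i1 => // r _; rewrite mul1r.
- by apply: intbleZ => //; apply: intble_eq i0 => // r _; rewrite mul1r.
apply/eqP; rewrite -[RHS](subrr 0).
apply: (@Rint_FTC _ _ (fun r => - (r `^ p * expR (- r)))).
- move=> r r0; apply: der_cont; der.
- by mfun.
- move=> r r0; derive_eq.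
  by rewrite addrK -(mulr_powRB1 (ltW r0) p0); ring.
- apply: (@intble_eq R D (fun r => r `^ (p + 1 - 1) * expR (- (1 * r)) +
      - p * (r `^ (p - 1) * expR (- (1 * r))))) => //.
    by move=> r _; rewrite mul1r mulNr.
  by apply: intbleD => //; exact: intbleZ.
- rewrite -[X in _ --> X](oppr0 R) -[X in - X](mul0r (expR (- 0))).
  apply: cvgN; apply: cvgM; first exact: powR_cvg0.
  have h : {for 0, continuous (fun x : R => expR (- x))} by apply: der_cont; der.
  exact: cvg_at_right_filter h.
- rewrite -[X in _ --> X](oppr0 R); apply: cvgN.
  have := powR_expR_cvgy ltr01 ltr01 (ltW p0).
  apply: cvg_trans; apply: near_eq_cvg; near=> r.
  rewrite mul1r powRr1//; near: r; exact: nbhs_pinfty_ge.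
Unshelve. all: by end_near. Qed.

Lemma euler_gamma1 : euler_gamma (1 : R) = 1.
Proof.
have mD := @msetD R; have i0 := @intble_powR_expR R 1 1 ltr01 ltr01.
have -> : 1 = 0 - (- 1) :> R by rewrite opprK add0r.
rewrite /euler_gamma; apply: (@Rint_FTC _ _ (fun r => - expR (- r))).
- move=> r r0; apply: der_cont; der.
- by mfun.
- move=> r r0; derive_eq.
  by rewrite opprK add0r subrr powRr0; ring.
- by apply: intble_eq i0 => // r _; rewrite opprK add0r mul1r.
- apply: cvgN; rewrite -[X in _ --> X]expR0 -[X in expR X](oppr0 R).
  have h : {for 0, continuous (fun x : R => expR (- x))} by apply: der_cont; der.
  exact: cvg_at_right_filter h.
- rewrite -[X in _ --> X](oppr0 R); apply: cvgN.
  have := @powR_expR_cvgy 0 1 1 ltr01 ltr01 (lexx 0).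
  apply: cvg_trans; apply: near_eq_cvg; near=> r.
  rewrite mul1r powRr0 mul1r powRr1//; near: r; exact: nbhs_pinfty_ge.
Unshelve. all: by end_near. Qed.

Lemma euler_gamma_scale p rho : 0 < p -> 0 < rho ->
  \int[leb]_(r in D) (r `^ (p - 1) * expR (- (rho * r))) =
  euler_gamma p * rho `^ (- p).
Proof.
move=> p0 rho0; have mD := @msetD R.
have i0 := intble_powR_expR p0 ltr01; have i1 := intble_powR_expR p0 rho0.
have E r : r \in D -> (rho * r `^ 1) `^ (p - 1) * expR (- (rho * r `^ 1)) *
    (rho * 1 * r `^ (1 - 1)) = rho `^ p * (r `^ (p - 1) * expR (- (rho * r))).
  rewrite inE /= in_itv/= andbT => r0.
  rewrite powRr1 ?(ltW r0)// powRM ?(ltW r0) ?(ltW rho0)// subrr powRr0.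
  by rewrite -(mulr_powRB1 (ltW rho0) p0); ring.
rewrite /euler_gamma (@Rint_subst_powR R (fun r => r `^ (p - 1) * expR (- r)) rho 1) ?ltr01//.
- rewrite (@eq_Rintegral _ _ R leb D _ _ E) RintegralZl// mulrAC -powRDp//.
  by rewrite subrr powRr0 mul1r.
- by move=> r r0; apply: der_cont; der.
- by mfun.
- by apply: intble_eq i0 => // r _; rewrite mul1r.
- by apply: intble_eq (intbleZ (rho `^ p) mD i1) => // r rD; rewrite E ?inE.
Qed.

(** The imaginary part of [r^(q-1) exp (i phi - rho e^(-i chi) r - X e^(i xi) r^b)]. Up to phases
    kept in [phi] and [xi], this is the integrand of a Gamma-like integral taken along the ray of
    angle [- chi]. *)
Definition rotint b q rho chi X xi phi r : R :=
  r `^ (q - 1) * (expR (- (rho * cos chi * r) - X * cos xi * r `^ b) *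
                  sin (rho * sin chi * r + phi - X * sin xi * r `^ b)).

Lemma measurable_rotint b q rho chi X xi phi :
  measurable_fun setT (rotint b q rho chi X xi phi).
Proof. by rewrite /rotint; mfun. Qed.

Lemma mulsin_le (a x : R) : 0 <= a -> `|a * sin x| <= a.
Proof. by move=> a0; rewrite normrM ger0_norm// ler_piMr// sin_max. Qed.

Lemma mulcos_le (a x : R) : 0 <= a -> `|a * cos x| <= a.
Proof. by move=> a0; rewrite normrM ger0_norm// ler_piMr// cos_max. Qed.

Lemma expR_rot_le b rho chi X xi r (c : R) : 0 <= r -> 0 <= X -> 0 <= rho ->
  c <= cos chi ->
  expR (- (rho * cos chi * r) - X * cos xi * r `^ b) <=
  expR (- (rho * c * r) + X * r `^ b).
Proof.
move=> r0 X0 rho0 cc; rewrite ler_expR lerD//.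
  by rewrite lerN2 ler_wpM2r// ler_wpM2l.
rewrite -mulNr ler_wpM2r ?powR_ge0// -mulrN -[leRHS]mulr1 ler_wpM2l//.
Qed.

Lemma intble_rotint b q rho chi X xi phi : 0 < q -> 0 < rho -> 0 < cos chi ->
  0 < b < 1 -> 0 <= X -> intble D (rotint b q rho chi X xi phi).
Proof.
move=> q0 rho0 c0 b01 X0; have mD := @msetD R.
apply: intble_dom (intble_powR_expRD q0 (mulr_gt0 rho0 c0) b01 X0) _ => //.
  by apply: mfunTS; exact: measurable_rotint.
move=> r /=; rewrite in_itv/= andbT => r0.
rewrite /rotint normrM ger0_norm ?powR_ge0// ler_wpM2l ?powR_ge0//.
apply: le_trans (mulsin_le _ (expR_ge0 _)) _.
by apply: expR_rot_le => //; exact: ltW.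
Qed.

(* The [r]-derivative of [rotprim] is the [chi]-derivative of [rotint]: this is
   the real form of Cauchy's theorem for a rotation of the ray of integration. *)
Definition rotprim b q rho chi X xi phi r : R :=
  - (r `^ q * (expR (- (rho * cos chi * r) - X * cos xi * r `^ b) *
               cos (rho * sin chi * r + phi - X * sin xi * r `^ b))).

Definition drotint b q rho chi X xi phi r : R :=
  r `^ (q - 1) * (expR (- (rho * cos chi * r) - X * cos xi * r `^ b) *
    (sin (rho * sin chi * r + phi - X * sin xi * r `^ b) *
       (rho * sin chi * r - b * X * sin xi * r `^ b) +
     cos (rho * sin chi * r + phi - X * sin xi * r `^ b) *
       (rho * cos chi * r - q + b * X * cos xi * r `^ b))).

Lemma derive_rotint b q rho chi X xi phi r :
  is_derive chi 1
    (fun c => rotint b q rho c X (xi - b * c) (phi - q * c) r)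
    (drotint b q rho chi X (xi - b * chi) (phi - q * chi) r).
Proof.
rewrite /rotint; derive_eq.
by rewrite /drotint; ring.
Qed.

Lemma derive_rotprim b q rho chi X xi phi r : 0 < r -> 0 < q -> 0 < b ->
  is_derive r 1 (rotprim b q rho chi X xi phi) (drotint b q rho chi X xi phi r).
Proof.
move=> r0 q0 b0; rewrite /rotprim; derive_eq.
rewrite /drotint -(mulr_powRB1 (ltW r0) q0) -(mulr_powRB1 (ltW r0) b0).
by ring.
Qed.

Lemma cvg_rotprim0 b q rho chi X xi phi : 0 < q -> 0 < b ->
  rotprim b q rho chi X xi phi r @[r --> 0^'+] --> 0.
Proof.
move=> q0 b0.
pose E (s : R) := expR (`|rho| * s + `|X| * s `^ b).
apply: (@cvg0_dom _ _ _ _ (fun r => r `^ q * expR (`|rho| + `|X|))).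
  near=> r; have r0 : 0 < r by near: r; exact: nbhs_right_gt.
  have r1 : r <= 1 by near: r; exact: nbhs_right_le.
  rewrite /rotprim normrN normrM ger0_norm ?powR_ge0// ler_wpM2l ?powR_ge0//.
  apply: le_trans (mulcos_le _ (expR_ge0 _)) _; rewrite ler_expR.
  have rb1 : `|r `^ b| <= 1.
    rewrite ger0_norm ?powR_ge0//; have := @ge0_ler_powR _ b (ltW b0) r 1.
    by rewrite powR1; apply => //; rewrite nnegrE// ltW.
  rewrite (le_trans (ler_norm _))// (le_trans (ler_normB _ _))// normrN lerD//.
    rewrite !normrM -mulrA ler_piMr// -[leRHS]mulr1 ler_pM ?cos_max//.
    by rewrite ger0_norm// ltW.
  by rewrite !normrM -mulrA ler_piMr// -[leRHS]mulr1 ler_pM ?cos_max.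
rewrite -[X in _ --> X](mul0r (expR (`|rho| + `|X|))); apply: cvgM.
  exact: powR_cvg0.
exact: cvg_cst.
Unshelve. all: by end_near. Qed.

Lemma cvg_rotprimy b q rho chi X xi phi : 0 < q -> 0 < rho -> 0 < cos chi ->
  0 < b < 1 -> 0 <= X ->
  rotprim b q rho chi X xi phi r @[r --> +oo] --> 0.
Proof.
move=> q0 rho0 c0 b01 X0.
have d0 : 0 < rho * cos chi / 2 by rewrite divr_gt0// mulr_gt0.
have [C CP] := powR_sublinear b01 X0 d0.
apply: (@cvg0_dom _ _ _ _ (fun r => expR C * (r `^ q * expR (- (rho * cos chi / 2 * r `^ 1))))).
  near=> r; have r0 : 0 < r by near: r; exact: nbhs_pinfty_gt.
  rewrite /rotprim normrN normrM ger0_norm ?powR_ge0// mulrCA ler_wpM2l ?powR_ge0//.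
  apply: le_trans (mulcos_le _ (expR_ge0 _)) _; rewrite -expRD powRr1 ?(ltW r0)//.
  apply: le_trans (expR_rot_le _ _ (ltW r0) X0 (ltW rho0) (lexx _)) _.
  by rewrite ler_expR; have := CP r r0; lra.
rewrite -[X in _ --> X](mulr0 (expR C)); apply: cvgM; first exact: cvg_cst.
by apply: powR_expR_cvgy => //; exact: ltW.
Unshelve. all: by end_near. Qed.

(** The angle enters the bound only through the lower bound [c] of its cosine, so that one majorant
    serves for all angles near a given one. The three powers come from differentiating [rho r], the
    phase [q chi] and [X r^b]. *)
Lemma drotint_le b q rho chi X xi phi r c : 0 < r -> 0 < q -> 0 < rho ->
  c <= cos chi -> 0 < b -> 0 <= X ->
  `|drotint b q rho chi X xi phi r| <=
    2 * rho * (r `^ (q + 1 - 1) * expR (- (rho * c * r) + X * r `^ b)) +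
    q * (r `^ (q - 1) * expR (- (rho * c * r) + X * r `^ b)) +
    2 * b * X * (r `^ (q + b - 1) * expR (- (rho * c * r) + X * r `^ b)).
Proof.
move=> r0 q0 rho0 cc b0 X0.
rewrite [q + 1 - 1]addrAC [q + b - 1]addrAC !(powRDp (q - 1) _ r0).
rewrite powRr1 ?(ltW r0)//.
rewrite /drotint normrM ger0_norm ?powR_ge0//.
set P := r `^ (q - 1); set B := r `^ b.
have B0 : 0 <= B by exact: powR_ge0.
have -> : 2 * rho * (P * r * expR (- (rho * c * r) + X * B)) +
   q * (P * expR (- (rho * c * r) + X * B)) +
   2 * b * X * (P * B * expR (- (rho * c * r) + X * B)) =
   P * (expR (- (rho * c * r) + X * B) *
     ((rho * r + b * X * B) + (rho * r + q + b * X * B))) by ring.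
rewrite ler_wpM2l ?powR_ge0// normrM ger0_norm ?expR_ge0//.
rewrite ler_pM ?expR_ge0//; first exact: expR_rot_le (ltW r0) X0 (ltW rho0) cc.
have bX : 0 <= b * X by rewrite mulr_ge0// ltW.
have rr : 0 <= rho * r by rewrite mulr_ge0// ltW.
have S1 (u v : R) : `|rho * sin u * r - b * X * sin v * B| <= rho * r + b * X * B.
  rewrite (le_trans (ler_normB _ _))// lerD//.
    by rewrite mulrAC mulsin_le.
  by rewrite -[_ * sin v * B]mulrAC mulsin_le// mulr_ge0.
have S2 (u v : R) : `|rho * cos u * r - q + b * X * cos v * B| <= rho * r + q + b * X * B.
  rewrite (le_trans (ler_normD _ _))// lerD//; last first.
    by rewrite -[_ * cos v * B]mulrAC mulcos_le// mulr_ge0.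
  rewrite (le_trans (ler_normB _ _))// lerD ?(ger0_norm (ltW q0))//.
  by rewrite mulrAC mulcos_le.
rewrite (le_trans (ler_normD _ _))// lerD//.
  rewrite normrM -[leRHS]mul1r ler_pM ?sin_max//.
by rewrite normrM -[leRHS]mul1r ler_pM ?cos_max.
Qed.

(** Replacing [r] by [r e^(-i chi)] turns [xi] into [xi - b chi] and, with the factor from [dr],
    [phi] into [phi - q chi]. The derivative of the integral in [chi] is the increment of [rotprim]
    over the half-line, and [rotprim] tends to 0 at both ends. *)
Lemma rotation b q rho chi X xi phi : 0 < q -> 0 < rho ->
  - (pi / 2) < chi < pi / 2 -> 0 < b < 1 -> 0 <= X ->
  \int[leb]_(r in D) rotint b q rho chi X (xi - b * chi) (phi - q * chi) r =
  \int[leb]_(r in D) rotint b q rho 0 X xi phi r.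
Proof.
move=> q0 rho0 chiI b01 X0; have mD := @msetD R.
have [b0 b1] := andP b01.
pose M c := \int[leb]_(r in D) rotint b q rho c X (xi - b * c) (phi - q * c) r.
have pi2 : 0 < pi / 2 :> R by rewrite divr_gt0// pi_gt0.
have -> : \int[leb]_(r in D) rotint b q rho 0 X xi phi r = M 0.
  by rewrite /M !mulr0 !subr0.
apply: (@der0_cst M (- (pi / 2)) (pi / 2)); last 2 first.
- by rewrite in_itv.
- by rewrite in_itv/= oppr_lt0 pi2.
move=> z; rewrite in_itv/= => zI.
have cz : 0 < cos z by exact: cos_gt0_pihalf.
(* Near [z] the cosine stays above half of its value at [z], which provides a common majorant for
   [drotint]. *)
pose c := cos z / 2.
have c0 : 0 < c by rewrite divr_gt0.
have cc : c < cos z by rewrite /c; lra.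
have [e /= e0 ez] : \forall y \near z, c < cos y.
  by have /cvgr_gt := @continuous_cos R z; exact.
have {}ez y : `|y - z| < e -> c <= cos y.
  by move=> yz; apply/ltW/ez; rewrite /ball/= distrC.
have rc : 0 < rho * c by rewrite mulr_gt0.
have q1 : 0 < q + 1 by rewrite addr_gt0.
have qb : 0 < q + b by rewrite addr_gt0.
have gi := intbleD mD (intbleD mD
    (intbleZ (2 * rho) mD (intble_powR_expRD q1 rc b01 X0))
    (intbleZ q mD (intble_powR_expRD q0 rc b01 X0)))
  (intbleZ (2 * b * X) mD (intble_powR_expRD qb rc b01 X0)).
have -> : 0 = \int[leb]_(r in D) drotint b q rho z X (xi - b * z) (phi - q * z) r.
  transitivity (0 - 0 : R); [by rewrite subrr|symmetry].
  have dd (r : R) : 0 < r -> exists l, is_derive r 1 (drotint b q rho z X (xi - b * z) (phi - q * z)) l.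
    by move=> r0; eexists; rewrite /drotint; der.
  have mdr : measurable_fun setT (drotint b q rho z X (xi - b * z) (phi - q * z)).
    by rewrite /drotint; mfun.
  apply: (@Rint_FTC _ _ (rotprim b q rho z X (xi - b * z) (phi - q * z))) => //.
  - by move=> r /dd [l]; exact: der_cont.
  - by move=> r r0; exact: derive_rotprim.
  - apply: intble_dom gi _ => //; first exact: mfunTS.
    move=> r /=; rewrite in_itv/= andbT => r0.
    by apply: drotint_le => //; exact: ltW.
  - exact: cvg_rotprim0.
  - exact: cvg_rotprimy.
apply: (is_derive_Rint (df := fun c => drotint b q rho c X (xi - b * c) (phi - q * c)) mD e0 _ _ gi).
- move=> y yz; apply: intble_rotint => //; exact: lt_le_trans (ez y yz).
- by move=> y r _ _; exact: derive_rotint.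
- move=> y r yz /=; rewrite in_itv/= andbT => r0.
  by apply: drotint_le => //; exact: ez.
Qed.

End Gamma.

(** * The product of Gamma at [p] and [1 - p] as a Beta integral *)

Section BetaIntegral.
Context {R : realType}.
Local Notation B p := (euler_gamma p * euler_gamma (1 - p)).
Implicit Types (p chi phi a bt u r : R).

Lemma Rint_expR_sin a bt phi : 0 < a ->
  \int[leb]_(r in D) (expR (- (a * r)) * sin (bt * r + phi)) =
  (a * sin phi + bt * cos phi) / (a ^+ 2 + bt ^+ 2).
Proof.
move=> a0; have mD := @msetD R.
have n0 : a ^+ 2 + bt ^+ 2 != 0.
  by rewrite gt_eqF// ltr_pwDl ?exprn_gt0// sqr_ge0.
have i0 := @intble_powR_expR R 1 a ltr01 a0.
pose F r := - (expR (- (a * r)) * (a * sin (bt * r + phi) + bt * cos (bt * r + phi)))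
  * (a ^+ 2 + bt ^+ 2)^-1.
have -> : (a * sin phi + bt * cos phi) / (a ^+ 2 + bt ^+ 2) =
    0 - (- ((a * sin phi + bt * cos phi) / (a ^+ 2 + bt ^+ 2))).
  by rewrite opprK add0r.
apply: (@Rint_FTC _ _ F).
- by move=> r r0; apply: der_cont; der.
- by mfun.
- move=> r r0; rewrite /F; derive_eq.
  by field.
- apply: (intble_dom mD _ i0); first by apply: mfunTS; mfun.
  by move=> r _; rewrite subrr powRr0 mul1r mulsin_le// expR_ge0.
- have h : {for 0, continuous F} by apply: der_cont; rewrite /F; der.
  have -> : - ((a * sin phi + bt * cos phi) / (a ^+ 2 + bt ^+ 2)) = F 0.
    by rewrite /F !mulr0 oppr0 expR0 add0r mul1r mulNr.
  exact: cvg_at_right_filter h.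
pose K : R := (`|a| + `|bt|) * `|(a ^+ 2 + bt ^+ 2)^-1|.
apply: (@cvg0_dom R R (pinfty_nbhs R) _ F (fun r : R => K * expR (- (a * r)))).
  near=> r; rewrite /F normrM normrN normrM (ger0_norm (expR_ge0 _)).
  rewrite -mulrA mulrC ler_wpM2r ?expR_ge0// /K ler_wpM2r// (le_trans (ler_normD _ _))//.
  by rewrite lerD// normrM -[leRHS]mulr1 ler_wpM2l ?sin_max ?cos_max.
rewrite -[X in _ --> X](mulr0 K); apply: cvgM; first exact: cvg_cst.
have := @powR_expR_cvgy R 0 a 1 a0 ltr01 (lexx 0).
apply: cvg_trans; apply: near_eq_cvg; near=> r.
rewrite powRr0 mul1r powRr1//; near: r; exact: nbhs_pinfty_ge.
Unshelve. all: by end_near. Qed.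

(** The bump with exponent [t = min p (1 - p)] dominates: [t <= 1 - p] is used near 0 and [t <= p]
    at infinity. The factor 4 bounds [(1 + r^t)^2] by 4 for [r <= 1] and by [4 r^(2 t)] for
    [r > 1]. *)
Lemma intble_powR_div1D p : 0 < p < 1 ->
  intble D (fun u : R => u `^ (- p) / (1 + u)).
Proof.
move=> /andP[p0 p1]; have mD := @msetD R.
pose t := Num.min p (1 - p).
have t0 : 0 < t by rewrite /t lt_min p0 subr_gt0.
have tp : t <= p by rewrite /t ge_min lexx.
have tq : t <= 1 - p by rewrite /t ge_min lexx orbT.
have u0 r : 0 < 1 + r `^ t by rewrite ltr_pwDl// powR_ge0.
have mf : measurable_fun setT (fun u : R => u `^ (- p) * (1 + u) `^ (- 1)) by mfun.
apply: (@intble_eq R D (fun u : R => u `^ (- p) * (1 + u) `^ (- 1))) => //.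
  by move=> u /=; rewrite in_itv/= andbT => u0'; rewrite powR_inv1// addr_ge0// ltW.
apply: (intble_dom mD _ (intbleZ (4 / t) mD (intble_powR_bump t0))).
  exact: mfunTS.
move=> r /=; rewrite in_itv/= andbT => r0.
have r1 : 0 < 1 + r by rewrite addr_gt0.
rewrite powR_inv1 ?(ltW r1)// ger0_norm ?divr_ge0 ?powR_ge0 ?(ltW r1)//.
have -> : 4 / t * (t * r `^ (t - 1) / (1 + r `^ t) ^+ 2) =
   4 * r `^ (t - 1) / (1 + r `^ t) ^+ 2.
  by field; rewrite !gt_eqF.
rewrite ler_pdivrMr// mulrAC ler_pdivlMr ?exprn_gt0//.
have [rle|rgt] := leP r 1.
  have h1 : r `^ t <= 1.
    have := @ge0_ler_powR _ t (ltW t0) r 1; rewrite powR1; apply => //.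
      by rewrite nnegrE ltW.
    by rewrite nnegrE.
  have h2 : r `^ (- p) <= r `^ (t - 1).
    by rewrite ger_powR ?r0 ?rle//; lra.
  have h3 : (1 + r `^ t) ^+ 2 <= 4.
    by have := powR_ge0 r t; move: h1; set s := r `^ t => h1 h4; nra.
  rewrite (@le_trans _ _ (r `^ (t - 1) * 4))//.
    by rewrite ler_pM ?powR_ge0 ?exprn_ge0// ltW.
  by have := powR_ge0 r (t - 1); set s := r `^ (t - 1) => s0; nra.
have h1 : 1 <= r `^ t by rewrite -(powRr0 r) ler_powR// ltW.
have h2 : (1 + r `^ t) ^+ 2 <= 4 * (r `^ t * r `^ t).
  by move: h1; set s := r `^ t => h1; nra.
rewrite (@le_trans _ _ (r `^ (- p) * (4 * (r `^ t * r `^ t))))//.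
  by rewrite ler_wpM2l// powR_ge0.
have h3 : r `^ (- p) * (r `^ t * r `^ t) <= r `^ (t - 1) * r.
  rewrite -[X in _ <= _ * X](powRr1 (ltW r0)) -!powRDp// ler_powR ?(ltW rgt)//; lra.
have := powR_ge0 r (t - 1); set s := r `^ (t - 1) in h3 * => s0; nra.
Qed.

(** Turn the integral for [euler_gamma p] by the angle [chi], write [euler_gamma (1 - p) r^(p-1)] as
    the integral of [u^(-p) exp (- r u)] over [u], and exchange the integrals: the one over [r]
    becomes the Laplace transform of a sine. *)
Lemma beta_rotation p chi phi : 0 < p < 1 -> - (pi / 2) < chi < pi / 2 ->
  euler_gamma p * euler_gamma (1 - p) * sin (p * chi + phi) =
  \int[leb]_(u in D) (u `^ (- p) *
     (((u + cos chi) * sin phi + sin chi * cos phi) /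
      ((u + cos chi) ^+ 2 + sin chi ^+ 2))).
Proof.
move=> /andP[p0 p1] chiI; have mD := @msetD R.
have q0 : 0 < 1 - p by rewrite subr_gt0.
have c0 : 0 < cos chi by exact: cos_gt0_pihalf.
(* [rotation] is applied with [X = 0], where the term in [r^b] disappears; 1/2 is one admissible
   exponent. *)
have b01 : 0 < (2^-1 : R) < 1 by lra.
have := @rotation R 2^-1 p 1 chi 0 0 (p * chi + phi) p0 ltr01 chiI b01 (lexx 0).
have -> : \int[leb]_(r in D) rotint 2^-1 p 1 0 0 0 (p * chi + phi) r =
    euler_gamma p * sin (p * chi + phi).
  rewrite -RintegralZr//; last first.
    by apply: intble_eq (intble_powR_expR p0 ltr01) => // r _; rewrite mul1r.
  apply: eq_Rintegral => r _; rewrite /rotint cos0 sin0.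
  by rewrite !(mul0r, mulr0, subr0, mulr1, mul1r, add0r) mulrA.
move=> E; rewrite mulrAC -E -RintegralZr//; last first.
  exact: intble_rotint.
transitivity (\int[leb]_(r in D) \int[leb]_(u in D)
    (u `^ (- p) * expR (- (r * u)) * (expR (- (cos chi * r)) * sin (sin chi * r + phi)))).
  apply: eq_Rintegral => r /set_mem/=; rewrite in_itv/= andbT => r0.
  have qE : 1 - p - 1 = - p by ring.
  have ii := intble_powR_expR q0 r0.
  have := euler_gamma_scale q0 r0; rewrite qE in ii * => G.
  rewrite RintegralZr// G /rotint !mul0r !subr0 !mul1r opprB.
  by rewrite (_ : p * chi + phi - p * chi = phi); ring.
rewrite (@fubini_dom R D D _
   (fun r u => expR (- (cos chi * r)) * (u `^ (1 - p - 1) * expR (- (r * u))))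
   (fun r => euler_gamma (1 - p) * (r `^ (p - 1) * expR (- (cos chi * r)))))//.
- apply: eq_Rintegral => u /set_mem/=; rewrite in_itv/= andbT => u0.
  have a0 : 0 < u + cos chi by rewrite addr_gt0.
  rewrite -Rint_expR_sin// -RintegralZl//; last first.
    apply: (intble_dom mD _ (@intble_powR_expR R 1 _ ltr01 a0)).
      by apply: mfunTS; mfun.
    by move=> r _; rewrite subrr powRr0 mul1r mulsin_le// expR_ge0.
  apply: eq_Rintegral => r _; rewrite mulrDl opprD expRD [r * u]mulrC; ring.
- by mfun.
- move=> r u _ _; rewrite (_ : 1 - p - 1 = - p); last by ring.
  rewrite normrM ger0_norm ?mulr_ge0 ?powR_ge0 ?expR_ge0// mulrC.
  by rewrite ler_wpM2r ?mulr_ge0 ?powR_ge0 ?expR_ge0// mulsin_le// expR_ge0.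
- by move=> r /=; rewrite in_itv/= andbT => r0; apply: intbleZ => //; exact: intble_powR_expR.
- move=> r /=; rewrite in_itv/= andbT => r0.
  rewrite RintegralZl//; last exact: intble_powR_expR.
  by rewrite euler_gamma_scale// opprB mulrCA [X in _ <= _ * X]mulrC.
- by apply: intbleZ => //; exact: intble_powR_expR.
move=> u /=; rewrite in_itv/= andbT => u0.
apply: (intble_dom mD _ (intbleZ (u `^ (- p)) mD (@intble_powR_expR R 1 _ ltr01 c0))).
  by apply: mfunTS; mfun.
move=> r /=; rewrite in_itv/= andbT => r0.
rewrite subrr powRr0 mul1r normrM ger0_norm ?mulr_ge0 ?powR_ge0 ?expR_ge0//.
rewrite -mulrA ler_wpM2l ?powR_ge0// -[leRHS]mul1r ler_pM ?expR_ge0//.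
  by rewrite expR_le1 oppr_le0 mulr_ge0 ?ltW.
by rewrite mulsin_le// expR_ge0.
Qed.

Lemma beta_int p : 0 < p < 1 -> B p = \int[leb]_(u in D) (u `^ (- p) / (1 + u)).
Proof.
move=> p01; have pi2 : 0 < pi / 2 :> R by rewrite divr_gt0// pi_gt0.
have := @beta_rotation p 0 (pi / 2) p01; rewrite oppr_lt0 pi2 => /(_ isT).
rewrite mulr0 add0r sin_pihalf mulr1 => ->.
apply: eq_Rintegral => u /set_mem/=; rewrite in_itv/= andbT => u0.
have n0 : 1 + u != 0 by rewrite gt_eqF// addr_gt0.
rewrite cos0 sin0 cos_pihalf; field.
exact: n0.
Qed.

(** This is the limit [chi -> pi / 2] of [beta_rotation] at [phi = 0]; at the angle [pi / 2] itself
    the decay of [exp (- r cos chi)] is lost. As [cos chi > 0], the denominators stay above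
    [1 + u^2], and [1 + u <= 2 (1 + u^2)] gives a majorant that does not depend on [chi]. *)
Lemma beta_sin p : 0 < p < 1 ->
  B p * sin (p * (pi / 2)) = \int[leb]_(u in D) (u `^ (- p) / (1 + u ^+ 2)).
Proof.
move=> p01; have mD := @msetD R.
have pi2 : 0 < pi / 2 :> R by rewrite divr_gt0// pi_gt0.
pose chi n : R := pi / 2 * (1 - (n.+1%:R)^-1).
have n1 n : 0 < (n.+1%:R : R)^-1 <= 1.
  by rewrite invr_gt0 ltr0n/= invf_le1 ?ltr0n// ler1n.
have chiI n : - (pi / 2) < chi n < pi / 2.
  have /andP[h1 h2] := n1 n; move: h1 h2 pi2; rewrite /chi.
  set P := pi / 2; set x := _^-1 => h1 h2 h3.
  have Px : 0 < P * x by rewrite mulr_gt0.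
  have Px1 : P * x <= P by rewrite ger_pMr.
  by apply/andP; split; lra.
have chi_cvg : chi n @[n --> \oo] --> pi / 2.
  rewrite (_ : pi / 2 = pi / 2 * (1 - 0) :> R); last by ring.
  apply: cvgM; first exact: cvg_cst.
  by apply: cvgB; [exact: cvg_cst|exact: cvg_harmonic].
have sin_cvg : sin (chi n) @[n --> \oo] --> (1 : R).
  rewrite -sin_pihalf; apply: (cvg_comp _ _ chi_cvg); exact: continuous_sin.
have cos_cvg : cos (chi n) @[n --> \oo] --> (0 : R).
  rewrite -[X in _ --> X]cos_pihalf; apply: (cvg_comp _ _ chi_cvg); exact: continuous_cos.
have c0 n : 0 < cos (chi n) by exact: cos_gt0_pihalf.
pose f_ n u := u `^ (- p) * (sin (chi n) / ((u + cos (chi n)) ^+ 2 + sin (chi n) ^+ 2)).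
have fE n u : 0 < u -> f_ n u = u `^ (- p) * (sin (chi n) *
    (u ^+ 2 + u * (2 * cos (chi n)) + 1) `^ (- 1)).
  move=> u0; rewrite /f_ powR_inv1; last first.
    by rewrite !addr_ge0 ?mulr_ge0 ?exprn_ge0 ?ltW.
  congr (_ * (_ / _)).
  transitivity (u ^+ 2 + u * (2 * cos (chi n)) + (cos (chi n) ^+ 2 + sin (chi n) ^+ 2)).
    by ring.
  by rewrite cos2Dsin2.
have [] := @dct R D (fun n u => u `^ (- p) * (sin (chi n) *
    (u ^+ 2 + u * (2 * cos (chi n)) + 1) `^ (- 1)))
   (fun u => u `^ (- p) / (1 + u ^+ 2)) (fun u => 2 * (u `^ (- p) / (1 + u))) mD.
- by move=> n; apply: mfunTS; mfun.
- by apply: intbleZ => //; exact: intble_powR_div1D.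
- move=> u uD; have u0 : 0 < u by move: uD; rewrite /= in_itv/= andbT.
  have n0 : 0 < 1 + u ^+ 2 by rewrite ltr_pwDl// sqr_ge0.
  have -> : (fun n => u `^ (- p) * (sin (chi n) *
    (u ^+ 2 + u * (2 * cos (chi n)) + 1) `^ (- 1))) = f_ ^~ u.
    by apply/funext => n; rewrite fE.
  apply: cvgM; first exact: cvg_cst.
  rewrite -[X in _ --> X]mul1r; apply: cvgM => //; apply: cvgV; first by rewrite gt_eqF.
  have -> : 1 + u ^+ 2 = (u + 0) * (u + 0) + 1 * 1 by ring.
  by rewrite /=; under eq_fun do rewrite !expr2; apply: cvgD; apply: cvgM => //;
    apply: cvgD => //; exact: cvg_cst.
- move=> n u uD; have u0 : 0 < u by move: uD; rewrite /= in_itv/= andbT.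
  have n0 : 0 < u ^+ 2 + u * (2 * cos (chi n)) + 1.
    by rewrite ltr_pwDr// addr_ge0 ?mulr_ge0 ?exprn_ge0 ?ltW.
  rewrite powR_inv1 ?(ltW n0)// normrM ger0_norm ?powR_ge0// [leRHS]mulrCA.
  rewrite ler_wpM2l ?powR_ge0// mulrC (le_trans (mulsin_le _ _)) ?invr_ge0 ?(ltW n0)//.
  rewrite ler_pdivlMr ?addr_gt0// mulrC ler_pdivrMr//.
  have := c0 n; set c := cos _ => cc0.
  have : 0 <= u * c by rewrite mulr_ge0 ?ltW.
  have := sqr_ge0 (u - 1/4); nra.
move=> _ h2; apply/esym; apply: (@cvg_unique _ (@Rhausdorff R) _ _ _ _ h2).
have -> : (fun n => \int[leb]_(u in D) (u `^ (- p) * (sin (chi n) *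
    (u ^+ 2 + u * (2 * cos (chi n)) + 1) `^ (- 1)))) =
    (fun n => B p * sin (p * chi n)).
  apply/funext => n; rewrite -[p * chi n]addr0 beta_rotation//.
  apply: eq_Rintegral => u /set_mem/=; rewrite in_itv/= andbT => u0.
  by rewrite -fE// /f_ sin0 cos0 mulr0 add0r mulr1.
apply: cvgM; first exact: cvg_cst.
have : p * chi n @[n --> \oo] --> p * (pi / 2) by apply: cvgM => //; exact: cvg_cst.
by move=> h; apply: (cvg_comp _ _ h); exact: continuous_sin.
Qed.

(** The substitution [u = v^(1/2)] in the integral of [beta_sin] produces half of the integral of
    [beta_int] at [(p + 1) / 2]. This duplication rule is what drives the reflection formula. *)
Lemma beta_half p : 0 < p < 1 -> 2 * sin (p * (pi / 2)) * B p = B ((p + 1) / 2).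
Proof.
move=> p01; have mD := @msetD R; have /andP[p0 p1] := p01.
have p01' : 0 < (p + 1) / 2 < 1 by lra.
rewrite -mulrA [sin _ * _]mulrC beta_sin// beta_int//.
have n0 u : 0 < 1 + u ^+ 2 :> R by rewrite ltr_pwDl// sqr_ge0.
have i1 := intble_powR_div1D p01; have i2 := intble_powR_div1D p01'.
have mG : measurable_fun setT (fun u : R => u `^ (- p) * (1 + u ^+ 2) `^ (- 1)) by mfun.
have E u : D u -> u `^ (- p) * (1 + u ^+ 2) `^ (- 1) = u `^ (- p) / (1 + u ^+ 2).
  by move=> _; rewrite powR_inv1 ?(ltW (n0 u)).
have S u : D u -> (1 * u `^ 2^-1) `^ (- p) * (1 + (1 * u `^ 2^-1) ^+ 2) `^ (- 1) *
    (1 * 2^-1 * u `^ (2^-1 - 1)) = 2^-1 * (u `^ (- ((p + 1) / 2)) / (1 + u)).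
  rewrite /= in_itv/= andbT => u0; rewrite !mul1r -powRrM.
  have -> : (u `^ 2^-1) ^+ 2 = u.
    by rewrite -(@powR_mulrn _ _ 2) ?powR_ge0// -powRrM mulVf ?powRr1 ?(ltW u0).
  have -> : u `^ (- ((p + 1) / 2)) = u `^ (2^-1 * - p) * u `^ (2^-1 - 1).
    by rewrite -powRDp//; congr (_ `^ _); field.
  by rewrite powR_inv1 ?addr_ge0 ?(ltW u0)//; ring.
rewrite -(@eq_Rintegral _ _ R leb D _ _ (fun u uD => E u (set_mem uD))).
rewrite (@Rint_subst_powR R _ 1 2^-1 ltr01)//.
- rewrite (@eq_Rintegral _ _ R leb D _ _ (fun u uD => S u (set_mem uD))).
  by rewrite RintegralZl//; field.
- move=> u u0; suff : {for u, continuous (fun u : R => u `^ (- p) / (1 + u ^+ 2))}.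
    move=> h; apply: cvg_trans; last first.
      rewrite /= E; first exact: h.
      by rewrite /= in_itv/= andbT.
    apply: near_eq_cvg; near=> y; rewrite /= E//= in_itv/= andbT.
    by near: y; exact: lt_nbhsr.
  apply: (@der_cont R _ _ (_ : R)); apply: derM; first by der.
  have -> : (fun y : R => (1 + y ^+ 2)^-1) = (fun y => (1 + y * y)^-1).
    by apply/funext => y; rewrite expr2.
  by notypeclasses refine (derV _ _); [rewrite -expr2 gt_eqF|der].
- apply: (intble_dom mD _ (intbleZ 2 mD i1)); first exact: mfunTS.
  move=> u uD; have u0 : 0 < u by move: uD; rewrite /= in_itv/= andbT.
  rewrite E// ger0_norm ?divr_ge0 ?powR_ge0 ?(ltW (n0 u))//.
  rewrite mulrCA ler_wpM2l ?powR_ge0// ler_pdivlMr ?addr_gt0// mulrC ler_pdivrMr//.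
  by have := sqr_ge0 (u - 1/4); nra.
- by apply: intble_eq (intbleZ 2^-1 mD i2) => // u uD; rewrite S.
Unshelve. all: by end_near. Qed.


End BetaIntegral.

Local Opaque euler_gamma.

(** * The reflection formula and the reciprocal of Gamma *)

Section Reflection.
Context {R : realType}.
Local Notation B p := (euler_gamma p * euler_gamma (1 - p)).
Implicit Types (p chi phi a bt u r : R).

(** The bounds on [u n] keep the integrand below the sum of the integrands at the extreme exponents,
    one being the larger for [r <= 1] and the other for [r > 1]. *)
Lemma euler_gamma_cvg1 (u : nat -> R) : (forall n, 2^-1 <= u n <= 3 / 2) ->
  u n @[n --> \oo] --> (1 : R) -> euler_gamma (u n) @[n --> \oo] --> (1 : R).
Proof.
move=> ub uc; have mD := @msetD R; rewrite -[X in _ --> X](@euler_gamma1 R).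
have h0 : 0 < 2^-1 :> R by rewrite invr_gt0.
have h1 : 0 < 3 / 2 :> R by rewrite divr_gt0.
have [] := @dct R D (fun n r => r `^ (u n - 1) * expR (- r))
   (fun r => r `^ (1 - 1) * expR (- r))
   (fun r => r `^ (2^-1 - 1) * expR (- (1 * r)) + r `^ (3 / 2 - 1) * expR (- (1 * r))) mD.
- by move=> n; apply: mfunTS; mfun.
- by apply: intbleD => //; exact: intble_powR_expR.
- move=> r /=; rewrite in_itv/= andbT => r0; apply: cvgM; last exact: cvg_cst.
  rewrite /powR gt_eqF//.
  apply: continuous_cvg; first exact: continuous_expR.
  apply: cvgM; last exact: cvg_cst.
  by apply: cvgB => //; exact: cvg_cst.
- move=> n r /=; rewrite in_itv/= andbT => r0; have /andP[un un'] := ub n.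
  rewrite mul1r -mulrDl ger0_norm ?mulr_ge0 ?powR_ge0 ?expR_ge0//.
  rewrite ler_wpM2r ?expR_ge0//; have [r1|r1] := leP r 1.
    by rewrite (le_trans (_ : _ <= r `^ (2^-1 - 1))) ?lerDl ?powR_ge0// ger_powR ?r0 ?r1//; lra.
  by rewrite (le_trans (_ : _ <= r `^ (3 / 2 - 1))) ?lerDr ?powR_ge0// ler_powR ?(ltW r1)//; lra.
by move=> _.
Qed.

Lemma sinc_cvg (u : nat -> R) : (forall n, u n != 0) ->
  u n @[n --> \oo] --> (0 : R) -> sin (u n) / u n @[n --> \oo] --> (1 : R).
Proof.
move=> u0 uc; have [] := is_derive_sin (0 : R); rewrite cos0 => hd hE.
have : (fun h : R => h^-1 *: ((sin \o shift 0) (h *: 1) - sin 0)) @ (0 : R)^' -->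
    'D_1 sin (0 : R) by exact: hd.
rewrite hE => /cvgr_dnbhsP /(_ u); rewrite /=.
under [X in _ -> X @ _ --> _]eq_fun => n do rewrite mulrC.
move=> H; have := H (conj u0 uc).
apply: cvg_trans; apply: near_eq_cvg; apply: nearW => n /=.
by rewrite sin0 subr0 addr0 /GRing.scale/= mulr1.
Qed.

(** By [beta_half] and the doubling formula for the sine, the left side does not change when [p] is
    replaced by [(p + 1) / 2]. The iterates tend to 1, where the functional equation moves the pole
    of the second Gamma factor into a quotient: the limit is [pi] times that of [sin y / y]. *)
Lemma euler_gamma_reflection p : 0 < p < 1 ->
  euler_gamma p * euler_gamma (1 - p) * sin (pi * p) = pi.
Proof.
move=> p01; have /andP[p0 p1] := p01.
(* The sequence starts with the first iterate [(p + 1) / 2] instead of [p], so that [1/2 <= v n] and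
   [2 - v n <= 3/2], as [euler_gamma_cvg1] requires. *)
pose v n : R := 1 - (1 - p) / 2 ^+ n.+1.
have x0 n : 0 < (1 - p) / 2 ^+ n.+1 by rewrite divr_gt0 ?subr_gt0 ?exprn_gt0.
have x1 n : (1 - p) / 2 ^+ n.+1 <= 2^-1.
  rewrite exprS invfM mulrCA ger_pMr ?invr_gt0// mulrC ler_pdivrMl ?exprn_gt0//.
  rewrite mulr1 (@le_trans _ _ 1)//; first lra.
  by rewrite exprn_ege1// ler1n.
have v01 n : 0 < v n < 1 by rewrite /v; have := x0 n; have := x1 n; lra.
have step (q : R) : 0 < q < 1 -> B q * sin (pi * q) = B ((q + 1) / 2) * sin (pi * ((q + 1) / 2)).
  move=> q01; rewrite -(beta_half q01).
  have -> : pi * ((q + 1) / 2) = q * (pi / 2) + pi / 2 :> R by field.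
  rewrite sinDpihalf; have -> : pi * q = (q * (pi / 2)) *+ 2 :> R by rewrite mulr2n; field.
  by rewrite sin_mulr2n mulr2n; ring.
have vS n : v n.+1 = (v n + 1) / 2.
  by rewrite /v [in 2 ^+ n.+2]exprS; field; rewrite expf_neq0.
have cst n : B p * sin (pi * p) = B (v n) * sin (pi * v n).
  elim: n => [|n ->]; last by rewrite vS; exact: step.
  have -> : v 0%N = (p + 1) / 2 by rewrite /v expr1; field.
  exact: step.
have xc : (1 - p) / 2 ^+ n.+1 @[n --> \oo] --> (0 : R).
  have : 2^-1 ^+ n @[n --> \oo] --> (0 : R).
    by apply: cvg_expr; rewrite ger0_norm// invf_lt1// ltr1n.
  rewrite -(cvg_shiftn 1) => h.
  have -> : (fun n => (1 - p) / 2 ^+ n.+1) = (fun n => (1 - p) * 2^-1 ^+ (n + 1)%N).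
    by apply/funext => n; rewrite addn1 exprVn.
  by rewrite -[X in _ --> X](mulr0 (1 - p)); apply: cvgM => //; exact: cvg_cst.
have vc : v n @[n --> \oo] --> (1 : R).
  by rewrite -[X in _ --> X]subr0; apply: cvgB => //; exact: cvg_cst.
have wc : 2 - v n @[n --> \oo] --> (1 : R).
  rewrite [X in _ --> X](_ : 1 = 2 - 1 :> R); last by ring.
  by apply: cvgB => //; exact: cvg_cst.
have gv : euler_gamma (v n) @[n --> \oo] --> (1 : R).
  by apply: euler_gamma_cvg1 => // n; rewrite /v; have := x0 n; have := x1 n; lra.
have gw : euler_gamma (2 - v n) @[n --> \oo] --> (1 : R).
  by apply: euler_gamma_cvg1 => // n; rewrite /v; have := x0 n; have := x1 n; lra.
pose y n : R := pi * (1 - v n).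
have y0 n : y n != 0.
  by rewrite /y mulf_neq0// ?gt_eqF ?pi_gt0 ?subr_gt0//; have /andP[] := v01 n.
have yc : y n @[n --> \oo] --> (0 : R).
  rewrite -[X in _ --> X](mulr0 pi); apply: cvgM; first exact: cvg_cst.
  by rewrite -(subrr 1); apply: cvgB => //; exact: cvg_cst.
have sc := sinc_cvg y0 yc.
have E n : B (v n) * sin (pi * v n) =
   pi * (euler_gamma (v n) * euler_gamma (2 - v n) * (sin (y n) / y n)).
  have h : 0 < 1 - v n by rewrite subr_gt0; have /andP[] := v01 n.
  have -> : 2 - v n = (1 - v n) + 1 by ring.
  have -> : pi * v n = - y n + pi by rewrite /y; ring.
  rewrite (euler_gammaS h) (sinDpi (- y n)) sinN opprK /y.
  have K (w z s A A' : R) : w != 0 -> z != 0 ->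
      A * A' * s = w * (A * (z * A') * (s / (w * z))).
    by move=> w0 z0; field; rewrite ?w0 ?z0.
  by apply: K; rewrite gt_eqF// pi_gt0.
have : pi * (euler_gamma (v n) * euler_gamma (2 - v n) * (sin (y n) / y n))
    @[n --> \oo] --> (pi * (1 * 1 * 1) : R).
  have h1 : euler_gamma (v n) * euler_gamma (2 - v n) @[n --> \oo] --> (1 * 1 : R).
    exact: cvgM gv gw.
  have h2 : euler_gamma (v n) * euler_gamma (2 - v n) * (sin (y n) / y n)
      @[n --> \oo] --> (1 * 1 * 1 : R) by exact: cvgM h1 sc.
  by apply: cvgM => //; exact: cvg_cst.
rewrite !mulr1; under eq_fun do rewrite -E -cst.
move=> h2; apply/esym; apply: (@cvg_unique _ (@Rhausdorff R) _ _ _ _ h2).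
exact: cvg_cst.
Qed.

(** For [0 < P < 1] this is the reflection formula. Larger [P] are reached through the functional
    equation, each step of which changes the sign of the sine. At positive integers both sides are
    0, on the left by the convention at the poles and on the right because of the sine. The lemma
    turns the coefficients of the Wright series into integrals over the half-line. *)
Lemma Gamma_inv (P : R) : 0 < P ->
  (Gamma (1 - P))^-1 = euler_gamma P * sin (pi * P) / pi.
Proof.
have pi0 : (pi : R) != 0 by rewrite gt_eqF// pi_gt0.
have base (y : R) : 0 < y < 1 ->
    (euler_gamma y)^-1 = euler_gamma (1 - y) * sin (pi * (1 - y)) / pi.
  move=> /andP[y0 y1].
  have := @euler_gamma_reflection (1 - y); rewrite subr_gt0 y1 ltrBlDr ltrDl y0.
  move=> /(_ isT); rewrite opprB addrCA subrr addr0 => E.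
  have g0 : euler_gamma y != 0.
    by apply/negP => /eqP h; move: E; rewrite h mulr0 mul0r => /esym/eqP; rewrite (negPf pi0).
  apply: (mulfI g0); rewrite mulfV// !mulrA.
  by rewrite [euler_gamma y * _]mulrC E divff.
have rec m (y : R) : 0 < y <= 1 -> (0 < m)%N || (y < 1) ->
   (euler_gamma y / \prod_(i < m) (y - m%:R + i%:R))^-1 =
   euler_gamma (1 - y + m%:R) * sin (pi * (1 - y + m%:R)) / pi.
  move=> /andP[y0 y1].
  have step k : (euler_gamma y / \prod_(i < k) (y - k%:R + i%:R))^-1 =
      euler_gamma (1 - y + k%:R) * sin (pi * (1 - y + k%:R)) / pi ->
      0 < 1 - y + k%:R ->
      (euler_gamma y / \prod_(i < k.+1) (y - k.+1%:R + i%:R))^-1 =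
      euler_gamma (1 - y + k.+1%:R) * sin (pi * (1 - y + k.+1%:R)) / pi.
    move=> IH k0; rewrite big_ord_recl/= addr0.
    have -> : \prod_(i < k) (y - k.+1%:R + (bump 0 i)%:R) = \prod_(i < k) (y - k%:R + i%:R).
      by apply: eq_bigr => i _; rewrite /bump/= add1n -!natr1; ring.
    rewrite invfM invrK mulrCA.
    have -> : (euler_gamma y)^-1 * \prod_(i < k) (y - k%:R + i%:R) =
      (euler_gamma y / \prod_(i < k) (y - k%:R + i%:R))^-1 by rewrite invfM invrK.
    rewrite IH -natr1 addrA euler_gammaS//.
    have -> : pi * (1 - y + k%:R + 1) = pi * (1 - y + k%:R) + pi by ring.
    by rewrite sinDpi; ring.
  case: m => [|m] /=.
    by move=> y1'; rewrite big_ord0 divr1 addr0 base// y0 y1'.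
  move=> _; have [y1'|y1'] := ltP y 1.
    have base0 : (euler_gamma y / \prod_(i < 0) (y - 0%:R + i%:R))^-1 =
        euler_gamma (1 - y + 0%:R) * sin (pi * (1 - y + 0%:R)) / pi.
      by rewrite big_ord0 divr1 addr0 base// y0 y1'.
    elim: m => [|m IH]; apply: step => //; rewrite ?addr0 ?subr_gt0//.
    by rewrite ltr_wpDr// subr_gt0.
  have yE : y = 1 by apply/le_anti; rewrite y1 y1'.
  rewrite yE in step *.
  elim: m => [|m IH].
    by rewrite big_ord_recl/= addr0 subrr mul0r invr0 mulr0 invr0 add0r mulr1 sinpi mulr0 mul0r.
  by apply: step => //; rewrite subrr add0r ltr0n.
move=> P0; rewrite /Gamma; case: ifPn => [h|].
  have hP : 0 < 1 - P < 1 by rewrite h gtrBl.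
  by rewrite (base _ hP) subKr.
rewrite -leNgt => h; set m := (Num.truncn _).+1.
have h' : 0 <= - (1 - P) by rewrite oppr_ge0.
have /andP[t1 t2] := truncn_itv h'.
have -> : \prod_(i < m) (1 - P + i%:R) = \prod_(i < m) (1 - P + m%:R - m%:R + i%:R).
  by apply: eq_bigr => i _; rewrite addrK.
(* The shift by [m] moves [1 - P] into [(0, 1]], and the endpoint 1 is attained exactly when [P] is
   an integer. *)
have y01 : 0 < 1 - P + m%:R <= 1 by rewrite /m -natr1; lra.
by rewrite rec// opprD addrA addrNK opprB addrCA subrr addr0.
Qed.

Lemma euler_gamma_neq0 p : 0 < p < 1 -> euler_gamma p != 0.
Proof.
move=> p01; have := euler_gamma_reflection p01.
apply: contra_eqN => /eqP ->; rewrite !mul0r.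
by rewrite eq_sym gt_eqF// pi_gt0.
Qed.

End Reflection.

Lemma derX {R : realType} (f : R -> R) (x a : R) (n : nat) : is_derive x 1 f a ->
  is_derive x 1 (fun y => f y ^+ n.+1) (n.+1%:R * f x ^+ n * a).
Proof.
move=> df; elim: n => [|n IH]; first by apply: der_eq df _; rewrite expr0; ring.
apply: (der_eq (derM df IH)).
by rewrite -[in RHS]natr1 [in RHS]exprS exprS -natr1; ring.
Qed.

(** * Expansion of the rotated integrals in powers of [X] *)

Section Series.
Context {R : realType}.
Implicit Types (b q rho X xi phi r y : R).

(** The [k]-th term in the expansion of the imaginary part of [exp (i phi - y e^(i xi))] in powers
    of [y]. *)
Definition expsin_term xi phi y (k : nat) : R :=
  (- y) ^+ k / k`!%:R * sin (phi + k%:R * xi).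

(** Induction on [n] by comparing derivatives in [y]: differentiation lowers the index of the terms
    and moves [phi] to [phi + xi], so the remainder [G] of order [n + 1] has as derivative minus the
    remainder of order [n] at [phi + xi]. The derivative of the bound [H] is at least the bound of
    order [n]. Since [G] and [H] vanish at 0, both [H + G] and [H - G] are nonnegative. *)
Lemma expsin_remainder xi (n : nat) phi y : 0 <= y ->
  `|expR (- (y * cos xi)) * sin (phi - y * sin xi) -
    \sum_(0 <= k < n) expsin_term xi phi y k| <= y ^+ n / n`!%:R * expR y.
Proof.
elim: n phi y => [|n IH] phi y y0.
  rewrite big_nil subr0 expr0 fact0 divr1 mul1r (le_trans (mulsin_le _ (expR_ge0 _)))//.
  by rewrite ler_expR -mulrN -[leRHS]mulr1 ler_wpM2l//.
pose g (p z : R) := expR (- (z * cos xi)) * sin (p - z * sin xi) -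
    \sum_(0 <= k < n) expsin_term xi p z k.
pose G (z : R) := expR (- (z * cos xi)) * sin (phi - z * sin xi) -
    \sum_(0 <= k < n.+1) expsin_term xi phi z k.
pose H (z : R) := z ^+ n.+1 / n.+1`!%:R * expR z.
have dT k (z : R) : is_derive z 1 (fun z => expsin_term xi phi z k.+1)
    (- expsin_term xi (phi + xi) z k).
  have hX := derX k (derN (derI z)).
  apply: (der_eq (derM (derM hX (derC z _)) (derC z _))).
  rewrite /expsin_term !mulr0 !add0r factS natrM.
  have f0 : (k`!%:R : R) != 0 by rewrite pnatr_eq0 -lt0n fact_gt0.
  have k0 : (k.+1%:R : R) != 0 by rewrite pnatr_eq0.
  rewrite (_ : phi + k.+1%:R * xi = phi + xi + k%:R * xi); last by rewrite -natr1; ring.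
  by move: (k.+1%:R : R) k0 => N N0; field; rewrite ?f0 ?N0.
have dS (m : nat) (z : R) : is_derive z 1
    (fun z => \sum_(0 <= k < m.+1) expsin_term xi phi z k : R)
    (- \sum_(0 <= k < m) expsin_term xi (phi + xi) z k : R).
  elim: m => [|m IHm].
    rewrite big_nil oppr0.
    have -> : (fun z0 : R => \sum_(0 <= k < 1) expsin_term xi phi z0 k) = (fun _ => sin phi).
      by apply/funext => w; rewrite big_nat1 /expsin_term expr0 fact0 divr1 mul1r mul0r addr0.
    exact: derC.
  rewrite big_nat_recr//= opprD.
  have -> : (fun z0 : R => \sum_(0 <= k < m.+2) expsin_term xi phi z0 k) =
    (fun z0 => \sum_(0 <= k < m.+1) expsin_term xi phi z0 k + expsin_term xi phi z0 m.+1).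
    by apply/funext => w; rewrite big_nat_recr.
  exact: derD.
have dG (z : R) : is_derive z 1 G (- g (phi + xi) z).
  notypeclasses refine (der_eq (derD _ (derN (dS n z))) _); [der|cbv beta].
  rewrite /g (_ : phi + xi - z * sin xi = (phi - z * sin xi) + xi); last by ring.
  by rewrite (sinD (phi - z * sin xi)); ring.
have dH (z : R) : is_derive z 1 H (z ^+ n / n`!%:R * expR z + H z).
  have hX := derX n (derI z).
  apply: (der_eq (derM (derM hX (derC z _)) (derexp (derI z)))).
  rewrite /H factS natrM.
  have f0 : (n`!%:R : R) != 0 by rewrite pnatr_eq0 -lt0n fact_gt0.
  have k0 : (n.+1%:R : R) != 0 by rewrite pnatr_eq0.
  by move: (n.+1%:R : R) k0 => N N0; field; rewrite ?f0 ?N0.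
have G0 : G 0 = 0.
  rewrite /G !mul0r oppr0 expR0 mul1r addr0 big_nat_recl//= big1 ?addr0; last first.
    by move=> i _; rewrite /expsin_term oppr0 expr0n/= mul0r mul0r.
  by rewrite /expsin_term expr0 fact0 divr1 mul1r mul0r addr0 subrr.
have H0 : H 0 = 0 by rewrite /H expr0n/= !mul0r.
have mono (K K' : R -> R) : (forall z : R, is_derive z 1 K (K' z)) ->
    (forall z : R, 0 <= z -> 0 <= K' z) -> K 0 <= K y.
  move=> dK K0.
  apply: (@ger0_derive1_le_cc _ K 0 y) => //; rewrite ?in_itv/= ?lexx ?y0//.
  - by move=> z; rewrite in_itv/= => /andP[z0 _]; have [_ E] := dK z; rewrite derive1E E K0// ltW.
  - by apply: continuous_in_subspaceT => z _; exact: der_cont (dK z).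
have Hge (z : R) : 0 <= z -> `|g (phi + xi) z| <= z ^+ n / n`!%:R * expR z + H z.
  move=> z0; rewrite (le_trans (IH _ _ z0))// lerDl /H.
  by rewrite mulr_ge0 ?expR_ge0// divr_ge0 ?exprn_ge0.
rewrite -/(G y) -/(H y) ler_norml; apply/andP; split.
  have := mono (fun z => G z + H z) _ (fun z => derD (dG z) (dH z)).
  rewrite G0 H0 add0r => h.
  have : 0 <= G y + H y.
    by apply: h => z /Hge; rewrite ler_norml => /andP[_]; lra.
  by lra.
have := mono (fun z => H z - G z) _ (fun z => derD (dH z) (derN (dG z))).
rewrite G0 H0 subr0 => h.
have : 0 <= H y - G y.
  by apply: h => z /Hge; rewrite ler_norml => /andP[+ _]; lra.
by lra.
Qed.

Lemma expsin_cvg xi phi y : 0 <= y ->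
  \sum_(0 <= k < n) expsin_term xi phi y k @[n --> \oo] -->
  expR (- (y * cos xi)) * sin (phi - y * sin xi).
Proof.
move=> y0; set l := expR _ * _.
have : (l - \sum_(0 <= k < n) expsin_term xi phi y k) @[n --> \oo] --> (0 : R).
  apply: (@cvg0_dom R nat \oo _ _ (fun n => y ^+ n / n`!%:R * expR y)).
    by apply: nearW => n; exact: expsin_remainder.
  rewrite -[X in _ --> X](mul0r (expR y)); apply: cvgM; last exact: cvg_cst.
  exact: cvg_series_cvg_0 (is_cvg_series_exp_coeff y).
move=> h; rewrite -[X in _ --> X]subr0.
have -> : (fun n => \sum_(0 <= k < n) expsin_term xi phi y k) =
  (fun n => l - (l - \sum_(0 <= k < n) expsin_term xi phi y k)).
  by apply/funext => n; ring.
by apply: cvgB => //; exact: cvg_cst.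
Qed.

(** Uniformity in [n] is the point: with [y = X r^b] this is the domination needed for termwise
    integration. *)
Lemma expsin_sum_le xi phi y n : 0 <= y ->
  `|\sum_(0 <= k < n) expsin_term xi phi y k| <= 2 * expR (2 * y).
Proof.
move=> y0; have := expsin_remainder xi n phi y0; set l := expR _ * _; set s := \sum_(_ <= _ < _) _.
have ly : `|l| <= expR y.
  by rewrite (le_trans (mulsin_le _ (expR_ge0 _)))// ler_expR -mulrN -[leRHS]mulr1 ler_wpM2l//.
have h1 : y ^+ n / n`!%:R * expR y <= expR (2 * y).
  by rewrite mulr_natl mulr2n expRD ler_wpM2r ?expR_ge0// expR_ge_pow.
have h2 : expR y <= expR (2 * y) by rewrite ler_expR; lra.
move=> h3; rewrite (_ : s = l - (l - s)); last by ring.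
rewrite (le_trans (ler_normB _ _))//; lra.
Qed.

(** Termwise integration is justified by the majorant [2 r^(q-1) exp (- rho r + 2 X r^b)],
    integrable because [b < 1]; each term is then a scaled Gamma integral. *)
Lemma rotint_series b q rho X xi phi : 0 < q -> 0 < rho -> 0 < b < 1 -> 0 <= X ->
  \sum_(0 <= k < n) ((- X) ^+ k / k`!%:R * sin (phi + k%:R * xi) *
     (euler_gamma (q + b * k%:R) * rho `^ (- (q + b * k%:R)))) @[n --> \oo] -->
  \int[leb]_(r in D) rotint b q rho 0 X xi phi r.
Proof.
move=> q0 rho0 b01 X0; have mD := @msetD R; have /andP[b0 b1] := b01.
pose t_ k r := ((- X) ^+ k / k`!%:R * sin (phi + k%:R * xi)) *
   (r `^ (q + b * k%:R - 1) * expR (- (rho * r))).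
have qk k : 0 < q + b * k%:R by rewrite ltr_pwDl// mulr_ge0 ?(ltW b0).
have ti k : intble D (t_ k) by apply: intbleZ => //; exact: intble_powR_expR.
have tE k r : 0 < r -> t_ k r = r `^ (q - 1) * expR (- (rho * r)) * expsin_term xi phi (X * r `^ b) k.
  move=> r0; rewrite /t_ /expsin_term addrAC (powRDp (q - 1) _ r0).
  by rewrite powRrM powR_mulrn ?powR_ge0// -(mulNr X) exprMn; ring.
have [] := @dct R D (fun n r => \sum_(0 <= k < n) t_ k r)
   (rotint b q rho 0 X xi phi)
   (fun r => 2 * (r `^ (q - 1) * expR (- (rho * r) + 2 * X * r `^ b))) mD.
- move=> n; have [h _] := Rintegral_sum n mD ti.
  by apply/measurable_EFinP; exact: measurable_int h.
- by apply: intbleZ => //; apply: intble_powR_expRD => //; rewrite mulr_ge0.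
- move=> r /=; rewrite in_itv/= andbT => r0.
  have y0 : 0 <= X * r `^ b by rewrite mulr_ge0 ?powR_ge0.
  have -> : (fun n => \sum_(0 <= k < n) t_ k r) = (fun n => r `^ (q - 1) * expR (- (rho * r)) *
      \sum_(0 <= k < n) expsin_term xi phi (X * r `^ b) k).
    by apply/funext => n; rewrite big_distrr/=; apply: eq_bigr => k _; rewrite tE.
  have -> : rotint b q rho 0 X xi phi r = r `^ (q - 1) * expR (- (rho * r)) *
     (expR (- (X * r `^ b * cos xi)) * sin (phi - X * r `^ b * sin xi)).
    rewrite /rotint cos0 sin0 !mulr1 mulr0 mul0r add0r expRD.
    by rewrite [X * cos xi * _]mulrAC [X * sin xi * _]mulrAC; ring.
  by apply: cvgM; [exact: cvg_cst|exact: expsin_cvg].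
- move=> n r /=; rewrite in_itv/= andbT => r0.
  have y0 : 0 <= X * r `^ b by rewrite mulr_ge0 ?powR_ge0.
  have -> : \sum_(0 <= k < n) t_ k r = r `^ (q - 1) * expR (- (rho * r)) *
      \sum_(0 <= k < n) expsin_term xi phi (X * r `^ b) k.
    by rewrite big_distrr/=; apply: eq_bigr => k _; rewrite tE.
  rewrite normrM ger0_norm ?mulr_ge0 ?powR_ge0 ?expR_ge0//.
  rewrite [leRHS]mulrCA -[leLHS]mulrA ler_wpM2l ?powR_ge0// expRD [leRHS]mulrCA.
  rewrite ler_wpM2l ?expR_ge0//.
  by rewrite -mulrA expsin_sum_le.
move=> _; suff -> : (fun n => \int[leb]_(r in D) \sum_(0 <= k < n) t_ k r) =
  (fun n => \sum_(0 <= k < n) ((- X) ^+ k / k`!%:R * sin (phi + k%:R * xi) *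
     (euler_gamma (q + b * k%:R) * rho `^ (- (q + b * k%:R))))) by [].
apply/funext => n; have [_ ->] := Rintegral_sum n mD ti.
apply: eq_bigr => k _; rewrite RintegralZl//; last exact: intble_powR_expR.
by rewrite euler_gamma_scale.
Qed.

End Series.

(** * The kernels *)

Section Kernel.
Context {R : realType}.
Implicit Types (b q psi theta rho chi X xi phi r t : R).

Lemma dct_near (A : set R) (f_ : nat -> R -> R) (f g : R -> R) : msetR A ->
  (forall n, mfunR A (f_ n)) -> intble A g ->
  (forall x, A x -> f_ n x @[n --> \oo] --> f x) ->
  (\forall n \near \oo, forall x, A x -> `|f_ n x| <= g x) ->
  \int[leb]_(x in A) f_ n x @[n --> \oo] --> \int[leb]_(x in A) f x.
Proof.
move=> mA mf gi ff [N _ Ng]; rewrite -(cvg_shiftn N).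
have [] := @dct R A (fun n => f_ (n + N)%N) f g mA _ gi _ _ => //.
  by move=> x Ax; rewrite (cvg_shiftn N (f_ ^~ x)); exact: ff.
by move=> n x Ax; apply: Ng => //=; rewrite leq_addl.
Qed.

(** At [chi = - pi / 2] or [pi / 2] the factor [exp (- rho r cos chi)] no longer decays and the term
    in [r^b] has to take over, hence [X > 0] and the positive cosine of [xi - b chi]. The angles
    [u n] approach [chi] from inside, and the cosine exceeds [c] for all large [n]. *)
Lemma rotation_limit b q rho chi X xi phi : 0 < q -> 0 < rho ->
  - (pi / 2) <= chi <= pi / 2 -> 0 < b < 1 -> 0 < X -> 0 < cos (xi - b * chi) ->
  \int[leb]_(r in D) rotint b q rho chi X (xi - b * chi) (phi - q * chi) r =
  \int[leb]_(r in D) rotint b q rho 0 X xi phi r.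
Proof.
move=> q0 rho0 chiI b01 X0 c0; have mD := @msetD R; have /andP[b0 b1] := b01.
have pi2 : 0 < pi / 2 :> R by rewrite divr_gt0// pi_gt0.
pose u n : R := chi * (1 - n.+1%:R^-1).
have uI n : - (pi / 2) < u n < pi / 2.
  have : 0 < (n.+1%:R : R)^-1 by rewrite invr_gt0.
  have : (n.+1%:R : R)^-1 <= 1 by rewrite invf_le1// ler1n.
  rewrite /u; move: chiI pi2; set P := pi / 2; set x := _^-1 => /andP[h1 h2] h3 h4 h5.
  by apply/andP; split; nra.
have uc : u n @[n --> \oo] --> chi.
  rewrite [X in _ --> X](_ : chi = chi * (1 - 0)); last by ring.
  apply: cvgM; first exact: cvg_cst.
  by apply: cvgB; [exact: cvg_cst|exact: cvg_harmonic].
have sinc (f : nat -> R) (l : R) : f n @[n --> \oo] --> l -> sin (f n) @[n --> \oo] --> sin l.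
  by move=> h; apply: (cvg_comp _ _ h); exact: continuous_sin.
have cosc (f : nat -> R) (l : R) : f n @[n --> \oo] --> l -> cos (f n) @[n --> \oo] --> cos l.
  by move=> h; apply: (cvg_comp _ _ h); exact: continuous_cos.
have cK (k l : R) : l - k * u n @[n --> \oo] --> l - k * chi.
  by apply: cvgB; [exact: cvg_cst|apply: cvgM => //; exact: cvg_cst].
pose c := cos (xi - b * chi) / 2.
have cc0 : 0 < c by rewrite divr_gt0.
have cc : c < cos (xi - b * chi) by rewrite /c; lra.
have H : \int[leb]_(r in D) rotint b q rho (u n) X (xi - b * u n) (phi - q * u n) r
    @[n --> \oo] -->
    \int[leb]_(r in D) rotint b q rho chi X (xi - b * chi) (phi - q * chi) r.
  apply: (@dct_near _ _ _ (fun r => r `^ (q - 1) * expR (- (X * c * r `^ b)))) => //.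
  - by move=> n; apply: mfunTS; exact: measurable_rotint.
  - by apply: intble_powR_expR_powR => //; rewrite mulr_gt0.
  - move=> r _; rewrite /rotint; apply: cvgM; first exact: cvg_cst.
    have k (x : R) : x @[n --> \oo] --> x by exact: cvg_cst.
    apply: cvgM.
      apply: continuous_cvg; first exact: continuous_expR.
      apply: cvgB; last by apply: cvgM => //; apply: cvgM => //; exact: cosc.
      by apply: cvgN; apply: cvgM => //; apply: cvgM => //; exact: cosc.
    apply: (sinc _ _); apply: cvgB; last by apply: cvgM => //; apply: cvgM => //; exact: sinc.
    by apply: cvgD => //; apply: cvgM => //; apply: cvgM => //; exact: sinc.
  near=> n; move=> r /=; rewrite in_itv/= andbT => r0.
  rewrite /rotint normrM ger0_norm ?powR_ge0// ler_wpM2l ?powR_ge0//.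
  apply: le_trans (mulsin_le _ (expR_ge0 _)) _; rewrite ler_expR.
  have h1 : c < cos (xi - b * u n) by near: n; have /cvgr_gt := cosc _ _ (cK b xi); exact.
  have h2 : 0 <= rho * cos (u n) * r.
    by rewrite !mulr_ge0 ?(ltW rho0) ?(ltW r0)// ltW// cos_gt0_pihalf.
  have h3 : X * c * r `^ b <= X * cos (xi - b * u n) * r `^ b.
    by rewrite ler_wpM2r ?powR_ge0// ler_wpM2l ?(ltW X0) ?(ltW h1).
  lra.
apply: (@cvg_unique _ (@Rhausdorff R) _ _ _ _ H).
have E n : \int[leb]_(r in D) rotint b q rho (u n) X (xi - b * u n) (phi - q * u n) r =
    \int[leb]_(r in D) rotint b q rho 0 X xi phi r by apply: rotation => //; exact: ltW.
by rewrite /=; under eq_fun do rewrite E; exact: cvg_cst.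
Unshelve. all: by end_near. Qed.

(** With [p = i r], this is the imaginary part of [e^(i theta) p^(q-1) exp (p t - X e^(i psi) p^b)]
    times [dp / dr = i]. The phase [q pi / 2] combines [p^(q-1)] with that factor [i]. *)
Definition eint b q psi theta X t r : R :=
  r `^ (q - 1) * (expR (- (X * cos (psi + b * (pi / 2)) * r `^ b)) *
    sin (r * t + (q * (pi / 2) + theta) - X * sin (psi + b * (pi / 2)) * r `^ b)).

Definition halfker b q psi theta X t : R := \int[leb]_(r in D) eint b q psi theta X t r.

Definition ebound b q psi X r : R :=
  r `^ (q - 1) * expR (- (X * cos (psi + b * (pi / 2)) * r `^ b)).

Lemma measurable_eint b q psi theta X t : measurable_fun setT (eint b q psi theta X t).
Proof. by rewrite /eint; mfun. Qed.

Lemma intble_ebound b q psi X : 0 < q -> 0 < b < 1 -> 0 < X ->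
  0 < cos (psi + b * (pi / 2)) -> intble D (ebound b q psi X).
Proof.
by move=> q0 /andP[b0 b1] X0 c0; apply: intble_powR_expR_powR; rewrite ?mulr_gt0.
Qed.

Lemma eint_le b q psi theta X X' t r : X <= X' -> 0 < cos (psi + b * (pi / 2)) ->
  `|eint b q psi theta X' t r| <= ebound b q psi X r.
Proof.
move=> XX c0; rewrite /eint /ebound normrM ger0_norm ?powR_ge0//.
rewrite ler_wpM2l ?powR_ge0//; apply: le_trans (mulsin_le _ (expR_ge0 _)) _.
by rewrite ler_expR lerN2 ler_wpM2r ?powR_ge0// ler_wpM2r// ltW.
Qed.

Lemma intble_eint b q psi theta X t : 0 < q -> 0 < b < 1 -> 0 < X ->
  0 < cos (psi + b * (pi / 2)) -> intble D (eint b q psi theta X t).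
Proof.
move=> q0 b01 X0 c0; apply: intble_dom (intble_ebound q0 b01 X0 c0) _; first exact: msetD.
  by apply: mfunTS; exact: measurable_eint.
by move=> r _; exact: eint_le.
Qed.

Lemma halfker_bounded b q psi theta X : 0 < q -> 0 < b < 1 -> 0 < X ->
  0 < cos (psi + b * (pi / 2)) ->
  exists C, forall X' t, X <= X' -> `|halfker b q psi theta X' t| <= C.
Proof.
move=> q0 b01 X0 c0; exists (\int[leb]_(r in D) ebound b q psi X r) => X' t XX.
apply: le_normr_Rint; first exact: msetD.
- by apply: mfunTS; exact: measurable_eint.
- exact: intble_ebound.
- by move=> r _; exact: eint_le.
Qed.

Lemma halfker_dt b q psi theta X t : 0 < q -> 0 < b < 1 -> 0 < X ->
  0 < cos (psi + b * (pi / 2)) ->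
  is_derive t 1 (halfker b q psi theta X) (halfker b (q + 1) psi theta X t).
Proof.
move=> q0 b01 X0 c0; have mD := @msetD R.
have q1 : 0 < q + 1 by rewrite addr_gt0.
apply: (@is_derive_Rint R D (eint b q psi theta X) (eint b (q + 1) psi theta X)
  (ebound b (q + 1) psi X) t 1 mD ltr01).
- by move=> x _; exact: intble_eint.
- move=> x r _ /=; rewrite in_itv/= andbT => r0.
  rewrite /eint; derive_eq.
  have -> : r * x + ((q + 1) * (pi / 2) + theta) - X * sin (psi + b * (pi / 2)) * r `^ b =
     r * x + (q * (pi / 2) + theta) - X * sin (psi + b * (pi / 2)) * r `^ b + pi / 2.
    by move: (pi / 2) => w; ring.
  rewrite sinDpihalf (addrAC q) (powRDp (q - 1) _ r0) powRr1 ?(ltW r0)//.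
  by move: (psi + _) (q * _ + _) => w w'; ring.
- exact: intble_ebound.
- by move=> x r _ _; exact: eint_le.
Qed.

Lemma halfker_dX b q psi theta X t : 0 < q -> 0 < b < 1 -> 0 < X ->
  0 < cos (psi + b * (pi / 2)) ->
  is_derive X 1 (fun X => halfker b q psi theta X t)
    (- halfker b (q + b) psi (theta + psi) X t).
Proof.
move=> q0 b01 X0 c0; have mD := @msetD R; have /andP[b0 b1] := b01.
have qb : 0 < q + b by rewrite addr_gt0.
have X2 : 0 < X / 2 by rewrite divr_gt0.
have near_X x : `|x - X| < X / 2 -> X / 2 < x.
  by rewrite ltr_distl => /andP[h _]; lra.
rewrite -mulN1r /halfker -RintegralZl//; last exact: intble_eint.
apply: (@is_derive_Rint R D (fun X => eint b q psi theta X t)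
  (fun X r => -1 * eint b (q + b) psi (theta + psi) X t r)
  (ebound b (q + b) psi (X / 2)) X (X / 2) mD X2).
- by move=> x /near_X xX; apply: intble_eint => //; exact: lt_trans xX.
- move=> x r _ /=; rewrite in_itv/= andbT => r0.
  rewrite /eint; derive_eq.
  have -> : r * t + ((q + b) * (pi / 2) + (theta + psi)) -
       x * sin (psi + b * (pi / 2)) * r `^ b =
     r * t + (q * (pi / 2) + theta) - x * sin (psi + b * (pi / 2)) * r `^ b +
       (psi + b * (pi / 2)).
    by move: (sin _) => s; move: (pi / 2) => w; ring.
  rewrite (sinD (_ - _)) (addrAC q) (powRDp (q - 1) _ r0).
  by move: (psi + _) (q * _ + _) => w w'; ring.
- exact: intble_ebound.
- move=> x r /near_X/ltW xX _; rewrite mulN1r normrN; exact: eint_le.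
Qed.

(** For [t > 0] the imaginary axis corresponds to the angle [pi / 2] of [rotint] and the negative
    axis, where [exp (p t)] decays, to the angle 0. The phases [b pi] and [q pi] come from
    [p = r e^(i pi)]. *)
Lemma halfker_pos b q psi theta X t : 0 < q -> 0 < b < 1 -> 0 < X ->
  0 < cos (psi + b * (pi / 2)) -> 0 < t ->
  halfker b q psi theta X t =
  \int[leb]_(r in D) rotint b q t 0 X (psi + b * pi) (q * pi + theta) r.
Proof.
move=> q0 b01 X0 c0 t0.
have pi2 : 0 < pi / 2 :> R by rewrite divr_gt0// pi_gt0.
have piE : pi = pi / 2 + pi / 2 :> R by move: (pi : R) => w; field.
have e1 : psi + b * pi - b * (pi / 2) = psi + b * (pi / 2) :> R.
  by rewrite [in b * pi]piE; ring.
have e2 : q * pi + theta - q * (pi / 2) = q * (pi / 2) + theta :> R.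
  by rewrite [in q * pi]piE; ring.
rewrite -(@rotation_limit b q t (pi / 2)) ?e1 ?e2//; last by rewrite lexx andbT; lra.
apply: eq_Rintegral => r _; rewrite /eint /rotint cos_pihalf sin_pihalf.
by rewrite mulr0 mul0r oppr0 add0r mulr1 [t * r]mulrC.
Qed.

(** For [t < 0] the decay of [exp (p t)] is on the positive axis, so the ray is turned the other
    way. There [p = r] adds no phase, and changing the signs of [psi] and [theta] only conjugates
    the integrand. *)
Lemma halfker_neg b q psi theta X t : 0 < q -> 0 < b < 1 -> 0 < X ->
  0 < cos (psi + b * (pi / 2)) -> t < 0 ->
  halfker b q psi theta X t = \int[leb]_(r in D) rotint b q (- t) 0 X psi theta r.
Proof.
move=> q0 b01 X0 c0 t0.
have pi2 : 0 < pi / 2 :> R by rewrite divr_gt0// pi_gt0.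
have e1 : psi - b * - (pi / 2) = psi + b * (pi / 2) :> R by ring.
have e2 : theta - q * - (pi / 2) = q * (pi / 2) + theta :> R by ring.
rewrite -(@rotation_limit b q (- t) (- (pi / 2))) ?e1 ?e2 ?oppr_gt0//; last by rewrite lexx; lra.
apply: eq_Rintegral => r _; rewrite /eint /rotint cosN sinN cos_pihalf sin_pihalf.
by rewrite mulr0 mul0r oppr0 add0r mulrN1 opprK [t * r]mulrC.
Qed.


End Kernel.

Local Opaque euler_gamma halfker.

(** * Kernels summed over both signs *)

Section SymmetricKernel.
Context {R : realType}.
Implicit Types (b q psi theta rho chi X xi phi r t : R).

(** The contour integral over the lower half of the imaginary axis for one sign is minus the
    conjugate of that over the upper half for the other sign. Hence this sum of two imaginary parts
    is [pi] times the sum over both signs of the inverse Laplace transforms of [e^(+- i theta)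
    p^(q-1) exp (- X e^(+- i psi) p^b)]. *)
Definition ker b q psi theta X t : R :=
  halfker b q psi theta X t + halfker b q (- psi) (- theta) X t.

(* Decay of the kernel integrand on both rays of the contour. *)
Definition decaying b psi : Prop :=
  [/\ 0 < b < 1, 0 < cos (psi + b * (pi / 2)) & 0 < cos (- psi + b * (pi / 2))].

Lemma ker_bounded b q psi theta X : decaying b psi -> 0 < q -> 0 < X ->
  exists C, forall X' t, X <= X' -> `|ker b q psi theta X' t| <= C.
Proof.
move=> [b01 c1 c2] q0 X0.
have [C1 H1] := halfker_bounded theta q0 b01 X0 c1.
have [C2 H2] := halfker_bounded (- theta) q0 b01 X0 c2.
exists (C1 + C2) => X' t XX.
rewrite /ker; apply: le_trans (ler_normD _ _) _.
by apply: lerD; [exact: H1|exact: H2].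
Qed.

Lemma ker_dt b q psi theta X t : decaying b psi -> 0 < q -> 0 < X ->
  is_derive t 1 (ker b q psi theta X) (ker b (q + 1) psi theta X t).
Proof. by move=> [b01 c1 c2] q0 X0; apply: derD; exact: halfker_dt. Qed.

Lemma ker_dX b q psi theta X t : decaying b psi -> 0 < q -> 0 < X ->
  is_derive X 1 (fun X => ker b q psi theta X t)
    (- ker b (q + b) psi (theta + psi) X t).
Proof.
move=> [b01 c1 c2] q0 X0; rewrite /ker opprD opprD.
by apply: derD; exact: halfker_dX.
Qed.

Lemma continuous_ker b q psi theta X : decaying b psi -> 0 < q -> 0 < X ->
  continuous (ker b q psi theta X).
Proof. by move=> dec q0 X0 t; apply: der_cont (ker_dt theta t dec q0 X0). Qed.

Lemma rotintN b q rho chi X xi phi r :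
  rotint b q rho (- chi) X (- xi) (- phi) r = - rotint b q rho chi X xi phi r.
Proof.
rewrite /rotint !cosN.
rewrite (_ : rho * sin (- chi) * r + - phi - X * sin (- xi) * r `^ b =
  - (rho * sin chi * r + phi - X * sin xi * r `^ b)); last by rewrite !sinN; ring.
by rewrite sinN !mulrN.
Qed.

(** For [t < 0] the two halves, moved to the positive axis, are integrals of conjugate functions, so
    their imaginary parts cancel. The value at [t = 0] follows by continuity in [t]. *)
Lemma ker_le0 b q psi theta X t : decaying b psi -> 0 < q -> 0 < X -> t <= 0 ->
  ker b q psi theta X t = 0.
Proof.
move=> dec q0 X0.
have neg s : s < 0 -> ker b q psi theta X s = 0.
  move=> s0; have [b01 c1 c2] := dec; rewrite /ker !halfker_neg//.
  have -> : \int[leb]_(r in D) rotint b q (- s) 0 X (- psi) (- theta) r =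
     \int[leb]_(r in D) (-1 * rotint b q (- s) 0 X psi theta r).
    by apply: eq_Rintegral => r _; rewrite mulN1r -rotintN oppr0.
  have ii : intble D (rotint b q (- s) 0 X psi theta).
    by apply: intble_rotint; rewrite ?oppr_gt0 ?cos0 ?(ltW X0).
  by rewrite RintegralZl ?mulN1r ?subrr.
rewrite le_eqVlt => /orP[/eqP->|]; last exact: neg.
have h : ker b q psi theta X s @[s --> (0 : R)^'-] --> ker b q psi theta X 0.
  by apply: cvg_at_left_filter; exact: continuous_ker.
apply: (@cvg_unique _ (@Rhausdorff R) _ _ _ _ h).
apply: cvg_near_cst; near=> s; apply: neg; near: s; exact: nbhs_left_lt.
Unshelve. all: by end_near. Qed.

Lemma ker_pos b q psi theta X t : decaying b psi -> 0 < q -> 0 < X -> 0 < t ->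
  ker b q psi theta X t =
  \int[leb]_(r in D) rotint b q t 0 X (psi + b * pi) (q * pi + theta) r +
  \int[leb]_(r in D) rotint b q t 0 X (- psi + b * pi) (q * pi - theta) r.
Proof. by move=> [b01 c1 c2] q0 X0 t0; rewrite /ker !halfker_pos. Qed.

Lemma ker_series b q psi theta X t : decaying b psi -> 0 < q -> 0 < X -> 0 < t ->
  \sum_(0 <= k < n) ((- X) ^+ k / k`!%:R *
     (euler_gamma (q + b * k%:R) * t `^ (- (q + b * k%:R))) *
     (2 * sin (pi * (q + b * k%:R)) * cos (theta + k%:R * psi))) @[n --> \oo] -->
  ker b q psi theta X t.
Proof.
move=> dec q0 X0 t0; have [b01 c1 c2] := dec; rewrite ker_pos//.
have h1 := @rotint_series R b q t X (psi + b * pi) (q * pi + theta) q0 t0 b01 (ltW X0).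
have h2 := @rotint_series R b q t X (- psi + b * pi) (q * pi - theta) q0 t0 b01 (ltW X0).
apply: (cvg_trans _ (cvgD h1 h2)); apply: near_eq_cvg; apply: nearW => n /=.
rewrite addrfctE -big_split/=; apply: eq_bigr => k _.
have -> : q * pi + theta + k%:R * (psi + b * pi) =
   pi * (q + b * k%:R) + (theta + k%:R * psi) by move: (pi : R) => w; ring.
have -> : q * pi - theta + k%:R * (- psi + b * pi) =
   pi * (q + b * k%:R) - (theta + k%:R * psi) by move: (pi : R) => w; ring.
by rewrite sinD sinB; ring.
Qed.

Lemma rotint_cvg0 b q rho xi phi : 0 < q -> 0 < rho -> 0 < b < 1 ->
  \int[leb]_(r in D) rotint b q rho 0 X xi phi r @[X --> 0^'+] -->
  euler_gamma q * rho `^ (- q) * sin phi.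
Proof.
move=> q0 rho0 b01; have mD := @msetD R.
have -> : euler_gamma q * rho `^ (- q) * sin phi =
    \int[leb]_(r in D) rotint b q rho 0 0 xi phi r.
  rewrite -euler_gamma_scale// -RintegralZr//; last exact: intble_powR_expR.
  apply: eq_Rintegral => r _; rewrite /rotint cos0 sin0.
  by rewrite !(mul0r, mulr0, subr0, mulr1, add0r) mulrA.
apply/cvg_at_rightP => u [u0 uc].
apply: (@dct_near R D (fun n => rotint b q rho 0 (u n) xi phi)
  (rotint b q rho 0 0 xi phi) (fun r => r `^ (q - 1) * expR (- (rho * r) + 1 * r `^ b))) => //.
- by move=> n; apply: mfunTS; exact: measurable_rotint.
- exact: intble_powR_expRD.
- move=> r _; rewrite /rotint; apply: cvgM; first exact: cvg_cst.
  have k (x : R) : x @[n --> \oo] --> x by exact: cvg_cst.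
  apply: cvgM.
    apply: continuous_cvg; first exact: continuous_expR.
    by apply: cvgB => //; apply: cvgM => //; exact: cvgM.
  apply: continuous_cvg; first exact: continuous_sin.
  by apply: cvgB => //; apply: cvgM => //; exact: cvgM.
near=> n; move=> r /=; rewrite in_itv/= andbT => r0.
have u1 : u n <= 1 by near: n; move/cvgr_le : uc; apply; exact: ltr01.
rewrite /rotint normrM ger0_norm ?powR_ge0// ler_wpM2l ?powR_ge0//.
apply: le_trans (mulsin_le _ (expR_ge0 _)) _.
apply: le_trans (expR_rot_le b xi (ltW r0) (ltW (u0 n)) (ltW rho0) (lexx _)) _.
by rewrite cos0 mulr1 ler_expR lerD2l ler_wpM2r ?powR_ge0.
Unshelve. all: by end_near. Qed.

(** On the imaginary axis all decay disappears as [X -> 0]. The form on the negative axis keeps the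
    factor [exp (- r t)], which dominates uniformly for [X <= 1]. *)
Lemma ker_cvg0 b q psi theta t : decaying b psi -> 0 < q -> 0 < t ->
  ker b q psi theta X t @[X --> 0^'+] -->
  euler_gamma q * t `^ (- q) * (2 * sin (pi * q) * cos theta).
Proof.
move=> dec q0 t0; have [b01 c1 c2] := dec.
have -> : euler_gamma q * t `^ (- q) * (2 * sin (pi * q) * cos theta) =
   euler_gamma q * t `^ (- q) * sin (q * pi + theta) +
   euler_gamma q * t `^ (- q) * sin (q * pi - theta).
  by rewrite sinD sinB [pi * q]mulrC; ring.
have h1 := @rotint_cvg0 b q t (psi + b * pi) (q * pi + theta) q0 t0 b01.
have h2 := @rotint_cvg0 b q t (- psi + b * pi) (q * pi - theta) q0 t0 b01.
apply: (cvg_trans _ (cvgD h1 h2)); apply: near_eq_cvg; near=> X.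
by rewrite /= ker_pos//; near: X; exact: nbhs_right_gt.
Unshelve. all: by end_near. Qed.

End SymmetricKernel.

Ltac der_cont := notypeclasses refine (@der_cont _ _ _ _ _); der.

(** * Fractional integrals of the kernels *)

Section FractionalIntegral.
Context {R : realType}.
Implicit Types (b q g e psi theta rho chi X xi phi r t u v : R).

Lemma contM (f g : R -> R) (x : R) : {for x, continuous f} -> {for x, continuous g} ->
  {for x, continuous (fun y => f y * g y)}.
Proof. by move=> cf cg; exact: cvgM. Qed.

Lemma contB (f g : R -> R) (x : R) : {for x, continuous f} -> {for x, continuous g} ->
  {for x, continuous (fun y => f y - g y)}.
Proof. by move=> cf cg; exact: cvgB. Qed.

Lemma cont_comp (h f : R -> R) (x : R) : {for f x, continuous h} ->
  {for x, continuous f} -> {for x, continuous (fun y => h (f y))}.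
Proof. by move=> ch cf; exact: (@continuous_comp _ _ _ f h x cf ch). Qed.

Lemma cont_cst (k x : R) : {for x, continuous (fun _ : R => k)}.
Proof. exact: cvg_cst. Qed.

(** Together with [argument], the polar coordinates of [e + i r]. For [r > 0] this point lies in the
    upper half-plane, where the arc cosine determines the argument. *)
Definition modulus e r : R := Num.sqrt (e ^+ 2 + r ^+ 2).

Definition argument e r : R := acos (e / modulus e r).

Lemma modulus_gt0 e r : 0 < r -> 0 < modulus e r.
Proof. by move=> r0; rewrite sqrtr_gt0 ltr_wpDl ?sqr_ge0 ?exprn_gt0. Qed.

Lemma le_modulus e r : 0 < r -> r <= modulus e r.
Proof.
move=> r0; rewrite -[leLHS](gtr0_norm r0) -sqrtr_sqr ler_wsqrtr//.
by rewrite lerDr sqr_ge0.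
Qed.

Lemma ratio_itv e r : 0 <= e -> 0 < r -> 0 <= e / modulus e r < 1.
Proof.
move=> e0 r0; have m0 := modulus_gt0 e r0; rewrite divr_ge0 ?(ltW m0)//=.
rewrite ltr_pdivrMr// mul1r -[ltLHS](ger0_norm e0) -sqrtr_sqr ltr_sqrt.
  by rewrite ltrDl exprn_gt0.
by rewrite ltr_wpDl ?sqr_ge0 ?exprn_gt0.
Qed.

Lemma modulus_cos e r : 0 <= e -> 0 < r -> modulus e r * cos (argument e r) = e.
Proof.
move=> e0 r0; have /andP[h1 h2] := ratio_itv e0 r0.
rewrite /argument acosK ?in_itv/= ?(ltW h2) ?andbT; last by rewrite (le_trans _ h1).
by rewrite mulrC divfK// gt_eqF// modulus_gt0.
Qed.

Lemma modulus_sin e r : 0 <= e -> 0 < r -> modulus e r * sin (argument e r) = r.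
Proof.
move=> e0 r0; have /andP[h1 h2] := ratio_itv e0 r0; have m0 := modulus_gt0 e r0.
have s0 : 0 <= sin (argument e r).
  rewrite sin_ge0_pi// acos_ge0 ?acos_lepi// ?(ltW h2) ?andbT (le_trans _ h1)//.
apply/eqP; rewrite -(@eqrXn2 _ 2)//; [|by rewrite mulr_ge0// ltW|exact: ltW].
rewrite exprMn sin2cos2 mulrBr mulr1 -exprMn modulus_cos//.
by rewrite sqr_sqrtr ?addr_ge0 ?sqr_ge0// addrAC subrr add0r.
Qed.

Lemma argument_itv e r : 0 < e -> 0 < r -> - (pi / 2) < - argument e r < pi / 2.
Proof.
move=> e0 r0; have /andP[h1 h2] := ratio_itv (ltW e0) r0; have m0 := modulus_gt0 e r0.
have h3 : -1 <= e / modulus e r <= 1 by rewrite (ltW h2) andbT (le_trans _ h1).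
have a0 : 0 <= argument e r by exact: acos_ge0.
have a1 : argument e r <= pi by exact: acos_lepi.
have pi0 := @pi_gt0 R.
have a2 : argument e r < pi / 2.
  rewrite -ltr_cos ?in_itv/= ?a0 ?a1//; last by apply/andP; split; lra.
  by rewrite cos_pihalf -(pmulr_rgt0 _ m0) modulus_cos// ltW.
by apply/andP; split; lra.
Qed.

(** The integral of [v^(g-1) exp (- (e + i r) v)] is [(e + i r)^(-g)] times the Gamma value at [g];
    this is its imaginary part after multiplication by [e^(i phi)]. It results from [rotation] by
    the argument of [e + i r], which is less than [pi / 2] because [e > 0]. *)
Lemma frac_sin g e r phi : 0 < g -> 0 < e -> 0 < r ->
  \int[leb]_(v in D) (v `^ (g - 1) * (expR (- (e * v)) * sin (phi - r * v))) =
  euler_gamma g * (modulus e r `^ (- g) * sin (phi - g * argument e r)).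
Proof.
move=> g0 e0 r0; have mD := @msetD R; have m0 := modulus_gt0 e r0.
have b01 : 0 < (2^-1 : R) < 1 by lra.
have := @rotation R 2^-1 g (modulus e r) (- argument e r) 0 0
  (phi - g * argument e r) g0 m0 (argument_itv e0 r0) b01 (lexx 0).
have -> : \int[leb]_(v in D) rotint 2^-1 g (modulus e r) 0 0 0 (phi - g * argument e r) v =
   euler_gamma g * (modulus e r `^ (- g) * sin (phi - g * argument e r)).
  rewrite mulrA -euler_gamma_scale// -RintegralZr//; last exact: intble_powR_expR.
  apply: eq_Rintegral => v _; rewrite /rotint cos0 sin0.
  by rewrite !(mul0r, mulr0, subr0, mulr1, add0r) mulrA.
move=> <-; apply: eq_Rintegral => v _; rewrite /rotint cosN (modulus_cos (ltW e0) r0).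
rewrite !mul0r !subr0 sinN mulrN (modulus_sin (ltW e0) r0).
by congr (_ * (_ * sin _)); ring.
Qed.

Lemma argument_cvg (u : nat -> R) r : 0 < r -> (forall n, 0 <= u n) ->
  u n @[n --> \oo] --> (0 : R) ->
  modulus (u n) r @[n --> \oo] --> r /\ argument (u n) r @[n --> \oo] --> pi / 2.
Proof.
move=> r0 u0 uc.
have mc : modulus (u n) r @[n --> \oo] --> r.
  rewrite -[X in _ --> X](gtr0_norm r0) -sqrtr_sqr -[X in Num.sqrt X]add0r.
  rewrite -[X in Num.sqrt (X + _)](mulr0 (0 : R)).
  apply: continuous_cvg; first exact: sqrt_continuous.
  apply: cvgD; last exact: cvg_cst.
  by under eq_fun do rewrite expr2; exact: cvgM.
split=> //; rewrite -acos0 /argument; apply: continuous_cvg.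
  by apply: continuous_acos; rewrite ltrN10 ltr01.
rewrite -[X in _ --> X](mul0r r^-1); apply: cvgM => //.
by apply: cvgV => //; rewrite gt_eqF.
Qed.

(** The integrand [eint] with the additional complex factor [(e + i r)^(-g)]. For [e -> 0] this
    factor becomes [(i r)^(-g)], which changes [q] into [q - g]. *)
Definition regint b q g psi theta X t e r : R :=
  modulus e r `^ (- g) * (r `^ (q - 1) *
    (expR (- (X * cos (psi + b * (pi / 2)) * r `^ b)) *
     sin (r * t + (q * (pi / 2) + theta) - X * sin (psi + b * (pi / 2)) * r `^ b
          - g * argument e r))).

Lemma regint_le b q g psi theta X t e r : 0 < r -> 0 < g ->
  `|regint b q g psi theta X t e r| <= ebound b (q - g) psi X r.
Proof.
move=> r0 g0; have m0 := modulus_gt0 e r0.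
rewrite /regint normrM ger0_norm ?powR_ge0//.
have h : modulus e r `^ (- g) <= r `^ (- g).
  rewrite !powRN lef_pV2 ?posrE ?powR_gt0// ge0_ler_powR ?nnegrE ?(ltW g0)//.
  - exact: ltW.
  - exact: ltW.
  - exact: le_modulus.
rewrite /ebound (_ : q - g - 1 = - g + (q - 1)); last by ring.
rewrite (powRDp (- g) (q - 1) r0) -[leRHS]mulrA; apply: ler_pM => //; first exact: powR_ge0.
rewrite normrM ger0_norm ?powR_ge0//.
by rewrite ler_wpM2l ?powR_ge0// mulsin_le// expR_ge0.
Qed.

Lemma continuous_modulus e r : {for r, continuous (modulus e)}.
Proof.
apply: continuous_cvg; first exact: sqrt_continuous.
by apply: cvgD; [exact: cvg_cst|exact: exprn_continuous].
Qed.

Lemma continuous_argument e r : 0 <= e -> 0 < r -> {for r, continuous (argument e)}.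
Proof.
move=> e0 r0; have /andP[h1 h2] := ratio_itv e0 r0.
apply: (@continuous_cvg _ _ _ _ _ (fun r => e / modulus e r) (@acos R)).
  by apply: continuous_acos; rewrite h2 andbT (lt_le_trans _ h1).
apply: cvgM; first exact: cvg_cst.
by apply: cvgV; [rewrite gt_eqF// modulus_gt0|exact: continuous_modulus].
Qed.

Lemma measurable_regint b q g psi theta X t e : 0 <= e ->
  mfunR D (regint b q g psi theta X t e).
Proof.
move=> e0; apply: open_continuous_measurable_fun; first exact: interval_open.
move=> r /set_mem/=; rewrite in_itv/= andbT => r0; have m0 := modulus_gt0 e r0.
have h0 : {for r, continuous (fun r => modulus e r `^ (- g))}.
  apply: (@cont_comp (fun x => x `^ (- g)) (modulus e)).
    exact: der_cont (derpow (- g) m0).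
  exact: continuous_modulus.
have h1 : {for r, continuous (fun r : R => r `^ (q - 1))} by der_cont.
have h2 : {for r, continuous (fun r : R => expR (- (X * cos (psi + b * (pi / 2)) * r `^ b)))}.
  by der_cont.
have h3 : {for r, continuous (fun r : R => r * t + (q * (pi / 2) + theta) -
    X * sin (psi + b * (pi / 2)) * r `^ b)} by der_cont.
have h4 := contM (@cont_cst g r) (continuous_argument e0 r0).
exact: contM h0 (contM h1 (contM h2 (cont_comp (@continuous_sin R _) (contB h3 h4)))).
Qed.

(** The factor [exp (- e v)] makes the double integral in [v] and [r] absolutely convergent, so that
    Fubini applies; the integral in [v] is then [frac_sin]. *)
Lemma halfker_frac_reg b q g psi theta X t e : 0 < b < 1 ->
  0 < cos (psi + b * (pi / 2)) -> 0 < g -> g < q -> 0 < X -> 0 < e ->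
  \int[leb]_(v in D) (v `^ (g - 1) * expR (- (e * v)) * halfker b q psi theta X (t - v)) =
  euler_gamma g * \int[leb]_(r in D) regint b q g psi theta X t e r.
Proof.
move=> b01 c0 g0 gq X0 e0; have mreg := measurable_regint b q g psi theta X t (ltW e0).
have mD := @msetD R; have q0 := lt_trans g0 gq.
have qg : 0 < q - g by rewrite subr_gt0.
have ig := intble_powR_expR g0 e0.
have ie := intble_ebound q0 b01 X0 c0.
transitivity (\int[leb]_(v in D) \int[leb]_(r in D)
    (v `^ (g - 1) * expR (- (e * v)) * eint b q psi theta X (t - v) r)).
  by apply: eq_Rintegral => v _; rewrite RintegralZl//; exact: intble_eint.
rewrite (@fubini_dom R D D _
   (fun v r => v `^ (g - 1) * expR (- (e * v)) * ebound b q psi X r)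
   (fun v => (\int[leb]_(r in D) ebound b q psi X r) * (v `^ (g - 1) * expR (- (e * v)))))//.
- rewrite -RintegralZl//; last first.
    apply: intble_dom (intble_ebound qg b01 X0 c0) _ => //.
    by move=> r /=; rewrite in_itv/= andbT => r0; exact: regint_le.
  apply: eq_Rintegral => r /set_mem/=; rewrite in_itv/= andbT => r0.
  pose A := r * t + (q * (pi / 2) + theta) - X * sin (psi + b * (pi / 2)) * r `^ b.
  pose P := r `^ (q - 1) * expR (- (X * cos (psi + b * (pi / 2)) * r `^ b)).
  transitivity (\int[leb]_(v in D) (P * (v `^ (g - 1) * (expR (- (e * v)) * sin (A - r * v))))).
    apply: eq_Rintegral => v _; rewrite /eint /P.
    rewrite (_ : r * (t - v) + (q * (pi / 2) + theta) - X * sin (psi + b * (pi / 2)) * r `^ b =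
      A - r * v); first by ring.
    by rewrite /A; move: (pi / 2) (sin _) => w s; ring.
  rewrite RintegralZl//; last first.
    apply: intble_dom ig _ => //; first by apply: mfunTS; mfun.
    by move=> v _; rewrite mulrA mulsin_le// mulr_ge0 ?powR_ge0 ?expR_ge0.
  rewrite frac_sin// /regint /P -/A; ring.
- rewrite /eint; mfun.
- move=> v r _ _; rewrite normrM ger0_norm ?mulr_ge0 ?powR_ge0 ?expR_ge0//.
  by rewrite ler_wpM2l ?mulr_ge0 ?powR_ge0 ?expR_ge0//; exact: eint_le.
- by move=> v _; exact: intbleZ.
- by move=> v _; rewrite RintegralZl// mulrC.
- exact: intbleZ.
move=> r _; apply: intble_dom (intbleZ (ebound b q psi X r) mD ig) _ => //.
  by apply: mfunTS; rewrite /eint; mfun.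
move=> v _; rewrite normrM ger0_norm ?mulr_ge0 ?powR_ge0 ?expR_ge0// mulrC.
by rewrite ler_wpM2r ?mulr_ge0 ?powR_ge0 ?expR_ge0//; exact: eint_le.
Qed.


Lemma intble_frac_halfker b q g psi theta X t e : 0 < b < 1 ->
  0 < cos (psi + b * (pi / 2)) -> 0 < g -> 0 < q -> 0 < X -> 0 < e ->
  intble D (fun v => v `^ (g - 1) * expR (- (e * v)) * halfker b q psi theta X (t - v)).
Proof.
move=> b01 c0 g0 q0 X0 e0; have mD := @msetD R.
have [C CP] := halfker_bounded theta q0 b01 X0 c0.
apply: intble_dom (intbleZ C mD (intble_powR_expR g0 e0)) _ => //.
  apply: mfunTS; apply: measurable_funM; first by mfun.
  apply: continuous_measurable_fun => v.
  apply: (@continuous_cvg _ _ _ _ _ (fun v : R => t - v)).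
    exact: der_cont (halfker_dt theta (t - v) q0 b01 X0 c0).
  by apply: cvgB; [exact: cvg_cst|exact: cvg_id].
move=> v _; rewrite normrM ger0_norm ?mulr_ge0 ?powR_ge0 ?expR_ge0// mulrC.
by rewrite ler_wpM2r ?mulr_ge0 ?powR_ge0 ?expR_ge0// CP.
Qed.

Lemma regint_cvg b q g psi theta X t (u : nat -> R) : 0 < b < 1 ->
  0 < cos (psi + b * (pi / 2)) -> 0 < g -> g < q -> 0 < X ->
  (forall n, 0 <= u n) -> u n @[n --> \oo] --> (0 : R) ->
  \int[leb]_(r in D) regint b q g psi theta X t (u n) r @[n --> \oo] -->
  halfker b (q - g) psi theta X t.
Proof.
move=> b01 c0 g0 gq X0 u0 uc; have mD := @msetD R.
have qg : 0 < q - g by rewrite subr_gt0.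
apply: (@dct_near R D (fun n => regint b q g psi theta X t (u n))
  (eint b (q - g) psi theta X t) (ebound b (q - g) psi X)) => //.
- by move=> n; exact: measurable_regint.
- exact: intble_ebound.
- move=> r /=; rewrite in_itv/= andbT => r0.
  have [mc ac] := argument_cvg r0 u0 uc.
  have -> : eint b (q - g) psi theta X t r = r `^ (- g) * (r `^ (q - 1) *
    (expR (- (X * cos (psi + b * (pi / 2)) * r `^ b)) *
     sin (r * t + (q * (pi / 2) + theta) - X * sin (psi + b * (pi / 2)) * r `^ b
          - g * (pi / 2)))).
    rewrite /eint (_ : q - g - 1 = - g + (q - 1)); last by ring.
    rewrite (powRDp (- g) (q - 1) r0) -mulrA; congr (_ * (_ * (_ * sin _))).
    by move: (sin _) => s; move: (pi / 2) => w; ring.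
  apply: cvgM.
    apply: (@continuous_cvg _ _ _ _ _ (fun n => modulus (u n) r) (fun x => x `^ (- g))) => //.
    exact: der_cont (derpow (- g) r0).
  do 2 (apply: cvgM; first exact: cvg_cst).
  apply: continuous_cvg; first exact: continuous_sin.
  by apply: cvgB; [exact: cvg_cst|apply: cvgM => //; exact: cvg_cst].
by apply: nearW => n r /=; rewrite in_itv/= andbT => r0; exact: regint_le.
Qed.

(** Both sides are limits of the regularised identity for [e -> 0]. On the left this rests on the
    sum of the two halves being 0 for [v >= t], which leaves a bounded range of [v]; on the right
    [modulus e r >= r] gives a majorant that does not depend on [e]. *)
Lemma ker_frac b q g psi theta X t : decaying b psi -> 0 < g -> g < q -> 0 < X ->
  \int[leb]_(v in D) (v `^ (g - 1) * ker b q psi theta X (t - v)) =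
  euler_gamma g * ker b (q - g) psi theta X t.
Proof.
move=> dec g0 gq X0; have mD := @msetD R; have q0 := lt_trans g0 gq.
have [b01 c1 c2] := dec.
have [C CP] := ker_bounded theta dec q0 X0.
have C0 : 0 <= C by rewrite (le_trans _ (CP X 0 (lexx X))).
pose u n : R := n.+1%:R^-1.
have u0 n : 0 < u n by rewrite invr_gt0.
have uc : u n @[n --> \oo] --> (0 : R) by exact: cvg_harmonic.
have mk : measurable_fun setT (fun v => ker b q psi theta X (t - v)).
  apply: continuous_measurable_fun => v.
  apply: (@continuous_cvg _ _ _ _ _ (fun v : R => t - v)); first exact: continuous_ker.
  by apply: cvgB; [exact: cvg_cst|exact: cvg_id].
have H : \int[leb]_(v in D) (v `^ (g - 1) * expR (- (u n * v)) * ker b q psi theta X (t - v))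
   @[n --> \oo] --> \int[leb]_(v in D) (v `^ (g - 1) * ker b q psi theta X (t - v)).
  (* For [v < t] the factor [exp (t - v)] is at least 1; it is inserted to make the majorant
     integrable over the whole half-line. *)
  apply: (@dct_near R D (fun n v => v `^ (g - 1) * expR (- (u n * v)) * ker b q psi theta X (t - v))
    (fun v => v `^ (g - 1) * ker b q psi theta X (t - v))
    (fun v => C * expR t * (v `^ (g - 1) * expR (- (1 * v))))) => //.
  - by move=> n; apply: mfunTS; apply: measurable_funM => //; mfun.
  - by apply: intbleZ => //; exact: intble_powR_expR.
  - move=> v _; apply: cvgM; last exact: cvg_cst.
    rewrite -[X in _ --> X]mulr1; apply: cvgM; first exact: cvg_cst.
    rewrite -expR0 -oppr0 -(mul0r v); apply: continuous_cvg; first exact: continuous_expR.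
    by apply: cvgN; apply: cvgM => //; exact: cvg_cst.
  apply: nearW => n v /=; rewrite in_itv/= andbT => v0.
  have [tv|vt] := leP t v.
    rewrite ker_le0 ?subr_le0// mulr0 normr0.
    by rewrite !mulr_ge0 ?expR_ge0 ?powR_ge0.
  rewrite normrM ger0_norm ?mulr_ge0 ?powR_ge0 ?expR_ge0//.
  rewrite mul1r (_ : C * expR t * (v `^ (g - 1) * expR (- v)) =
    v `^ (g - 1) * (C * (expR t * expR (- v)))); last by ring.
  rewrite -mulrA ler_wpM2l ?powR_ge0// mulrC ler_pM ?expR_ge0 ?CP//.
  rewrite -expRD ler_expR (@le_trans _ _ 0)//; last by rewrite subr_ge0 ltW.
  by rewrite oppr_le0 mulr_ge0// ltW.
apply: (@cvg_unique _ (@Rhausdorff R) _ _ _ _ H).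
have E n : \int[leb]_(v in D) (v `^ (g - 1) * expR (- (u n * v)) * ker b q psi theta X (t - v)) =
   euler_gamma g * (\int[leb]_(r in D) regint b q g psi theta X t (u n) r +
     \int[leb]_(r in D) regint b q g (- psi) (- theta) X t (u n) r).
  rewrite mulrDr -!halfker_frac_reg// -RintegralD//.
  - by apply: eq_Rintegral => v _; rewrite /ker mulrDr.
  - exact: intble_frac_halfker.
  - exact: intble_frac_halfker.
rewrite /=; under eq_fun do rewrite E.
apply: cvgM; first exact: cvg_cst.
by apply: cvgD; apply: regint_cvg => // n; exact: ltW.
Qed.

End FractionalIntegral.

(** * Potentials *)

Local Opaque euler_gamma halfker ker.

Section Potential.
Context {R : realType}.
Implicit Types (b q g psi theta eta X r s t u v T M : R).

Lemma intble_cst (a c k : R) : intble `]a, c[ (fun _ : R => k).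
Proof.
have : intble `[a, c] (fun _ : R => k) by apply: intble_cc => x _; exact: cvg_cst.
by apply: integrableS; [exact: mset_itv|exact: mset_itv|exact: subset_itv_oo_cc].
Qed.

Lemma intble_powR_oo g t : 0 < g -> intble `]0, t[ (fun v : R => v `^ (g - 1)).
Proof.
move=> g0; have mt : msetR (`]0, t[%classic : set R) by exact: mset_itv.
apply: (@intble_dom R _ _ (fun v => expR t * (v `^ (g - 1) * expR (- (1 * v))))) => //.
- by apply: mfunTS; mfun.
- apply: intbleZ => //; apply: integrableS (intble_powR_expR g0 ltr01) => //.
  by move=> v /=; rewrite !in_itv/= => /andP[->].
move=> v /=; rewrite in_itv/= => /andP[v0 vt].
rewrite ger0_norm ?powR_ge0// mulrCA -[leLHS]mulr1 ler_wpM2l ?powR_ge0//.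
by rewrite mul1r -expRD -expR0 ler_expR subr_ge0 ltW.
Qed.

(** Integrating up to [T] instead of [s] avoids a moving endpoint, so that derivatives in [s] have
    no boundary term. For [0 < s <= T] the part with [eta >= s] contributes 0. *)
Definition potential b q psi theta (tau : R -> R) T X s : R :=
  \int[leb]_(eta in `]0, T[) (ker b q psi theta X (s - eta) * tau eta).

Context (b psi M T : R) (tau : R -> R) (dec : decaying b psi).
Context (ctau : continuous tau) (tauM : forall x, `|tau x| <= M).

Lemma tau_bound_ge0 : 0 <= M. Proof. exact: le_trans (tauM 0). Qed.

Lemma measurable_ker_shift q theta X s : 0 < q -> 0 < X ->
  measurable_fun setT (fun eta => ker b q psi theta X (s - eta) * tau eta).
Proof.
move=> q0 X0; apply: continuous_measurable_fun => v.
apply: (@contM R (fun eta => ker b q psi theta X (s - eta)) tau); last exact: ctau.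
apply: (@cont_comp R (ker b q psi theta X) (fun v : R => s - v)).
  exact: continuous_ker.
by apply: contB; [exact: cont_cst|exact: cvg_id].
Qed.

Lemma ker_shift_le q theta X : 0 < q -> 0 < X ->
  exists2 C : R, 0 <= C & forall X' s eta, X <= X' -> `|ker b q psi theta X' (s - eta) * tau eta| <= C.
Proof.
move=> q0 X0; have [C CP] := ker_bounded theta dec q0 X0.
have C0 : 0 <= C by rewrite (le_trans _ (CP X 0 (lexx X))).
exists (C * M) => [|X' s eta XX]; first by rewrite mulr_ge0// tau_bound_ge0.
by rewrite normrM; apply: ler_pM => //; exact: CP.
Qed.

Lemma intble_ker_shift q theta X s a c : 0 < q -> 0 < X ->
  intble `]a, c[ (fun eta => ker b q psi theta X (s - eta) * tau eta).
Proof.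
move=> q0 X0; have [C C0 CP] := ker_shift_le theta q0 X0.
apply: intble_dom (intble_cst a c C) _; first exact: mset_itv.
  by apply: mfunTS; exact: measurable_ker_shift.
by move=> x _; exact: CP.
Qed.

Lemma potential_ds q theta X s : 0 < q -> 0 < X ->
  is_derive s 1 (potential b q psi theta tau T X) (potential b (q + 1) psi theta tau T X s).
Proof.
move=> q0 X0; have q1 : 0 < q + 1 by rewrite addr_gt0.
have [C C0 CP] := ker_shift_le theta q1 X0.
apply: (@is_derive_Rint R `]0, T[%classic (fun s eta => ker b q psi theta X (s - eta) * tau eta)
  (fun s eta => ker b (q + 1) psi theta X (s - eta) * tau eta) (fun=> C) s 1
  (mset_itv _) ltr01).
- by move=> x _; exact: intble_ker_shift.
- move=> x eta _ _.
  have h := ker_dt theta (x - eta) dec q0 X0.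
  have h1 : is_derive x 1 (fun y : R => y - eta) 1.
    by apply: (der_eq (derD (derI x) (derC x (- eta)))); rewrite addr0.
  have h2 := @is_derive1_comp R (ker b q psi theta X) (fun y : R => y - eta) x _ _ h h1.
  apply: (der_eq (derM h2 (derC x (tau eta)))).
  by rewrite mulr0 add0r mulr1 mulrC.
- exact: intble_cst.
- by move=> x eta _ _; exact: CP.
Qed.

Lemma potential_dX q theta X s : 0 < q -> 0 < X ->
  is_derive X 1 (fun X => potential b q psi theta tau T X s)
    (- potential b (q + b) psi (theta + psi) tau T X s).
Proof.
move=> q0 X0; have [/andP[b0 _] _ _] := dec.
have qb : 0 < q + b by rewrite addr_gt0.
have X2 : 0 < X / 2 by rewrite divr_gt0.
have near_X (x : R) : `|x - X| < X / 2 -> X / 2 < x.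
  by rewrite ltr_distl => /andP[h _]; lra.
have [C C0 CP] := ker_shift_le (theta + psi) qb X2.
rewrite -mulN1r /potential -RintegralZl; [|exact: mset_itv|exact: intble_ker_shift].
apply: (@is_derive_Rint R `]0, T[%classic (fun X eta => ker b q psi theta X (s - eta) * tau eta)
  (fun X eta => -1 * (ker b (q + b) psi (theta + psi) X (s - eta) * tau eta))
  (fun=> C) X (X / 2) (mset_itv _) X2).
- by move=> x /near_X xX; apply: intble_ker_shift => //; exact: lt_trans xX.
- move=> x eta /near_X xX _; have x0 := lt_trans X2 xX.
  have h := ker_dX theta (s - eta) dec q0 x0.
  apply: (der_eq (derM h (derC x (tau eta)))).
  by rewrite mulr0 add0r mulrN mulN1r mulrC.
- exact: intble_cst.
- by move=> x eta /near_X/ltW xX _; rewrite mulN1r normrN; exact: CP.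
Qed.

Lemma potential_trunc q theta X s t : 0 < q -> 0 < X -> 0 < s -> s <= t ->
  \int[leb]_(eta in `]0, s[) (ker b q psi theta X (s - eta) * tau eta) =
  potential b q psi theta tau t X s.
Proof.
move=> q0 X0 s0 st; rewrite /potential [LHS]Rintegral_mkcond [RHS]Rintegral_mkcond.
apply: eq_Rintegral => eta _; rewrite !patchE.
have [es|es] := boolP (eta \in `]0, s[%classic).
  rewrite ifT//; move/set_mem : es; rewrite /= in_itv/= => /andP[e0 es].
  by apply/mem_set; rewrite /= in_itv/= e0 (lt_le_trans es st).
case: ifPn => // /set_mem; rewrite /= in_itv/= => /andP[e0 _].
rewrite ker_le0 ?mul0r// subr_le0 leNgt; apply: contra es => es.
by apply/mem_set; rewrite /= in_itv/= e0 es.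
Qed.

Lemma potential_frac q g theta X t : 0 < g -> g < q -> 0 < X -> 0 < t -> t <= T ->
  \int[leb]_(v in `]0, t[) (v `^ (g - 1) * potential b q psi theta tau T X (t - v)) =
  euler_gamma g * potential b (q - g) psi theta tau T X t.
Proof.
move=> g0 gq X0 t0 tT; have q0 := lt_trans g0 gq.
have qg : 0 < q - g by rewrite subr_gt0.
have mt : msetR (`]0, t[%classic : set R) by exact: mset_itv.
have mT : msetR (`]0, T[%classic : set R) by exact: mset_itv.
have mD := @msetD R.
have [C C0 CP] := ker_shift_le theta q0 X0.
have ig := intble_powR_oo t g0.
transitivity (\int[leb]_(v in `]0, t[) \int[leb]_(eta in `]0, T[)
    (v `^ (g - 1) * (ker b q psi theta X (t - v - eta) * tau eta))).
  apply: eq_Rintegral => v _; rewrite RintegralZl//; exact: intble_ker_shift.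
have mk : measurable_fun setT (fun z : R * R =>
    z.1 `^ (g - 1) * (ker b q psi theta X (t - z.1 - z.2) * tau z.2)).
  apply: measurable_funM.
    exact: (measurableT_comp (@measurable_powR _ (g - 1)) measurable_fst).
  apply: measurable_funM.
    have mh : measurable_fun setT (fun z : R * R => t - z.1 - z.2).
      by apply: measurable_funB => //; apply: measurable_funB.
    have mker := continuous_measurable_fun (continuous_ker (theta := theta) dec q0 X0).
    exact: (measurableT_comp mker mh).
  have mtau := continuous_measurable_fun ctau.
  exact: (measurableT_comp mtau measurable_snd).
rewrite (@fubini_dom R _ _ _ (fun v eta => v `^ (g - 1) * C)
  (fun v => v `^ (g - 1) * (\int[leb]_(eta in `]0, T[) C)))//.
- rewrite /potential -RintegralZl//; last exact: intble_ker_shift.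
  apply: eq_Rintegral => eta /set_mem/=; rewrite in_itv/= => /andP[e0 eT].
  transitivity (\int[leb]_(v in `]0, t[) (tau eta * (v `^ (g - 1) * ker b q psi theta X (t - eta - v)))).
    by apply: eq_Rintegral => v _; rewrite (addrAC t) mulrA mulrC.
  (* For [v >= t] the time [t - eta - v] is negative and the kernel vanishes, so the range extends
     to the half-line, as in [ker_frac]. *)
  have mE : \int[leb]_(v in `]0, t[) (v `^ (g - 1) * ker b q psi theta X (t - eta - v)) =
      \int[leb]_(v in D) (v `^ (g - 1) * ker b q psi theta X (t - eta - v)).
    rewrite [LHS]Rintegral_mkcond [RHS]Rintegral_mkcond.
    apply: eq_Rintegral => v _; rewrite !patchE.
    have [vt|vt] := boolP (v \in `]0, t[%classic).
      rewrite ifT//; move/set_mem : vt; rewrite /= in_itv/= => /andP[v0 _].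
      by apply/mem_set; rewrite /= in_itv/= v0.
    case: ifPn => // /set_mem; rewrite /= in_itv/= andbT => v0.
    have tv : t <= v.
      rewrite leNgt; apply: contra vt => vt.
      by apply/mem_set; rewrite /= in_itv/= v0.
    by rewrite ker_le0 ?mulr0//; lra.
  rewrite RintegralZl//; last first.
    have [K KP] := ker_bounded theta dec q0 X0.
    apply: (intble_dom mt _ (intbleZ K mt ig)).
      apply: mfunTS; apply: measurable_funM; first exact: measurable_powR.
      have mker := continuous_measurable_fun (continuous_ker (theta := theta) dec q0 X0).
      have mh : measurable_fun setT (fun v : R => t - eta - v) by exact: measurable_funB.
      exact: (measurableT_comp mker mh).
    move=> v _; rewrite normrM ger0_norm ?powR_ge0// mulrC ler_wpM2r ?powR_ge0//.
    exact: KP.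
  by rewrite mE ker_frac//; ring.
- move=> v eta _ _; rewrite normrM ger0_norm ?powR_ge0// ler_wpM2l ?powR_ge0//.
  exact: CP.
- by move=> v _; exact: intble_cst.
- by move=> v _; rewrite RintegralZl//; exact: intble_cst.
- by apply: (@intble_eq R _ (fun v => (\int[leb]_(eta in `]0, T[) C) * v `^ (g - 1))) => //;
    [move=> v _; rewrite mulrC|exact: intbleZ].
move=> eta _; apply: (intble_dom mt _ (intbleZ C mt ig)).
  apply: mfunTS; apply: measurable_funM; first exact: measurable_powR.
  apply: measurable_funM; last exact: measurable_cst.
  have mker := continuous_measurable_fun (continuous_ker (theta := theta) dec q0 X0).
  have mh : measurable_fun setT (fun v : R => t - v - eta).
    by apply: measurable_funB => //; apply: measurable_funB.
  exact: (measurableT_comp mker mh).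
move=> v _; rewrite normrM ger0_norm ?powR_ge0// mulrC ler_wpM2r ?powR_ge0//.
exact: CP.
Qed.

End Potential.

(** * The substitution [s -> t - s] for weakly singular integrands *)

Section Reflect.
Context {R : realType}.
Implicit Types (b q g psi theta X r s t u v T M : R).

Lemma le_Rintegral_subset (A E : set R) (f : R -> R) : msetR A -> msetR E ->
  E `<=` A -> intble A f -> (forall x, A x -> 0 <= f x) ->
  \int[leb]_(x in E) f x <= \int[leb]_(x in A) f x.
Proof.
move=> mA mE EA fi f0; apply: fine_le.
- by apply: integrable_fin_num => //; exact: integrableS fi.
- exact: integrable_fin_num.
by apply: ge0_subset_integral => //; exact: measurable_int fi.
Qed.

Lemma Rint_reflect_cc (F : R -> R) t (u : R) : 0 < u -> u <= t - u ->
  (forall v, 0 < v -> v < t -> {for v, continuous F}) ->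
  \int[leb]_(s in `[u, t - u]) F (t - s) = \int[leb]_(s in `[u, t - u]) F s.
Proof.
move=> u0 ut cF; pose P (s : R) := t - s.
have dP (s : R) : is_derive s 1 P (-1).
  by apply: (der_eq (derD (derC s t) (derN (derI s)))); rewrite add0r.
have dPE : derive1 P = cst (-1) by apply/funext => s; rewrite derive1E; have [_ ->] := dP s.
have cP (s : R) : {for s, continuous P} by exact: der_cont (dP s).
have := @integration_by_substitution_decreasing R P F u (t - u) ut.
rewrite dPE /P subKr => H; rewrite /Rintegral H.
- by congr fine; apply: eq_integral => s _; rewrite /= fctE opprK mulr1.
- by move=> x y _ _ xy; rewrite ltrD2l ltrN2.
- by move=> x _; exact: cvg_cst.
- by apply/cvg_ex; exists (-1); exact: cvg_cst.
- by apply/cvg_ex; exists (-1); exact: cvg_cst.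
- split.
  + by move=> x _; have [] := dP x.
  + by apply: cvg_at_right_filter; exact: cP.
  + by apply: cvg_at_left_filter; exact: cP.
apply: continuous_in_subspaceT => v /set_mem/=; rewrite in_itv/= => /andP[uv vt].
by apply: cF; lra.
Qed.

(** Since [F] may blow up at 0 like [v^(g-1)], the substitution is carried out on the symmetric
    intervals [[u n, t - u n]]. The reflected majorant is integrable by monotone convergence, as its
    integrals over these intervals equal those of [v^(g-1)]. *)
Lemma Rint_reflect (F : R -> R) (K g t : R) : 0 < t -> 0 < g ->
  (forall v, 0 < v -> v < t -> {for v, continuous F}) -> measurable_fun setT F ->
  (forall v, 0 < v -> v < t -> `|F v| <= K * v `^ (g - 1)) ->
  intble `]0, t[ (fun s => F (t - s)) /\
  \int[leb]_(s in `]0, t[) F (t - s) = \int[leb]_(s in `]0, t[) F s.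
Proof.
move=> t0 g0 cF mF FK; have mt : msetR (`]0, t[%classic : set R) by exact: mset_itv.
(* Denominators from 2 on ensure [u n <= t - u n]. *)
pose u n : R := t / n.+2%:R.
have u0 n : 0 < u n by rewrite divr_gt0.
have ut n : u n <= t - u n.
  rewrite lerBrDr -mulr2n -mulr_natl /u mulrCA ger_pMr// ler_pdivrMr ?ltr0n//.
  by rewrite mul1r ler_nat.
pose E n := `[u n, t - u n]%classic.
have mE n : msetR (E n) by exact: mset_itv.
have mE' n : measurable (E n) by exact: measurable_itv.
have EA n : E n `<=` `]0, t[.
  by move=> x; rewrite /E/= !in_itv/= => /andP[h1 h2]; have := u0 n; lra.
have uc : u n @[n --> \oo] --> (0 : R).
  rewrite -[X in _ --> X](mulr0 t); apply: cvgM; first exact: cvg_cst.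
  have := @cvg_harmonic R; rewrite -(cvg_shiftn 1).
  by apply: cvg_trans; apply: near_eq_cvg; apply: nearW => n; rewrite /= addn1.
have AE x : `]0, t[%classic x -> \forall n \near \oo, E n x.
  rewrite /= in_itv/= => /andP[x0 xt]; near=> n; rewrite /E/= in_itv/=.
  have h1 : u n < x by near: n; move/cvgr_lt : uc; exact.
  have h2 : u n < t - x by near: n; move/cvgr_lt : uc; apply; rewrite subr_gt0.
  by apply/andP; split; lra.
have mR (f : R -> R) : measurable_fun setT f -> measurable_fun setT (fun s => f (t - s)).
  by move=> mf; apply: (measurableT_comp mf); exact: measurable_funB.
have ig := intble_powR_oo t g0.
have cg v : 0 < v -> v < t -> {for v, continuous (fun v : R => v `^ (g - 1))}.
  by move=> v0 _; exact: der_cont (derpow (g - 1) v0).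
have mg : measurable_fun setT (fun v : R => v `^ (g - 1)) by mfun.
have igr : intble `]0, t[ (fun s : R => (t - s) `^ (g - 1)).
  apply: (@intble_ge0_exhaust R _ E _ (\int[leb]_(v in `]0, t[) v `^ (g - 1))) => //.
  - move=> m n mn; apply/subsetPset; apply: subset_itv; rewrite bnd_simp.
      by rewrite ler_pM2l// lef_pV2 ?posrE ?ltr0n// ler_nat !ltnS.
    by rewrite lerD2l lerN2 ler_pM2l// lef_pV2 ?posrE ?ltr0n// ler_nat !ltnS.
  - apply/seteqP; split => [x [n _]|x xt]; first exact: EA.
    by have [n _ /(_ n (leqnn n)) xn] := AE x xt; exists n.
  - exact: (mR _ mg).
  - by move=> x _; exact: powR_ge0.
  - move=> n; apply: intble_cc => x xE.
    have xt : 0 < t - x by move: xE; rewrite in_itv/= => /andP[_]; have := u0 n; lra.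
    apply: (@cont_comp R (fun v => v `^ (g - 1)) (fun s => t - s)).
      exact: der_cont (derpow (g - 1) xt).
    by apply: contB; [exact: cont_cst|exact: cvg_id].
  move=> n; rewrite /E (@Rint_reflect_cc (fun v => v `^ (g - 1)))//.
  by apply: (le_Rintegral_subset mt (mE n) (EA n) ig) => x _; exact: powR_ge0.
have iF : intble `]0, t[ F.
  apply: intble_dom (intbleZ K mt ig) _ => //; first exact: mfunTS.
  by move=> v /=; rewrite in_itv/= => /andP[]; exact: FK.
have iFr : intble `]0, t[ (fun s => F (t - s)).
  apply: intble_dom (intbleZ K mt igr) _ => //; first by apply: mfunTS; exact: mR.
  move=> v /=; rewrite in_itv/= => /andP[v0 vt]; apply: FK; lra.
split=> //.
have H1 := Rint_exhaust_set mt mE' EA AE iFr (mR F mF).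
have H2 := Rint_exhaust_set mt mE' EA AE iF mF.
apply: (@cvg_unique _ (@Rhausdorff R) _ _ _ _ H1).
have -> : (fun n => \int[leb]_(x in E n) F (t - x)) = (fun n => \int[leb]_(x in E n) F x).
  by apply/funext => n; exact: Rint_reflect_cc.
exact: H2.
Unshelve. all: by end_near. Qed.

End Reflect.

(** * The Wright function *)

Section WrightLimit.
Local Open Scope complex_scope.
Context {R : realType}.
Implicit Types (rho mu a c : R) (z w : R[i]).

Lemma cvg_complexC (u : nat -> R) a : u n @[n --> \oo] --> a ->
  ((u n)%:C : R[i]^o) @[n --> \oo] --> (a%:C : R[i]^o).
Proof.
move=> ua; apply/cvgrPdist_lt => /= e e0.
(* In the order of [R[i]] a positive number is real, so the radius [e] may be treated as a real
   one. *)
have [h1 h2] : complex.Im e = 0 /\ 0 < complex.Re e.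
  by move: e0; rewrite ltcE/= => /andP[/eqP].
have eE : e = (complex.Re e)%:C by case: e h1 {e0 h2} => x y /= ->.
move/cvgrPdist_lt : ua => /(_ _ h2); apply: filterS => n.
rewrite -rmorphB/= normc_def/= expr0n addr0 sqrtr_sqr eE.
by rewrite ltcE/= eqxx.
Qed.

Lemma cvgM_complexl (k : R[i]) (u : nat -> R[i]^o) (l : R[i]^o) : u n @[n --> \oo] --> l ->
  (k * u n : R[i]^o) @[n --> \oo] --> (k * l : R[i]^o).
Proof.
move=> ul.
have h : (k *: u n : R[i]^o) @[n --> \oo] --> (k *: l : R[i]^o).
  by apply: cvgZl_tmp.
exact: h.
Qed.

Lemma cvg_complex (u v : nat -> R) a c : u n @[n --> \oo] --> a ->
  v n @[n --> \oo] --> c ->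
  ((u n +i* v n) : R[i]^o) @[n --> \oo] --> ((a +i* c) : R[i]^o).
Proof.
move=> ua vc.
have E (x y : R) : (x +i* y : R[i]^o) = x%:C + 'i%C * y%:C.
  by rewrite [LHS]complexE.
rewrite E; under eq_fun do rewrite E.
apply: cvgD; first exact: cvg_complexC.
apply: cvgM_complexl; exact: cvg_complexC.
Qed.

(** The partial sums are controlled only through the real and imaginary parts of their products with
    [w], which will be 1 or [omega3]. Dividing by [w] yields convergence of the series itself, on
    which the value of [wright] as a [limn] depends. *)
Lemma wright_limit rho mu z w a c : w != 0 ->
  complex.Re (w * \sum_(0 <= k < n) (z ^+ k / k`!%:R * ((Gamma (rho * k%:R + mu))^-1)%:C))
    @[n --> \oo] --> a ->
  complex.Im (w * \sum_(0 <= k < n) (z ^+ k / k`!%:R * ((Gamma (rho * k%:R + mu))^-1)%:C))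
    @[n --> \oo] --> c ->
  w * wright rho mu z = a +i* c.
Proof.
move=> w0 ha hc.
pose S n : R[i]^o := \sum_(0 <= k < n) (z ^+ k / k`!%:R * ((Gamma (rho * k%:R + mu))^-1)%:C).
have H : (w * S n : R[i]^o) @[n --> \oo] --> (a +i* c : R[i]^o).
  have := cvg_complex ha hc; apply: cvg_trans; apply: near_eq_cvg; apply: nearW => n.
  by rewrite -/(S n); case: (w * S n).
have HS : S n @[n --> \oo] --> (w^-1 * (a +i* c) : R[i]^o).
  have -> : S = (fun n => w^-1 * (w * S n) : R[i]^o).
    by apply/funext => n; rewrite mulKf.
  exact: cvgM_complexl H.
have -> : wright rho mu z = w^-1 * (a +i* c).
  rewrite /wright; apply: (@cvg_lim (R[i]^o : normedModType R[i])) => //.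
have K (x : R[i]) : w * (w^-1 * x) = x.
  by rewrite mulrA (divff w0) mul1r.
exact: K.
Qed.

Definition cis (x : R) : R[i] := cos x +i* sin x.

Lemma cisD (x y : R) : cis x * cis y = cis (x + y).
Proof.
rewrite /cis sinD cosD; apply/eqP; rewrite eq_complex /=.
by apply/andP; split; apply/eqP; ring.
Qed.

Lemma realM_cis (x y : R) : x%:C * cis y = (x * cos y) +i* (x * sin y).
Proof.
apply/eqP; rewrite eq_complex /=.
by apply/andP; split; apply/eqP; ring.
Qed.

(** With [P = 1 - 2 b + b k], the argument of Gamma in the [k]-th coefficient is [1 - P], so
    [Gamma_inv] turns it into the coefficient found in [ker_series]; comparing [sin / pi] there with
    [2 sin] here leaves the factor [1 / (2 pi)]. Since [sin x = cos (x - pi / 2)], the imaginary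
    part is the same kernel with [theta] lowered by [pi / 2]. *)
Lemma wright_ker b psi theta X t z w : 0 < b < 1 / 3 -> decaying b psi ->
  0 < X -> 0 < t -> w != 0 ->
  (forall k, w * z ^+ k = ((- (X / t `^ b)) ^+ k)%:C * cis (theta + k%:R * psi)) ->
  w * wright (- b) (2 * b) z =
  (t `^ (1 - 2 * b) / (2 * pi) * ker b (1 - 2 * b) psi theta X t) +i*
  (t `^ (1 - 2 * b) / (2 * pi) * ker b (1 - 2 * b) psi (theta - pi / 2) X t).
Proof.
move=> /andP[b0 b3] dec X0 t0 w0 Hz.
set q := 1 - 2 * b.
have q0 : 0 < q by rewrite /q; lra.
have pi0 : (pi : R) != 0 by rewrite gt_eqF// pi_gt0.
pose A k : R := (- (X / t `^ b)) ^+ k / k`!%:R * (Gamma (- b * k%:R + 2 * b))^-1.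
have SE n : w * \sum_(0 <= k < n) (z ^+ k / k`!%:R * ((Gamma (- b * k%:R + 2 * b))^-1)%:C) =
    \sum_(0 <= k < n) ((A k)%:C * cis (theta + k%:R * psi)).
  rewrite big_distrr/=; apply: eq_bigr => k _; rewrite !mulrA Hz /A.
  have -> : (k`!%:R : R[i])^-1 = ((k`!%:R : R)^-1)%:C.
    by rewrite (fmorphV (real_complex R)) (rmorph_nat (real_complex R)).
  rewrite !(rmorphM (real_complex R)); ring.
have AE k : A k * 1 = t `^ q / (2 * pi) * ((- X) ^+ k / k`!%:R *
     (euler_gamma (q + b * k%:R) * t `^ (- (q + b * k%:R))) *
     (2 * sin (pi * (q + b * k%:R)))).
  have P0 : 0 < q + b * k%:R by rewrite ltr_pwDl// mulr_ge0 ?(ltW b0).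
  rewrite /A (_ : - b * k%:R + 2 * b = 1 - (q + b * k%:R)); last by rewrite /q; ring.
  rewrite (Gamma_inv P0) opprD (powRDp (- q) (- (b * k%:R)) t0).
  rewrite -mulNr exprMn exprVn.
  rewrite (_ : t `^ (- (b * k%:R)) = (t `^ b ^+ k)^-1); last first.
    by rewrite powRN powRrM powR_mulrn ?powR_ge0.
  have tq : t `^ q * t `^ (- q) = 1 by rewrite -powRDp// subrr powRr0.
  move: (pi : R) pi0 (sin _) (euler_gamma _) => p p0 s G.
  transitivity ((- X) ^+ k / t `^ b ^+ k / k`!%:R * (G * s / p) * (t `^ q * t `^ (- q))).
    by rewrite tq; ring.
  have f0 : (k`!%:R : R) != 0 by rewrite pnatr_eq0 -lt0n fact_gt0.
  have T0 : t `^ b ^+ k != 0 by rewrite expf_neq0// gt_eqF// powR_gt0.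
  by field; rewrite ?f0 ?T0 ?p0.
have half (th : R) : \sum_(0 <= k < n) (A k * cos (th + k%:R * psi)) @[n --> \oo] -->
    t `^ q / (2 * pi) * ker b q psi th X t.
  have -> : (fun n => \sum_(0 <= k < n) (A k * cos (th + k%:R * psi))) =
    (fun n => t `^ q / (2 * pi) * \sum_(0 <= k < n) ((- X) ^+ k / k`!%:R *
     (euler_gamma (q + b * k%:R) * t `^ (- (q + b * k%:R))) *
     (2 * sin (pi * (q + b * k%:R)) * cos (th + k%:R * psi)))).
    apply/funext => n; rewrite big_distrr/=; apply: eq_bigr => k _.
    by rewrite -[A k]mulr1 AE; ring.
  by apply: cvgM; [exact: cvg_cst|exact: ker_series].
have ReD (x y : R[i]) : complex.Re (x + y) = complex.Re x + complex.Re y.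
  by case: x y => ? ? [].
have ImD (x y : R[i]) : complex.Im (x + y) = complex.Im x + complex.Im y.
  by case: x y => ? ? [].
have ReS n : complex.Re (\sum_(0 <= k < n) ((A k)%:C * cis (theta + k%:R * psi))) =
    \sum_(0 <= k < n) (A k * cos (theta + k%:R * psi)).
  elim: n => [|n IH]; first by rewrite !big_nil.
  by rewrite big_nat_recr// [RHS]big_nat_recr// ReD IH realM_cis.
have ImS n : complex.Im (\sum_(0 <= k < n) ((A k)%:C * cis (theta + k%:R * psi))) =
    \sum_(0 <= k < n) (A k * cos (theta - pi / 2 + k%:R * psi)).
  elim: n => [|n IH]; first by rewrite !big_nil.
  rewrite big_nat_recr// [RHS]big_nat_recr// ImD IH realM_cis.
  have E : theta - pi / 2 + n%:R * psi = theta + n%:R * psi - pi / 2 by rewrite addrAC.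
  by rewrite E cosBpihalf.
apply: wright_limit => //.
  by under eq_fun do rewrite SE ReS; exact: half.
by under eq_fun do rewrite SE ImS; exact: half.
Qed.

End WrightLimit.

(** * Fractional derivatives of potentials *)

Local Opaque euler_gamma halfker ker.

Section Extension.
Context {R : realType}.
Implicit Types (tau : R -> R) (T : R).

(** Composing with the projection onto [[0, T]] gives a density that is continuous and bounded on
    the whole line, as the potentials require. Agreement on the open interval is enough, as only
    integrals over parts of [(0, T)] occur. *)
Lemma clamp_extension tau T : 0 < T -> {within `[0, T], continuous tau} ->
  exists2 sigma : R -> R, continuous sigma /\ exists M, forall x, `|sigma x| <= M &
    forall x, 0 < x < T -> sigma x = tau x.
Proof.
move=> T0 ct; pose c (x : R) := Num.min (Num.max x 0) T.
have cI x : `[0, T]%classic (c x).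
  by rewrite /= in_itv/= /c le_min ge_min le_max !lexx !orbT/= (ltW T0).
exists (tau \o c); last first.
  by move=> x /andP[x0 xT]; rewrite /= /c (max_l (ltW x0)) (min_l (ltW xT)).
split.
  move=> x; have cc : {for x, continuous c}.
    by apply: continuous_min; [apply: continuous_max|]; [exact: cvg_id|exact: cvg_cst..].
  move/subspace_continuousP : ct => /(_ (c x) (cI x)) ct.
  have cw : c y @[y --> x] --> within `[0, T]%classic (nbhs (c x)).
    move=> U hU; have := cc _ hU; rewrite /= !nbhs_simpl/=.
    by apply: filterS => y Uy; exact: Uy (cI y).
  exact: cvg_comp cw ct.
have [u _ hu] := EVT_max (ltW T0) ct.
have [v _ hv] := EVT_min (ltW T0) ct.
exists (Num.max `|tau u| `|tau v|) => x /=; have := cI x => /= xI.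
rewrite ler_norml lerNl !le_max; apply/andP; split; apply/orP.
  by right; have := hv _ xI; have := ler_norm (- tau v); rewrite normrN; lra.
by left; apply: le_trans (ler_norm _); exact: hu.
Qed.

End Extension.

Section KernelSolution.
Context {R : realType}.
Context (b psi T M : R) (tau : R -> R).
Context (b3 : 0 < b < 1 / 3) (dec : decaying b psi).
Context (ctau : continuous tau) (tauM : forall x, `|tau x| <= M).
Implicit Types (q theta X s t c e a x y : R).

Local Notation u q theta := (potential b q psi theta tau T).

Lemma potential_bounded q theta X : 0 < q -> 0 < X ->
  exists C, forall s, `|u q theta X s| <= C.
Proof.
move=> q0 X0; have [C C0 CP] := ker_shift_le dec tauM theta q0 X0.
exists (\int[leb]_(eta in `]0, T[) C) => s; apply: le_normr_Rint.
- exact: mset_itv.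
- by apply: mfunTS; exact: measurable_ker_shift.
- exact: intble_cst.
- by move=> x _; exact: CP.
Qed.

(** The derivative of [f] has the exponent [q + 1]. After [s -> t - s] the weight [(t - s)^(- 3 b)]
    is [v^(g-1)] with [g = 1 - 3 b], so [potential_frac] lowers the exponent to [q + 1 - g = 1 + b],
    and its Gamma factor cancels the one in [caputo]. *)
Lemma caputo_potential theta X t c (f : R -> R) : 0 < X -> 0 < t <= T ->
  (forall s, 0 < s <= T -> f s = c * u (1 - 2 * b) theta X s) ->
  caputo_derivable (3 * b) f t /\
  caputo (3 * b) f t = c * u (1 + b) theta X t.
Proof.
move=> X0 /andP[t0 tT] fE; have /andP[b0 b13] := b3.
pose q := 1 - 2 * b; pose g := 1 - 3 * b.
have q0 : 0 < q by rewrite /q; lra.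
have q1 : 0 < q + 1 by rewrite addr_gt0.
have g0 : 0 < g by rewrite /g; lra.
have gq : g < q + 1 by rewrite /g /q; lra.
have G0 : euler_gamma g != 0 by apply: euler_gamma_neq0; rewrite /g; lra.
have mt : msetR (`]0, t[%classic : set R) by exact: mset_itv.
have df s : 0 < s < t -> is_derive s 1 f (c * u (q + 1) theta X s).
  move=> /andP[s0 st].
  have h := derM (derC s c) (potential_ds T dec ctau tauM theta s q0 X0).
  have h' : is_derive s 1 (fun s => c * u q theta X s) (c * u (q + 1) theta X s).
    by apply: (der_eq h); rewrite mulr0 addr0.
  (* The formula for [f] is available only on [(0, T]]; [0 < s < t <= T] leaves a whole
     neighbourhood of [s]. *)
  apply: near_eq_is_derive h'; near=> y; rewrite fE//; apply/andP; split.
    by near: y; exact: lt_nbhsr.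
  by apply/ltW; near: y; apply: lt_nbhsl; exact: lt_le_trans tT.
pose F (v : R) := c * (v `^ (g - 1) * u (q + 1) theta X (t - v)).
have cu s : {for s, continuous (u (q + 1) theta X)}.
  exact: der_cont (potential_ds T dec ctau tauM theta s q1 X0).
have cut (v : R) : {for v, continuous (fun v : R => u (q + 1) theta X (t - v))}.
  apply: (@cont_comp R (u (q + 1) theta X) (fun v : R => t - v)) => //.
  by apply: contB; [exact: cont_cst|exact: cvg_id].
have [C CP] := potential_bounded theta q1 X0.
have [iF IF] : intble `]0, t[ (fun s => F (t - s)) /\
    \int[leb]_(s in `]0, t[) F (t - s) = \int[leb]_(s in `]0, t[) F s.
  apply: (@Rint_reflect R F (`|c| * C) g) => //.
  - move=> v v0 _; apply: (@contM R (fun=> c) (fun v => v `^ (g - 1) * u (q + 1) theta X (t - v))).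
      exact: cont_cst.
    apply: (@contM R (fun v => v `^ (g - 1)) (fun v => u (q + 1) theta X (t - v))); last exact: cut.
    exact: der_cont (derpow (g - 1) v0).
  - apply: measurable_funM; first exact: measurable_cst.
    apply: measurable_funM; first exact: measurable_powR.
    by apply: continuous_measurable_fun => v; exact: cut.
  move=> v _ _; rewrite /F !normrM (ger0_norm (powR_ge0 _ _)) -mulrA ler_wpM2l//.
  by rewrite mulrC; apply: ler_wpM2r; [exact: powR_ge0|exact: CP].
have FE s : `]0, t[%classic s -> F (t - s) = caputo_integrand (3 * b) f t s.
  rewrite /= in_itv/= => st; have [_ fs] := df s st.
  rewrite /caputo_integrand derive1E fs /F subKr -powRN.
  by rewrite (_ : g - 1 = - (3 * b)); [ring|rewrite /g; ring].
split.
  split; first by move=> s /df[].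
  exact: intble_eq mt FE iF.
have IE : \int[leb]_(s in `]0, t[) caputo_integrand (3 * b) f t s =
    \int[leb]_(s in `]0, t[) F s.
  by rewrite -IF; apply: eq_Rintegral => s /set_mem st; rewrite FE.
have E := potential_frac dec ctau tauM theta g0 gq X0 t0 tT.
have iFv : intble `]0, t[ (fun v : R => v `^ (g - 1) * u (q + 1) theta X (t - v)).
  apply: (intble_dom mt _ (intbleZ C mt (intble_powR_oo t g0))).
    apply: mfunTS; apply: measurable_funM; first exact: measurable_powR.
    by apply: continuous_measurable_fun => v; exact: cut.
  move=> v _; rewrite normrM (ger0_norm (powR_ge0 _ _)) mulrC.
  by apply: ler_wpM2r; [exact: powR_ge0|exact: CP].
have ZE : \int[leb]_(s in `]0, t[) F s = c * (euler_gamma g * u (q + 1 - g) theta X t).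
  by rewrite -E; exact: RintegralZl.
have GE : Gamma (1 - 3 * b) = euler_gamma g by rewrite /Gamma -/g g0.
rewrite /caputo IE ZE GE.
have -> : q + 1 - g = 1 + b by rewrite /q /g; ring.
rewrite mulrCA (mulKf G0); reflexivity.
Unshelve. all: by end_near. Qed.

(** In use [e] is 1 or -1, so that [e (y - a)] is the distance of [y] from [a]. Each derivative
    contributes [-1] from [potential_dX] and [e] from the chain rule. As the condition on [y] is
    open, the formula for one derivative holds near [y] and can be differentiated again. *)
Lemma derive1n_potential theta t c e a (f : R -> R) q : 0 < q ->
  (forall y, 0 < e * (y - a) -> f y = c * u q theta (e * (y - a)) t) ->
  forall n y, 0 < e * (y - a) ->
  derive1n n f y = c * (- e) ^+ n * u (q + n%:R * b) (theta + n%:R * psi) (e * (y - a)) t /\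
  derivable (derive1n n f) y 1.
Proof.
move=> q0 fE; have /andP[b0 _] := b3.
pose F n y := c * (- e) ^+ n * u (q + n%:R * b) (theta + n%:R * psi) (e * (y - a)) t.
have dF n y : 0 < e * (y - a) -> is_derive y 1 (F n) (F n.+1 y).
  move=> ya; have qn : 0 < q + n%:R * b by rewrite ltr_pwDl// mulr_ge0// ltW.
  have h := potential_dX T dec ctau tauM (theta + n%:R * psi) t qn ya.
  have h1 : is_derive y 1 (fun y : R => e * (y - a)) e.
    by apply: (der_eq (derM (derC y e) (derD (derI y) (derC y (- a))))); ring.
  have h2 := @is_derive1_comp R (fun X => u (q + n%:R * b) (theta + n%:R * psi) X t)
    (fun y : R => e * (y - a)) y _ _ h h1.
  apply: (der_eq (derM (derC y (c * (- e) ^+ n)) h2)).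
  rewrite /F mulr0 addr0 exprSr.
  have -> : q + n.+1%:R * b = q + n%:R * b + b by rewrite -natr1; ring.
  have -> : theta + n.+1%:R * psi = theta + n%:R * psi + psi by rewrite -natr1; ring.
  by ring.
have near_pos y : 0 < e * (y - a) -> \forall z \near y, 0 < e * (z - a).
  move=> ya; have ce : {for y, continuous (fun y : R => e * (y - a))}.
    apply: contM; first exact: cont_cst.
    by apply: contB; [exact: cvg_id|exact: cont_cst].
  by move/cvgr_gt : ce; exact.
have fn n y : 0 < e * (y - a) -> derive1n n f y = F n y /\ is_derive y 1 (derive1n n f) (F n.+1 y).
  elim: n y => [|n IH] y ya.
    have f0 z : 0 < e * (z - a) -> f z = F 0%N z.
      move=> za; rewrite (fE z za) /F expr0 mulr1 !mul0r !addr0; reflexivity.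
    split; first exact: f0.
    apply: near_eq_is_derive (dF 0%N y ya); apply: filterS (near_pos y ya) => z za.
    exact: esym (f0 z za).
  have E z : 0 < e * (z - a) -> derive1n n.+1 f z = F n.+1 z.
    by move=> za; rewrite derive1nS derive1E; have [_ [_ ->]] := IH z za.
  split; first exact: E.
  apply: near_eq_is_derive (dF n.+1 y ya); apply: filterS (near_pos y ya) => z za.
  exact: esym (E z za).
by move=> n y ya; have [fE' [dE _]] := fn n y ya; split; [exact: fE'|exact: dE].
Qed.

(** The Caputo derivative and the third derivative in [x] both have the exponent [1 + b], so only
    phases and signs remain to be compared. That comparison is the first hypothesis, in which
    [- e^3] is the sign from three differentiations. *)
Lemma potential_solves theta c e a x t (w : R -> R -> R) :
  (forall X s, 0 < X -> - e ^+ 3 * ker b (1 + b) psi (theta + 3%:R * psi) X s =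
    ker b (1 + b) psi theta X s) ->
  0 < e * (x - a) -> 0 < t <= T ->
  (forall y s, 0 < e * (y - a) -> 0 < s <= T ->
     w y s = c * u (1 - 2 * b) theta (e * (y - a)) s) ->
  solves_at (3 * b) w x t.
Proof.
move=> He xa tT wE; have /andP[b0 b13] := b3.
have q0 : 0 < 1 - 2 * b by lra.
have [h1 h2] := caputo_potential xa tT (wE x ^~ xa).
have h3 := @derive1n_potential theta t c e a (w ^~ t) _ q0 (fun y ya => wE y t ya tT).
split=> //.
  have ce : {for x, continuous (fun y : R => e * (y - a))}.
    apply: contM; first exact: cont_cst.
    by apply: contB; [exact: cvg_id|exact: cont_cst].
  move/cvgr_gt : ce => /(_ _ xa); apply: filterS => y ya n _.
  by have [] := h3 n y ya.
have [-> _] := h3 3%N x xa; rewrite h2.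
have -> : 1 - 2 * b + 3%:R * b = 1 + b by ring.
apply/eqP; rewrite subr_eq0; apply/eqP; rewrite -mulrA; congr (_ * _).
have E : forall eta, ker b (1 + b) psi theta (e * (x - a)) (t - eta) * tau eta =
    (- e) ^+ 3 * (ker b (1 + b) psi (theta + 3%:R * psi) (e * (x - a)) (t - eta) * tau eta).
  by move=> eta; rewrite -(He _ _ xa); ring.
rewrite /potential -RintegralZl; [|exact: mset_itv|]; last first.
  by apply: intble_ker_shift => //; lra.
by apply: eq_Rintegral => eta _; exact: E.
Qed.

End KernelSolution.

Local Opaque euler_gamma halfker ker.

(** * [G] and [V] in terms of the kernels *)

Section Kernels.
Context {R : realType}.
Implicit Types (b t y x : R).

Lemma decaying0 b : 0 < b < 1 / 3 -> decaying b 0.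
Proof.
move=> /andP[b0 b3]; have pi0 := pi_gt0 R.
have h0 : 0 < b * (pi / 2) by rewrite mulr_gt0 ?divr_gt0.
have h1 : b * (pi / 2) < (1 / 3) * (pi / 2) by rewrite ltr_pM2r ?divr_gt0.
have : 0 < cos (b * (pi / 2)) by apply: cos_gt0_pihalf; lra.
by move=> h; split; [lra|rewrite add0r|rewrite oppr0 add0r].
Qed.

(** The critical ray has the angle [pi / 3 + b pi / 2], which stays below [pi / 2] exactly for
    [b < 1/3], that is, for [alpha < 1]. *)
Lemma decaying_third b : 0 < b < 1 / 3 -> decaying b (- (pi / 3)).
Proof.
move=> /andP[b0 b3]; have pi0 := pi_gt0 R.
have h0 : 0 < b * (pi / 2) by rewrite mulr_gt0 ?divr_gt0.
have h1 : b * (pi / 2) < (1 / 3) * (pi / 2) by rewrite ltr_pM2r ?divr_gt0.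
split; [lra|..]; by apply: cos_gt0_pihalf; lra.
Qed.

Lemma cos_2pi3 : cos (2 * pi / 3) = - (1 / 2) :> R.
Proof.
have pi0 := pi_gt0 R; pose x : R := pi / 3.
have sx : 0 < sin x by apply: sin_gt0_pi; rewrite /x; lra.
(* As [2 pi / 3 = pi - pi / 3], the doubling formula reads [2 sin x cos x = sin x], whence
   [cos x = 1/2]. *)
have h1 : sin (x + x) = sin x.
  rewrite (_ : x + x = pi - x); last by rewrite /x; field.
  by rewrite sinB sinpi cospi; ring.
have cx : cos x = 1 / 2.
  apply: (mulfI (lt0r_neq0 sx)); move: h1; rewrite sinD; lra.
have s2 := cos2Dsin2 x.
rewrite (_ : 2 * pi / 3 = x + x); last by rewrite /x; field.
by rewrite cosD cx; move: s2; rewrite cx; nra.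
Qed.

(** The origin of [psi = - pi / 3]: since [omega3 = - e^(- i pi / 3)], the powers of [omega3 Y] are
    those of [- Y] with the phase [- k pi / 3]. The factor in front contributes
    [theta = 2 pi / 3]. *)
Lemma omega3_power (Y : R) k : omega3 R * (omega3 R * (Y%:C)%C) ^+ k =
  (((- Y) ^+ k)%:C)%C * cis (2 * pi / 3 + k%:R * - (pi / 3)).
Proof.
have E : omega3 R = cis (2 * pi / 3) by [].
elim: k => [|k IH]; first by rewrite !expr0 mulr1 mul0r addr0 E mul1r.
rewrite !exprSr mulrA IH E.
have -> : 2 * pi / 3 + k.+1%:R * - (pi / 3) =
    2 * pi / 3 + k%:R * - (pi / 3) + 2 * pi / 3 - pi :> R.
  by rewrite -natr1; field.
set th := 2 * pi / 3 + _.
have -> : cis (th + 2 * pi / 3 - pi) = - cis (th + 2 * pi / 3).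
  rewrite -[in RHS](subrK pi (th + _)) /cis cosDpi sinDpi.
  by apply/eqP; rewrite eq_complex /= !opprK !eqxx.
rewrite -(cisD th (2 * pi / 3)) (rmorphM (real_complex R)) (rmorphN (real_complex R)); ring.
Qed.

Lemma cvg_dnbhs_left_right (f : R -> R) (p l : R) :
  f x @[x --> p^'+] --> l ->
  f x @[x --> p^'-] --> l ->
  f x @[x --> p^'] --> l.
Proof. 
move=> hr hl U lU.
have Hr : \forall x \near p, p < x -> U (f x) := hr U lU.
have Hl : \forall x \near p, x < p -> U (f x) := hl U lU.
suff : \forall x \near p, x != p -> U (f x) by [].
by apply: filterS2 Hr Hl => x xr xl; rewrite neq_lt => /orP[/xl|/xr].
Qed.

(** The argument [y / t^b] equals [- X / t^b] with [X = - y], so no phase appears. The powers of [t]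
    cancel, and [6 pi] is the product of the 3 in [G_off0] and the [2 pi] of [wright_ker]. *)
Lemma G_off0_neg b y t : 0 < b < 1 / 3 -> 0 < t -> y < 0 ->
  G_off0 (3 * b) y t = (6 * pi)^-1 * ker b (1 - 2 * b) 0 0 (- y) t.
Proof.
move=> b3 t0 y0; rewrite /G_off0 y0 /wrightG.
have -> : 3 * b / 3 = b by field.
have -> : 2 * (3 * b) / 3 = 2 * b by field.
have y0' : 0 < - y by rewrite oppr_gt0.
have := @wright_ker R b 0 0 (- y) t ((y / t `^ b)%:C)%C 1 b3 (decaying0 b3) y0' t0 (oner_neq0 _).
rewrite mul1r => -> /=.
  have T0 : t `^ (1 - 2 * b) != 0 by rewrite gt_eqF// powR_gt0.
  have pi0 : (pi : R) != 0 by rewrite gt_eqF// pi_gt0.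
  move: (t `^ _) (pi : R) (ker _ _ _ _ _ _) T0 pi0 => p w K p0 w0.
  by field; rewrite ?p0 ?w0.
move=> k; rewrite mulr0 addr0 /cis cos0 sin0 mulNr opprK mul1r (rmorphXn (real_complex R)).
by rewrite mulr1.
Qed.

Lemma rotated_wright_ker b y t : 0 < b < 1 / 3 -> 0 < t -> 0 < y ->
  rotated_wright (3 * b) y t =
  ((t `^ (1 - 2 * b) / (2 * pi) * ker b (1 - 2 * b) (- (pi / 3)) (2 * pi / 3) y t) +i*
  (t `^ (1 - 2 * b) / (2 * pi) * ker b (1 - 2 * b) (- (pi / 3)) (pi / 6) y t))%C.
Proof.
move=> b3 t0 y0; rewrite /rotated_wright /wrightG.
have -> : 3 * b / 3 = b by field.
have -> : 2 * (3 * b) / 3 = 2 * b by field.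
rewrite (@wright_ker R b (- (pi / 3)) (2 * pi / 3) y t _ _ b3 (decaying_third b3) y0 t0).
- by have -> : 2 * pi / 3 - pi / 2 = pi / 6 :> R by field.
- rewrite eq_complex/= cos_2pi3; lra.
by move=> k; exact: omega3_power.
Qed.

Lemma G_off0_pos b y t : 0 < b < 1 / 3 -> 0 < t -> 0 < y ->
  G_off0 (3 * b) y t = - (3 * pi)^-1 * ker b (1 - 2 * b) (- (pi / 3)) (2 * pi / 3) y t.
Proof.
move=> b3 t0 y0; rewrite /G_off0 ltNge (ltW y0)/= rotated_wright_ker//=.
have -> : 2 * (3 * b) / 3 = 2 * b by field.
have T0 : t `^ (1 - 2 * b) != 0 by rewrite gt_eqF// powR_gt0.
have pi0 : (pi : R) != 0 by rewrite gt_eqF// pi_gt0.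
move: (t `^ _) (pi : R) (ker _ _ _ _ _ _) T0 pi0 => p w K p0 w0.
by field; rewrite ?p0 ?w0.
Qed.

Lemma V_off0_pos b y t : 0 < b < 1 / 3 -> 0 < t -> 0 < y ->
  V_off0 (3 * b) y t = (6 * pi)^-1 * ker b (1 - 2 * b) (- (pi / 3)) (pi / 6) y t.
Proof.
move=> b3 t0 y0; rewrite /V_off0 rotated_wright_ker//=.
have -> : 2 * (3 * b) / 3 = 2 * b by field.
have T0 : t `^ (1 - 2 * b) != 0 by rewrite gt_eqF// powR_gt0.
have pi0 : (pi : R) != 0 by rewrite gt_eqF// pi_gt0.
move: (t `^ _) (pi : R) (ker _ _ _ _ _ _) T0 pi0 => p w K p0 w0.
by field; rewrite ?p0 ?w0.
Qed.

(** The one-sided limits agree because [- 2 cos (2 pi / 3) = 1 = cos 0], so the [lim] defining [G]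
    at 0 is a genuine two-sided limit. *)
Lemma G_at0 b : 0 < b < 1 / 3 -> exists c, forall t, 0 < t ->
  G (3 * b) 0 t = c * t `^ (2 * b - 1).
Proof.
move=> b3; have q0 : 0 < 1 - 2 * b by lra.
exists ((6 * pi)^-1 * (euler_gamma (1 - 2 * b) * (2 * sin (pi * (1 - 2 * b))))) => t t0.
have -> : 2 * b - 1 = - (1 - 2 * b) by ring.
set q := 1 - 2 * b; rewrite /G eqxx.
apply: cvg_lim; first exact: Rhausdorff.
apply: cvg_dnbhs_left_right.
  have h := @ker_cvg0 R b q (- (pi / 3)) (2 * pi / 3) t (decaying_third b3) q0 t0.
  have h2 : (- (3 * pi)^-1 * ker b q (- (pi / 3)) (2 * pi / 3) y t) @[y --> 0^'+] -->
     - (3 * pi)^-1 * (euler_gamma q * t `^ (- q) * (2 * sin (pi * q) * cos (2 * pi / 3))).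
    by apply: cvgM; [exact: cvg_cst|exact: h].
  rewrite cos_2pi3 in h2.
  have pi0 : (pi : R) != 0 by rewrite gt_eqF// pi_gt0.
  have E : - (3 * pi)^-1 * (euler_gamma q * t `^ (- q) * (2 * sin (pi * q) * - (1 / 2))) =
    (6 * pi)^-1 * (euler_gamma q * (2 * sin (pi * q))) * t `^ (- q).
    move: (pi : R) pi0 (sin _) (euler_gamma _) (t `^ _) => w w0 s G p.
    by field; rewrite ?w0.
  rewrite -E; apply: (cvg_trans _ h2); apply: near_eq_cvg; near=> y.
  rewrite G_off0_pos//; near: y; exact: nbhs_right_gt.
have h := @ker_cvg0 R b q 0 0 t (decaying0 b3) q0 t0.
have h2 : ((6 * pi)^-1 * ker b q 0 0 y t) @[y --> 0^'+] -->
   (6 * pi)^-1 * (euler_gamma q * t `^ (- q) * (2 * sin (pi * q) * cos 0)).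
  by apply: cvgM; [exact: cvg_cst|exact: h].
have E : (6 * pi)^-1 * (euler_gamma q * t `^ (- q) * (2 * sin (pi * q) * 1)) =
    (6 * pi)^-1 * (euler_gamma q * (2 * sin (pi * q))) * t `^ (- q).
  move: (sin _) (euler_gamma _) (t `^ _) (_^-1) => s G p w; ring.
rewrite cos0 E in h2.
apply/cvg_at_leftNP; rewrite oppr0.
apply: (cvg_trans _ h2); apply: near_eq_cvg; near=> y.
have y0 : 0 < y by near: y; exact: nbhs_right_gt.
by rewrite /= G_off0_neg ?opprK// oppr_lt0.
Unshelve. all: by end_near. Qed.

Lemma V_at0 b : 0 < b < 1 / 3 -> exists c, forall t, 0 < t ->
  V (3 * b) 0 t = c * t `^ (2 * b - 1).
Proof.
move=> b3; have q0 : 0 < 1 - 2 * b by lra.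
exists ((6 * pi)^-1 * (euler_gamma (1 - 2 * b) * (2 * sin (pi * (1 - 2 * b)) * cos (pi / 6)))) => t t0.
have -> : 2 * b - 1 = - (1 - 2 * b) by ring.
set q := 1 - 2 * b; rewrite /V eqxx.
apply: cvg_lim; first exact: Rhausdorff.
have h := @ker_cvg0 R b q (- (pi / 3)) (pi / 6) t (decaying_third b3) q0 t0.
have h2 : ((6 * pi)^-1 * ker b q (- (pi / 3)) (pi / 6) y t) @[y --> 0^'+] -->
   (6 * pi)^-1 * (euler_gamma q * t `^ (- q) * (2 * sin (pi * q) * cos (pi / 6))).
  by apply: cvgM; [exact: cvg_cst|exact: h].
have E : (6 * pi)^-1 * (euler_gamma q * t `^ (- q) * (2 * sin (pi * q) * cos (pi / 6))) =
    (6 * pi)^-1 * (euler_gamma q * (2 * sin (pi * q) * cos (pi / 6))) * t `^ (- q).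
  move: (sin _) (cos _) (euler_gamma _) (t `^ _) (_^-1) => s c G p w; ring.
rewrite E in h2.
apply: (cvg_trans _ h2); apply: near_eq_cvg; near=> y.
rewrite V_off0_pos//; near: y; exact: nbhs_right_gt.
Unshelve. all: by end_near. Qed.

End Kernels.

Local Opaque euler_gamma halfker ker.

(** * Behaviour as [t] tends to 0 *)

Section Limits.
Context {R : realType}.
Implicit Types (b psi q g theta X s t c M T : R) (tau sigma : R -> R).

(** Split the exponent as [g - 1 = g / 2 + (g / 2 - 1)]. The first part is at most [t^(g/2)] and
    tends to 0, while the second is still integrable, with integral at most [K] for [t <= 1]. *)
Lemma weak_singularity_cvg0 g M sigma : 0 < g < 1 -> continuous sigma ->
  (forall x, `|sigma x| <= M) ->
  \int[leb]_(eta in `]0, t[) ((t - eta) `^ (g - 1) * sigma eta) @[t --> 0^'+] --> (0 : R).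
Proof.
move=> /andP[g0 g1] cs sM; have M0 : 0 <= M := le_trans (normr_ge0 _) (sM 0).
have h0 : 0 < g / 2 by rewrite divr_gt0.
pose K : R := \int[leb]_(v in `]0, 1[) v `^ (g / 2 - 1).
apply: (@cvg0_dom R _ _ _ _ (fun t => M * K * t `^ (g / 2))); last first.
  rewrite -[X in _ --> X](mulr0 (M * K)); apply: cvgM; first exact: cvg_cst.
  exact: powR_cvg0.
near=> t.
have t0 : 0 < t by near: t; exact: nbhs_right_gt.
have t1 : t <= 1 by near: t; exact: nbhs_right_le.
have mt : msetR (`]0, t[%classic : set R) by exact: mset_itv.
have m1 : msetR (`]0, 1[%classic : set R) by exact: mset_itv.
have [ir Ir] := @Rint_reflect R (fun v => v `^ (g / 2 - 1)) 1 (g / 2) t t0 h0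
  (fun v v0 _ => der_cont (derpow (g / 2 - 1) v0)) (measurable_powR _)
  (fun v _ _ => ltac:(by rewrite mul1r ger0_norm ?powR_ge0)).
have mr : measurable_fun setT (fun eta : R => (t - eta) `^ (g - 1)).
  by apply: (measurableT_comp (measurable_powR _)); exact: measurable_funB.
have B : `|\int[leb]_(eta in `]0, t[) ((t - eta) `^ (g - 1) * sigma eta)| <=
    \int[leb]_(eta in `]0, t[) ((M * t `^ (g / 2)) * (t - eta) `^ (g / 2 - 1)).
  apply: le_normr_Rint; first exact: mt.
  - apply: mfunTS; apply: measurable_funM; first exact: mr.
    exact: continuous_measurable_fun.
  - exact: intbleZ.
  move=> eta /=; rewrite in_itv/= => /andP[e0 et].
  have te : 0 < t - eta by rewrite subr_gt0.
  rewrite normrM (ger0_norm (powR_ge0 _ _)) mulrC -mulrA.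
  apply: ler_pM; [exact: normr_ge0|exact: powR_ge0|exact: sM|].
  rewrite (_ : g - 1 = g / 2 + (g / 2 - 1)); last by field.
  rewrite (powRDp (g / 2) (g / 2 - 1) te); apply: ler_wpM2r; first exact: powR_ge0.
  have tet : t - eta <= t by rewrite gerBl ltW.
  by apply: (ge0_ler_powR (ltW h0) (ltW te) (ltW t0) tet).
apply: le_trans B _; rewrite (RintegralZl _ mt ir) Ir mulrAC.
apply: ler_wpM2r; first exact: powR_ge0.
apply: ler_wpM2l; first exact: M0.
apply: le_Rintegral_subset; [exact: m1|exact: mt|..].
- by apply: subset_itvl; rewrite bnd_simp.
- exact: intble_powR_oo.
by move=> x _; exact: powR_ge0.
Unshelve. all: by end_near. Qed.

(** The potential is differentiable in [s] on the whole line, hence continuous at 0, and it vanishes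
    there because the kernel does so at the times [- eta < 0]. *)
Lemma potential_cvg0 b psi q theta T M sigma X : decaying b psi -> 0 < q -> 0 < X ->
  continuous sigma -> (forall x, `|sigma x| <= M) ->
  potential b q psi theta sigma T X s @[s --> 0^'+] --> (0 : R).
Proof.
move=> dec q0 X0 cs sM.
have u0 : potential b q psi theta sigma T X 0 = 0.
  rewrite /potential (@eq_Rintegral _ _ R leb _ (fun=> 0)); last first.
    move=> eta /set_mem/=; rewrite in_itv/= => /andP[e0 _].
    by rewrite ker_le0 ?mul0r//; lra.
  by rewrite Rintegral_cst ?mul0r//; exact: mset_itv.
rewrite -[X in _ --> X]u0; apply: cvg_at_right_filter.
exact: der_cont (potential_ds T dec cs sM theta 0 q0 X0).
Qed.

(** For positive time each term of [ker_series] contains [theta] only through [cos (theta + k psi)],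
    which changes sign; for nonpositive time both sides are 0. *)
Lemma kerBpi b psi q theta X s : decaying b psi -> 0 < q -> 0 < X ->
  ker b q psi (theta - pi) X s = - ker b q psi theta X s.
Proof.
move=> dec q0 X0; have [s0|s0] := leP s 0; first by rewrite !ker_le0 ?oppr0.
have := @ker_series R b q psi (theta - pi) X s dec q0 X0 s0.
have h2 := @ker_series R b q psi theta X s dec q0 X0 s0.
have E (k : nat) : cos (theta - pi + k%:R * psi) = - cos (theta + k%:R * psi).
  have -> : theta + k%:R * psi = theta - pi + k%:R * psi + pi by ring.
  by rewrite cosDpi opprK.
under eq_fun do under eq_bigr do rewrite E !mulrN.
under eq_fun do rewrite sumrN.
by move=> h1; apply: (@cvg_unique _ (@Rhausdorff R) _ _ _ _ h1); exact: cvgN.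
Qed.

(** Passes from the given density on [(0, s)] to its extension on [(0, T)]. The formula for [K] is
    needed at positive times only, since [eta < s] on the left. *)
Lemma Rint_potential b psi q theta T M c X s tau sigma (K : R -> R) :
  decaying b psi -> 0 < q -> 0 < X ->
  continuous sigma -> (forall x, `|sigma x| <= M) ->
  (forall x, 0 < x < T -> sigma x = tau x) ->
  (forall v, 0 < v -> K v = c * ker b q psi theta X v) -> 0 < s <= T ->
  \int[leb]_(eta in `]0, s[) (K (s - eta) * tau eta) =
  c * potential b q psi theta sigma T X s.
Proof.
move=> dec q0 X0 cs sM st KE /andP[s0 sT].
rewrite -(potential_trunc (psi := psi) _ dec theta q0 X0 s0 sT).
rewrite -RintegralZl; [|exact: mset_itv|exact: intble_ker_shift].
apply: eq_Rintegral => eta /set_mem/=; rewrite in_itv/= => /andP[e0 es].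
by rewrite KE ?subr_gt0// st ?e0 ?(lt_le_trans es sT)// mulrA.
Qed.

End Limits.

Local Opaque euler_gamma halfker ker.

(** * [w1] and [w2] as potentials *)

Section Representation.
Context {R : realType}.
Context (b T M a : R) (tau sigma : R -> R).
Context (b3 : 0 < b < 1 / 3) (T0 : 0 < T).
Context (cs : continuous sigma) (sM : forall x, `|sigma x| <= M).
Context (st : forall x, 0 < x < T -> sigma x = tau x).
Implicit Types (y t s : R).

Local Notation q := (1 - 2 * b).

Let q0 : 0 < q. Proof. by have /andP[b0 b13] := b3; lra. Qed.

Lemma w1_left y s : 0 < -1 * (y - a) -> 0 < s <= T ->
  w1 (3 * b) a tau y s =
  (6 * pi)^-1 * potential b q 0 0 sigma T (-1 * (y - a)) s.
Proof.
move=> ya sT; apply: (Rint_potential (decaying0 b3) q0 ya cs sM st _ sT) => v v0.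
have y0 : y - a < 0 by rewrite -oppr_gt0 -mulN1r.
by rewrite /G lt_eqF// G_off0_neg// mulN1r.
Qed.

Lemma w1_right y s : 0 < 1 * (y - a) -> 0 < s <= T ->
  w1 (3 * b) a tau y s =
  - (3 * pi)^-1 * potential b q (- (pi / 3)) (2 * pi / 3) sigma T (1 * (y - a)) s.
Proof.
move=> ya sT; apply: (Rint_potential (decaying_third b3) q0 ya cs sM st _ sT) => v v0.
by move: ya; rewrite mul1r => ya; rewrite /G gt_eqF// G_off0_pos.
Qed.

Lemma w2_right y s : 0 < 1 * (y - a) -> 0 < s <= T ->
  w2 (3 * b) a tau y s =
  (6 * pi)^-1 * potential b q (- (pi / 3)) (pi / 6) sigma T (1 * (y - a)) s.
Proof.
move=> ya sT; apply: (Rint_potential (decaying_third b3) q0 ya cs sM st _ sT) => v v0.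
by move: ya; rewrite mul1r => ya; rewrite /V gt_eqF// V_off0_pos.
Qed.

(** Here [3 psi = - pi]: the resulting change of sign cancels the one from three differentiations in
    [X]. *)
Lemma ker_third theta (X s : R) : 0 < X ->
  - 1 ^+ 3 * ker b (1 + b) (- (pi / 3)) (theta + 3%:R * - (pi / 3)) X s =
  ker b (1 + b) (- (pi / 3)) theta X s.
Proof.
move=> X0; have -> : theta + 3%:R * - (pi / 3) = theta - pi by field.
rewrite (kerBpi theta s (decaying_third b3) _ X0); last by have /andP[b0 _] := b3; lra.
by rewrite expr1n mulN1r opprK.
Qed.

Lemma w1_solves x t : x != a -> 0 < t <= T -> solves_at (3 * b) (w1 (3 * b) a tau) x t.
Proof.
rewrite neq_lt => /orP[xa|ax] tT.
  apply: (potential_solves b3 (decaying0 b3) cs sM _ _ tT w1_left); last by lra.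
  by move=> X s _; rewrite mulr0 addr0; ring.
apply: (potential_solves b3 (decaying_third b3) cs sM _ _ tT w1_right); last by lra.
by move=> X s; exact: ker_third.
Qed.

Lemma w2_solves x t : a < x -> 0 < t <= T -> solves_at (3 * b) (w2 (3 * b) a tau) x t.
Proof.
move=> ax tT.
apply: (potential_solves b3 (decaying_third b3) cs sM _ _ tT w2_right); last by lra.
by move=> X s; exact: ker_third.
Qed.

Lemma near_horizon : \forall s \near (0 : R)^'+, 0 < s <= T.
Proof.
near=> s; apply/andP; split; near: s; [exact: nbhs_right_gt|exact: nbhs_right_le].
Unshelve. all: by end_near. Qed.

Lemma potential_repr_cvg0 psi theta c X (w : R -> R) : decaying b psi -> 0 < X ->
  (forall s, 0 < s <= T -> w s = c * potential b q psi theta sigma T X s) ->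
  w s @[s --> 0^'+] --> (0 : R).
Proof.
move=> dec X0 wE.
have h : c * potential b q psi theta sigma T X s @[s --> 0^'+] --> (0 : R).
  rewrite -[X in _ --> X](mulr0 c); apply: cvgM; first exact: cvg_cst.
  exact: potential_cvg0 cs sM.
apply: (cvg_trans _ h); apply: near_eq_cvg; apply: filterS near_horizon => s sT.
exact: esym (wE s sT).
Qed.

Lemma weak_repr_cvg0 c (K : R -> R) :
  (forall t, 0 < t -> K t = c * t `^ (2 * b - 1)) ->
  \int[leb]_(eta in `]0, t[) (K (t - eta) * tau eta) @[t --> 0^'+] --> (0 : R).
Proof.
move=> KE.
have g01 : 0 < 2 * b < 1 by have /andP[b0 b13] := b3; lra.
have h : \int[leb]_(eta in `]0, t[) ((t - eta) `^ (2 * b - 1) * (c * sigma eta))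
    @[t --> 0^'+] --> (0 : R).
  apply: (@weak_singularity_cvg0 R (2 * b) (`|c| * M) (fun x => c * sigma x)) => // x.
    by apply: contM; [exact: cont_cst|exact: cs].
  by rewrite normrM ler_wpM2l.
apply: (cvg_trans _ h); apply: near_eq_cvg; apply: filterS near_horizon => s /andP[s0 sT].
apply: eq_Rintegral => eta /set_mem/=; rewrite in_itv/= => /andP[e0 es].
rewrite KE ?subr_gt0// st ?e0 ?(lt_le_trans es sT)//; ring.
Qed.

Lemma w1_cvg0 x : w1 (3 * b) a tau x t @[t --> 0^'+] --> (0 : R).
Proof.
have [xa|ax|->] := ltgtP x a.
- have ya : 0 < -1 * (x - a) by lra.
  exact: (potential_repr_cvg0 (w := w1 (3 * b) a tau x) (decaying0 b3) ya
    (fun s sT => w1_left ya sT)).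
- have ya : 0 < 1 * (x - a) by lra.
  exact: (potential_repr_cvg0 (w := w1 (3 * b) a tau x) (decaying_third b3) ya
    (fun s sT => w1_right ya sT)).
have [c cE] := G_at0 b3; rewrite /w1 subrr; exact: weak_repr_cvg0 cE.
Qed.

Lemma w2_cvg0 x : a <= x -> w2 (3 * b) a tau x t @[t --> 0^'+] --> (0 : R).
Proof.
rewrite le_eqVlt => /orP[/eqP <-|ax].
  have [c cE] := V_at0 b3; rewrite /w2 subrr; exact: weak_repr_cvg0 cE.
have ya : 0 < 1 * (x - a) by lra.
exact: (potential_repr_cvg0 (w := w2 (3 * b) a tau x) (decaying_third b3) ya
    (fun s sT => w2_right ya sT)).
Qed.

End Representation.

Theorem lemma1 (R : realType) (alpha T a : R) (tau1 tau2 : R -> R)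
    (halpha : 0 < alpha < 1) (hT : 0 < T)
    (htau1 : {within `[0, T], continuous tau1})
    (htau2 : {within `[0, T], continuous tau2}) :
  ((forall x t : R, x != a -> 0 < t <= T ->
      solves_at alpha (w1 alpha a tau1) x t) /\
   (forall x t : R, a < x -> 0 < t <= T ->
      solves_at alpha (w2 alpha a tau2) x t)) /\
  ((forall x : R, w1 alpha a tau1 x t @[t --> 0^'+] --> (0 : R)) /\
   (forall x : R, a <= x -> w2 alpha a tau2 x t @[t --> 0^'+] --> (0 : R))).
Proof.
have b3 : 0 < alpha / 3 < 1 / 3 by move: halpha => /andP[]; lra.
have -> : alpha = 3 * (alpha / 3) by field.
have [sigma1 [cs1 [M1 sM1]] st1] := clamp_extension hT htau1.
have [sigma2 [cs2 [M2 sM2]] st2] := clamp_extension hT htau2.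
split; split.
- by move=> x t; exact: w1_solves b3 cs1 sM1 st1 x t.
- by move=> x t; exact: w2_solves b3 cs2 sM2 st2 x t.
- by move=> x; exact: w1_cvg0 b3 hT cs1 sM1 st1 x.
- by move=> x; exact: w2_cvg0 b3 hT cs2 sM2 st2 x.
Qed.
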